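(* Let $d\in\{1,2,3\}$, $T>0$, $r\ge0$, let $f\in\mathcal{C}^\infty(\mathbb{R})$ with $f(0)=0$, and let $(e_\varepsilon)_{\varepsilon\in(0,1]}$ be a net of real numbers such that $|e_\varepsilon|=O(\varepsilon^b)$ as $\varepsilon\to0$ for some $b>0$. Put $B_0=\{x\in\mathbb{R}^d:|x|\le r\}$ and $K_0=\{(t,x)\in[0,T]\times\mathbb{R}^d:|x|\le t+r\}$. Let $(u_{0\varepsilon},u_{1\varepsilon})_{\varepsilon\in(0,1]}$ be nets of smooth functions on $\mathbb{R}^d$ with compact support in $B_0$ such that, for every multi-index $\alpha$, $\sup_{x\in B_0}|\partial^\alpha u_{0\varepsilon}(x)|=O(1)$ and $\sup_{x\in B_0}|\partial^\alpha u_{1\varepsilon}(x)|=O(1)$ as $\varepsilon\to0$. Then there is a moderate net $(u_\varepsilon)_{\varepsilon\in(0,1]}$ of smooth functions on $[0,T]\times\mathbb{R}^d$ which solves $$\partial_t^2u_\varepsilon-\Delta u_\varepsilon=e_\varepsilon f(u_\varepsilon)+O(\varepsilon^\infty),\quad t\in[0,T],\ x\in\mathbb{R}^d,\qquad u_\varepsilon|_{t=0}=u_{0\varepsilon},\quad \partial_tu_\varepsilon|_{t=0}=u_{1\varepsilon},\quad x\in\mathbb{R}^d.$$ Further, any two nets of smooth functions solving this initial value problem with supports in $K_0$ differ by $O(\varepsilon^\infty)$.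
   Context: Smooth functions on $[0,T]\times\mathbb{R}^d$ are real-valued smooth functions on $(0,T)\times\mathbb{R}^d$ all of whose derivatives extend continuously to $[0,T]\times\mathbb{R}^d$. A net $(u_\varepsilon)_{\varepsilon\in(0,1]}$ of such functions is moderate if for all compact $K\subset[0,T]\times\mathbb{R}^d$ and all multi-indices $\alpha$ there is $b\in\mathbb{R}$ with $\sup_{K}|\partial^\alpha u_\varepsilon|=O(\varepsilon^b)$ as $\varepsilon\to0$. The notation $O(\varepsilon^\infty)$ signifies a net $(m_\varepsilon)_{\varepsilon\in(0,1]}$ of smooth functions on $[0,T]\times\mathbb{R}^d$ vanishing to any order, i.e. such that for all compact $K\subset[0,T]\times\mathbb{R}^d$, all multi-indices $\alpha$ and all $a\ge0$, $\sup_{K}|\partial^\alpha m_\varepsilon|=O(\varepsilon^a)$ as $\varepsilon\to0$. $\Delta$ is the Laplacian in $x\in\mathbb{R}^d$. *)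

(* Defs.v *)
From HB Require Import structures.
From mathcomp Require Import all_boot all_order all_algebra.
From mathcomp Require Import all_classical all_reals all_analysis.
From mathcomp Require Import lra.

Set Implicit Arguments.
Unset Strict Implicit.
Unset Printing Implicit Defensive.

Import Order.TTheory GRing.Theory Num.Theory.
Import numFieldNormedType.Exports.

Local Open Scope classical_set_scope.
Local Open Scope ring_scope.

Section PartialDerivatives.
Context {R : realType} {n : nat}.
Implicit Types (u : 'rV[R]_n -> R) (U : set 'rV[R]_n).

(* The library's norm on row vectors is the maximum norm. *)
Definition enorm (x : 'rV[R]_n) : R := Num.sqrt (\sum_(i < n) x ord0 i ^+ 2).

Definition partial (i : 'I_n) u : 'rV[R]_n -> R :=
  fun x => 'D_(delta_mx ord0 i) u x.

Definition partials (s : seq 'I_n) u : 'rV[R]_n -> R := foldr partial u s.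

Definition multi_index := {ffun 'I_n -> nat}.

(* d^a u = d_0^(a 0) (d_1^(a 1) (...)) *)
Definition mderiv (a : multi_index) u : 'rV[R]_n -> R :=
  partials (flatten [seq nseq (a i) i | i <- enum 'I_n]) u.

(* Meant for open U: iterated partial derivatives, taken in any order, exist
   and are continuous on U. *)
Definition smooth_on U u :=
  forall (s : seq 'I_n) x, U x ->
    {for x, continuous (partials s u)} /\
    forall i, derivable (partials s u) x (delta_mx ord0 i).

Definition sup_abs (K : set 'rV[R]_n) u : R := sup [set `|u x| | x in K].

Definition tsupport u : set 'rV[R]_n := closure [set x | u x != 0].

End PartialDerivatives.
Arguments multi_index n : clear implicits.

Definition smooth_fun (R : realType) (f : R -> R) :=
  forall n x, derivable (derive1n n f) x 1.

(* f eps = O(eps ^ b) as eps -> 0, for a net indexed by ]0, 1] *)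
Definition Opow (R : realType) (f : R -> R) (b : R) :=
  f =O_ (0^'+) (fun eps : R => eps `^ b).

(* Points (t, x) of R x R^d are row vectors of length d.+1; coordinate 0 is t. *)
Section Slab.
Context {R : realType} {d : nat}.
Variable T : R.
Implicit Types (z : 'rV[R]_d.+1) (u : 'rV[R]_d.+1 -> R).
Implicit Types w : R -> 'rV[R]_d.+1 -> R.

Definition time z : R := z ord0 ord0.
Definition space z : 'rV[R]_d := col' ord0 z.

Definition slab : set 'rV[R]_d.+1 := [set z | 0 <= time z <= T].
Definition open_slab : set 'rV[R]_d.+1 := [set z | 0 < time z < T].

(* A function on the slab is represented by a function on R x R^d of which
   only the values on open_slab are relevant. *)
Definition smooth_slab u :=
  smooth_on open_slab u /\
  forall a : multi_index d.+1, exists g : 'rV[R]_d.+1 -> R,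
    {within slab, continuous g} /\
    forall z, open_slab z -> g z = mderiv a u z.

(* The continuous extension to the slab of the derivative d^a u; at z in slab
   it is the limit of d^a u at z from within open_slab. *)
Definition dext (a : multi_index d.+1) u : 'rV[R]_d.+1 -> R :=
  fun z => lim (mderiv a u y @[y --> within open_slab (nbhs z)]).

Definition val_ext : ('rV[R]_d.+1 -> R) -> 'rV[R]_d.+1 -> R :=
  dext [ffun=> 0%N].

(* d_i^k, extended to the slab *)
Definition pderiv_ext (i : 'I_d.+1) (k : nat) :
    ('rV[R]_d.+1 -> R) -> 'rV[R]_d.+1 -> R :=
  dext [ffun j => if j == i then k else 0%N].

Definition laplacian u z : R :=
  \sum_(i < d) pderiv_ext (lift ord0 i) 2 u z.

Definition slab_support u : set 'rV[R]_d.+1 :=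
  closure [set z | slab z /\ val_ext u z != 0].

Definition smooth_net w := forall eps : R, 0 < eps <= 1 -> smooth_slab (w eps).

Definition moderate w :=
  smooth_net w /\
  forall K : set 'rV[R]_d.+1, compact K -> K `<=` slab ->
  forall a, exists b : R,
    Opow (fun eps : R => sup_abs K (dext a (w eps))) b.

(* the nets denoted by O(eps^infty) *)
Definition vanishing w :=
  smooth_net w /\
  forall K : set 'rV[R]_d.+1, compact K -> K `<=` slab ->
  forall a (b : R), 0 <= b ->
    Opow (fun eps : R => sup_abs K (dext a (w eps))) b.

Definition solves (f : R -> R) (e : R -> R) (u0 u1 : R -> 'rV[R]_d -> R) w :=
  exists m : R -> 'rV[R]_d.+1 -> R, vanishing m /\
  forall eps : R, 0 < eps <= 1 ->
    [/\ forall z, slab z ->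
          pderiv_ext ord0 2 (w eps) z - laplacian (w eps) z =
          e eps * f (val_ext (w eps) z) + val_ext (m eps) z,
        forall z, time z = 0 -> val_ext (w eps) z = u0 eps (space z)
      & forall z, time z = 0 -> pderiv_ext ord0 1 (w eps) z = u1 eps (space z)].

(* dext agrees on the slab with any continuous extension. *)
Lemma dext_unique (a : multi_index d.+1) u (g : 'rV[R]_d.+1 -> R) :
  0 < T -> {within slab, continuous g} ->
  (forall z, open_slab z -> g z = mderiv a u z) ->
  forall z, slab z -> dext a u z = g z.
Proof.
move=> T0 gc gu z Sz.
have ctime : continuous (fun y : 'rV[R]_d.+1 => time y).
  exact: coord_continuous.
have oopen : open open_slab.
  rewrite /open_slab.
  rewrite (_ : mkset _ = (fun y => time y) @^-1` [set` `]0, T[ ]); last first.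
    by apply/seteqP; split=> y /=; rewrite in_itv.
  by apply: open_comp; [move=> y _; exact: ctime|exact: interval_open].
have PF : ProperFilter (within open_slab (nbhs z)).
  apply: within_nbhs_proper => A Az.
  pose h (s : R) : 'rV[R]_d.+1 := z + s *: ((T / 2 - time z) *: delta_mx 0 0).
  have hc : h s @[s --> 0^'+] --> z.
    have -> : z = h 0 by rewrite /h scale0r addr0.
    apply: cvg_within_filter; apply: (@cvgD _ 'rV[R]_d.+1); first exact: cvg_cst.
    by apply: cvgZr_tmp; exact: cvg_id.
  have : \forall s \near 0^'+, A (h s) /\ 0 < s < 1.
    near=> s; split; first by near: s; exact: hc.
    apply/andP; split; first by near: s; exact: nbhs_right_gt.
    by near: s; exact: nbhs_right_lt.
  move=> Hs; have [s [Ahs /andP[s0 s1]]] :=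
    @filter_ex _ _ (at_right_proper_filter (0 : R)) _ Hs.
  exists (h s); split => //.
  rewrite /open_slab /= /time !mxE !eqxx /= mulr1.
  move: Sz; rewrite /slab /= /time => /andP[].
  move: (z ord0 ord0) => t t0 tT.
  by apply/andP; split; nra.
apply: cvg_lim => //.
have /subspace_continuousP/(_ z Sz) gz := gc.
move=> A /gz gA.
suff : nbhs z [set y | open_slab y -> A (mderiv a u y)] by [].
apply: (@filterS _ (nbhs z) _ _ _ _ gA) => y /= Ay Oy; rewrite -gu//; apply: Ay.
by move: Oy => /andP[y0 yT]; rewrite /slab /= !ltW.
Unshelve. all: by end_near. Qed.

End Slab.

Definition origin_ball (R : realType) (d : nat) (r : R) : set 'rV[R]_d :=
  [set x | enorm x <= r].

Definition origin_cone (R : realType) (d : nat) (T r : R) : set 'rV[R]_d.+1 :=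
  [set z | slab T z /\ enorm (space z) <= time z + r].

(* Main.v *)
(* Existence. With K the Duhamel operator, consider the Picard iterates
   w_(n+1) = w_0 + K (e f(w_n) - box w_0), where w_0 = u_0 + t u_1. Each of them has
   all derivatives bounded uniformly in eps, and the residual of w_n is of order
   |e|^n, because K is bounded in the sup norm and f is locally Lipschitz. As |e| is
   at most a positive power of eps, an index n = n(eps) that grows slowly enough
   yields a residual smaller than every power of eps; its derivatives are small by
   interpolation of sup bounds.

   Uniqueness. For zero initial data Kirchhoff's formula bounds w by a constant times
   the sup of box w. The small factor e then gives bounds uniform in eps for any
   supported solution u and, by induction on the order and absorption of the top
   term, for its spatial derivatives; the equation and interpolation provide the
   derivatives in t. For a difference of two solutions the same absorption gives a
   sup bound smaller than every power of eps, hence by interpolation also for all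
   derivatives.

   Dimensions d = 1, 2, 3 are treated at once: a function of d <= 3 variables is one of
   three variables, so the formulas over the sphere of R^3 hold, with the sums
   restricted to the first d coordinates (Hadamard's descent). *)
Require Import Defs.
From HB Require Import structures.
From mathcomp Require Import all_boot all_order all_algebra.
From mathcomp Require Import all_classical all_reals all_analysis.
From mathcomp Require Import ring lra.
Import Order.TTheory GRing.Theory Num.Theory.
Import numFieldNormedType.Exports.
Set Implicit Arguments.
Unset Strict Implicit.
Unset Printing Implicit Defensive.
Local Open Scope classical_set_scope.
Local Open Scope ring_scope.

(** At the boundary of the slab derivatives exist only as continuous extensions. The iterates avoid
    this difficulty, being smooth on all of R x R^d: the backward cone of (t, x) is parametrised by
    a fixed compact set of (s, theta, phi), scaled by t, so that K has fixed limits of integration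
    and can be differentiated under the integral sign. A given solution is smooth only inside the
    slab; its sup bound comes from the mean value theorem in s on ]0, 1[ for the spherical mean of t
    s (d_t + d_r) u + u, whose end values are 4 pi u(z) at s = 0 and a mean of the initial data at s
    = 1.

    Vanishing to any order is a condition on compact sets. Supports in K_0 and f(0) = 0 make it
    uniform, since the remainder box u - e f(u) then vanishes off a compact box. As f is only
    locally Lipschitz, the first sup bound needs a continuity argument in time. In the existence
    part the constants depend on n, so along n = n(eps) the bounded derivatives become merely
    O(1/eps), which interpolation tolerates. *)

Local Notation space := Defs.space.
Local Notation li := (lift ord0).
Local Notation "''e_' i" := (delta_mx (ord0 : 'I_1) i) (at level 8, i at level 2).

(** * Partial derivatives and smoothness *)

Section Calculus.
Context {R : realType} {n : nat}.
Implicit Types (u g : 'rV[R]_n -> R) (O : set 'rV[R]_n) (z v : 'rV[R]_n).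

Lemma is_derive_line u z v (t : R) : derivable u (z + t *: v) v ->
  is_derive t 1 (fun s => u (z + s *: v)) ('D_v u (z + t *: v)).
Proof.
move=> du.
have E : (fun h : R => h^-1 *: ((u \o shift (z + t *: v)) (h *: v) - u (z + t *: v))) =
  (fun h : R => h^-1 *: (((fun s => u (z + s *: v)) \o shift t) (h *: 1) - u (z + t *: v))).
  by apply/funext => h /=; rewrite /= [_%:A]mulr1 scalerDl addrCA [h *: v + _]addrC addrA.
split; first by move: du; rewrite /derivable E.
by rewrite /derive E.
Qed.

(** Rescaling the segment to [0, 1] admits steps h of either sign, and h = 0. *)
Lemma mvt_partial (i : 'I_n) u z (h : R) :
  (forall t : R, 0 <= t <= 1 -> derivable u (z + (t * h) *: 'e_i) 'e_i) ->
  exists2 t : R, 0 <= t <= 1 &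
    u (z + h *: 'e_i) - u z = h * partial i u (z + (t * h) *: 'e_i).
Proof.
move=> du.
have D (t : R) : 0 <= t <= 1 -> is_derive t 1 (fun s => u (z + (s * h) *: 'e_i))
    (h * partial i u (z + (t * h) *: 'e_i)).
  move=> t01.
  have := is_derive_line (du t t01).
  set f := fun s => u (z + s *: 'e_i) => df.
  have dh : is_derive t 1 (fun s : R => s * h) h.
    by apply: is_derive_eq; rewrite scaler0 add0r [_%:A]mulr1.
  have := @is_derive1_comp _ f (fun s => s * h) t _ _ df dh.
  by rewrite mulrC.
have [] := @MVT_segment R (fun s => u (z + (s * h) *: 'e_i))
   (fun t => h * partial i u (z + (t * h) *: 'e_i)) 0 1 ler01.
- move=> t; rewrite in_itv/= => /andP[t0 t1]; apply: D.
  by rewrite (ltW t0) (ltW t1).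
- apply: derivable_within_continuous => t; rewrite in_itv/= => t01.
  exact: (@ex_derive _ _ _ _ _ _ _ (D t t01)).
move=> t; rewrite in_itv/= => t01 E; exists t => //.
by move: E; rewrite mul1r mul0r scale0r addr0 subr0 mulr1.
Qed.

Lemma partial_near (i : 'I_n) u g z : (\forall y \near z, u y = g y) ->
  partial i u z = partial i g z.
Proof. exact: near_eq_derive. Qed.

Lemma near_continuous u g z : (\forall y \near z, u y = g y) ->
  {for z, continuous u} -> {for z, continuous g}.
Proof.
move=> ug; rewrite /prop_for /continuous_at (nbhs_singleton ug) => uc.
exact: (cvg_trans (near_eq_cvg ug) uc).
Qed.

Lemma open_near O z : open O -> O z -> \forall y \near z, O y.
Proof. by move=> oO Oz; apply: open_nbhs_nbhs; split. Qed.

Lemma near_eq_on O u g z : open O -> O z -> (forall y, O y -> u y = g y) ->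
  \forall y \near z, u y = g y.
Proof. by move=> oO Oz ug; apply: filterS (open_near oO Oz). Qed.

Lemma partials_eq_on O u g s z : open O -> (forall y, O y -> u y = g y) ->
  O z -> partials s u z = partials s g z.
Proof.
move=> oO ug; elim: s z => [|i s IH] z Oz /=; first exact: ug.
by apply: partial_near; apply: near_eq_on oO Oz _.
Qed.

(** Coinduction principle: a class of continuous functions that is closed under partial derivatives,
    up to equality on O, can be differentiated forever. *)
Lemma smooth_on_coind O (S : ('rV[R]_n -> R) -> Prop) : open O ->
  (forall g z, S g -> O z -> {for z, continuous g}) ->
  (forall g i, S g -> exists2 g', S g' &
     forall z, O z -> is_derive z 'e_i g (g' z)) ->
  forall g, S g -> smooth_on O g.
Proof.
move=> oO Sc Sd g Sg s.
have [h Sh hE] : exists2 h, S h & forall z, O z -> partials s g z = h z.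
  elim: s => [|i s [h Sh hE]] /=; first by exists g.
  have [h' Sh' h'E] := Sd h i Sh; exists h' => // z Oz.
  rewrite (@partial_near i _ h); last exact: near_eq_on oO Oz hE.
  by have [] := h'E z Oz.
move=> z Oz; split.
  apply: near_continuous (Sc h z Sh Oz).
  by apply: filterS (near_eq_on oO Oz hE) => y ->.
move=> i; have [h' Sh' h'E] := Sd h i Sh.
apply: near_eq_derivable (@ex_derive _ _ _ _ _ _ _ (h'E z Oz)).
by apply: filterS (near_eq_on oO Oz hE) => y ->.
Qed.

Lemma smooth_on_cont O u z : smooth_on O u -> O z -> {for z, continuous u}.
Proof. by move=> us Oz; have [] := us [::] z Oz. Qed.

Lemma smooth_on_is_derive O u i z : smooth_on O u -> O z ->
  is_derive z 'e_i u (partial i u z).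
Proof. by move=> us Oz; have [_ /(_ i)/derivableP] := us [::] z Oz. Qed.

Lemma smooth_on_derivable O u i z : smooth_on O u -> O z -> derivable u z 'e_i.
Proof. by move=> us Oz; have [_ /(_ i)] := us [::] z Oz. Qed.

Lemma partials_cat s s' u : partials (s ++ s') u = partials s (partials s' u).
Proof. by rewrite /partials foldr_cat. Qed.

Lemma smooth_on_partials O u s : smooth_on O u -> smooth_on O (partials s u).
Proof. by move=> us s' z Oz; rewrite -partials_cat; exact: us. Qed.

Lemma smooth_on_partial O u i : smooth_on O u -> smooth_on O (partial i u).
Proof. exact: (@smooth_on_partials O u [:: i]). Qed.

Lemma smooth_on_subset O O' u : O' `<=` O -> smooth_on O u -> smooth_on O' u.
Proof. by move=> OO' us s z Oz; apply: us; exact: OO'. Qed.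

Lemma smooth_on_eq O u g : open O -> (forall z, O z -> u z = g z) ->
  smooth_on O u -> smooth_on O g.
Proof.
move=> oO ug us; pose S h := exists2 h', smooth_on O h' & forall z, O z -> h' z = h z.
apply: (@smooth_on_coind O S) => //; last by exists u.
- move=> h z [h' h's h'h] Oz.
  exact: near_continuous (near_eq_on oO Oz h'h) (smooth_on_cont h's Oz).
- move=> h i [h' h's h'h]; exists (partial i h').
    by exists (partial i h'); [exact: smooth_on_partial|].
  move=> z Oz; apply: near_eq_is_derive (smooth_on_is_derive i h's Oz).
  exact: near_eq_on oO Oz h'h.
Qed.

(** The derivatives of the functions of interest are sums of products of such functions with smooth
    coefficients. This algebra is therefore the class to which [smooth_on_coind] is applied, and
    closure only has to be checked on generators. *)
Inductive smooth_alg O (S : ('rV[R]_n -> R) -> Prop) : ('rV[R]_n -> R) -> Prop :=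
  | SAgen g of S g : smooth_alg O S g
  | SAsmooth g of smooth_on O g : smooth_alg O S g
  | SAadd g h of smooth_alg O S g & smooth_alg O S h :
      smooth_alg O S (fun z => g z + h z)
  | SAmul g h of smooth_alg O S g & smooth_alg O S h :
      smooth_alg O S (fun z => g z * h z).

Lemma smooth_on_alg O (S : ('rV[R]_n -> R) -> Prop) : open O ->
  (forall g z, S g -> O z -> {for z, continuous g}) ->
  (forall g i, S g -> exists2 g', smooth_alg O S g' &
     forall z, O z -> is_derive z 'e_i g (g' z)) ->
  forall g, smooth_alg O S g -> smooth_on O g.
Proof.
move=> oO Sc Sd; apply: smooth_on_coind => //.
  move=> h z Sh Oz; elim: Sh => {h}.
  - by move=> h Sh; exact: Sc.
  - by move=> h hs; exact: smooth_on_cont hs Oz.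
  - by move=> h k _ hc _ kc; exact: continuousD.
  - by move=> h k _ hc _ kc; exact: continuousM.
move=> h i; elim=> {h}.
- by move=> h Sh; exact: Sd.
- move=> h hs; exists (partial i h); first exact/SAsmooth/smooth_on_partial.
  by move=> z Oz; exact: smooth_on_is_derive hs Oz.
- move=> h k Sh [h' Sh' dh] Sk [k' Sk' dk].
  exists (fun z => h' z + k' z); first exact: SAadd.
  by move=> z Oz; have := dh z Oz; have := dk z Oz => ? ?; exact: is_deriveD.
- move=> h k Sh [h' Sh' dh] Sk [k' Sk' dk].
  exists (fun z => h z * k' z + k z * h' z); first by apply: SAadd; exact: SAmul.
  by move=> z Oz; have := dh z Oz; have := dk z Oz => ? ?; exact: is_deriveM.
Qed.

Lemma smooth_onD O u g : open O -> smooth_on O u -> smooth_on O g ->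
  smooth_on O (fun z => u z + g z).
Proof.
move=> oO us gs; apply: (@smooth_on_alg O (fun=> False)) => //.
by apply: SAadd; exact: SAsmooth.
Qed.

Lemma smooth_onM O u g : open O -> smooth_on O u -> smooth_on O g ->
  smooth_on O (fun z => u z * g z).
Proof.
move=> oO us gs; apply: (@smooth_on_alg O (fun=> False)) => //.
by apply: SAmul; exact: SAsmooth.
Qed.

Lemma smooth_on_cst O (c : R) : open O -> smooth_on O (fun=> c).
Proof.
move=> oO; pose S (h : 'rV[R]_n -> R) := exists c, h = fun=> c.
apply: (@smooth_on_coind O S) => //; last by exists c.
- by move=> h z [k ->] _; exact: cst_continuous.
- move=> h i [k ->]; exists (fun=> 0); first by exists 0.
  by move=> z _; exact: is_derive_cst.
Qed.

Lemma smooth_onZ O (c : R) u : open O -> smooth_on O u ->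
  smooth_on O (fun z => c * u z).
Proof. by move=> oO us; exact: smooth_onM oO (smooth_on_cst c oO) us. Qed.

Lemma smooth_onB O u g : open O -> smooth_on O u -> smooth_on O g ->
  smooth_on O (fun z => u z - g z).
Proof.
move=> oO us gs; apply: (@smooth_on_eq O (fun z => u z + (-1) * g z) _ oO).
  by move=> z _; rewrite mulN1r.
exact: smooth_onD oO us (smooth_onZ (-1) oO gs).
Qed.

Lemma smooth_on_sum O (I : Type) (r : seq I) (F : I -> 'rV[R]_n -> R) : open O ->
  (forall i, smooth_on O (F i)) -> smooth_on O (fun z => \sum_(i <- r) F i z).
Proof.
move=> oO Fs; elim: r => [|i r IH].
  apply: (@smooth_on_eq O (fun=> 0)) => //; last exact: smooth_on_cst.
  by move=> z _; rewrite big_nil.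
apply: (@smooth_on_eq O (fun z => F i z + \sum_(i <- r) F i z) _ oO).
  by move=> z _; rewrite big_cons.
exact: smooth_onD oO (Fs i) IH.
Qed.

Lemma smooth_alg_sum O (S : ('rV[R]_n -> R) -> Prop) (I : Type) (r : seq I)
    (g : I -> 'rV[R]_n -> R) : open O ->
  (forall i, smooth_alg O S (g i)) -> smooth_alg O S (fun z => \sum_(i <- r) g i z).
Proof.
move=> oO Sg; elim: r => [|i r IH].
  rewrite (_ : (fun z => _) = fun=> 0); first exact/SAsmooth/smooth_on_cst.
  by apply/funext => z; rewrite big_nil.
rewrite (_ : (fun z => _) = fun z => g i z + \sum_(j <- r) g j z); first exact: SAadd.
by apply/funext => z; rewrite big_cons.
Qed.

Lemma is_derive_coord (i j : 'I_n) z :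
  is_derive z 'e_i (fun y : 'rV[R]_n => y ord0 j) (j == i)%:R.
Proof.
have E : (fun h : R => h^-1 *: (((fun y : 'rV[R]_n => y ord0 j) \o shift z) (h *: 'e_i) - z ord0 j))
   @ 0^' --> ((j == i)%:R : R).
  apply: cvg_near_cst; near=> h.
  rewrite /= !mxE eqxx /= addrK -[LHS]/(h^-1 * (h * (j == i)%:R)) mulrA mulVf ?mul1r//.
  by near: h; exact: nbhs_dnbhs_neq.
split; first by apply/cvg_ex; eexists; exact: E.
exact/cvg_lim.
Unshelve. all: by end_near. Qed.

Lemma smooth_on_coord O j : open O -> smooth_on O (fun z => z ord0 j).
Proof.
move=> oO; apply: (@smooth_on_alg O (fun h => h = fun z => z ord0 j)) => //.
- by move=> h z -> _; exact: coord_continuous.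
- move=> h i ->; exists (fun=> (j == i)%:R); first exact/SAsmooth/smooth_on_cst.
  by move=> z _; exact: is_derive_coord.
- exact: SAgen.
Qed.

End Calculus.

Lemma cvg_sumr (R : realType) (T : Type) (F : set_system T) {FF : Filter F} (I : Type)
    (r : seq I) (f : I -> T -> R) (l : I -> R) :
  (forall i, f i x @[x --> F] --> l i) ->
  \sum_(i <- r) f i x @[x --> F] --> \sum_(i <- r) l i.
Proof.
move=> fl; elim: r => [|i r IH].
  by rewrite big_nil; under eq_cvg do rewrite big_nil; exact: cvg_cst.
by rewrite big_cons; under eq_cvg do rewrite big_cons; exact: cvgD.
Qed.

Section RowNorm.
Context {R : realType} {n : nat}.
Implicit Types (z v : 'rV[R]_n).

Lemma coord_le_norm v i : `|v ord0 i| <= `|v|.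
Proof.
rewrite [leRHS]/Num.Def.normr/= mx_normrE.
exact: (le_bigmax _ (fun j : 'I_1 * 'I_n => `|v j.1 j.2|) (ord0, i)).
Qed.

Lemma row_norm_le v (e : R) : 0 <= e -> (forall i, `|v ord0 i| <= e) -> `|v| <= e.
Proof.
move=> e0 ve; rewrite [leLHS]/Num.Def.normr/= mx_normrE.
by apply: bigmax_le => // -[i j] _; rewrite (ord1 i); exact: ve.
Qed.

Lemma row_norm_lt v (e : R) : 0 < e -> (forall i, `|v ord0 i| < e) -> `|v| < e.
Proof.
move=> e0 ve; rewrite [ltLHS]/Num.Def.normr/= mx_normrE.
by apply: bigmax_lt => // -[i j] _; rewrite (ord1 i); exact: ve.
Qed.

Lemma near_row_norm z (P : set 'rV[R]_n) : (\forall y \near z, P y) ->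
  exists2 e : R, 0 < e & forall y, `|y - z| < e -> P y.
Proof.
move=> /nbhs_normP[e /= e0 eP]; exists e => // y yz.
by apply: eP; rewrite /= distrC.
Qed.

End RowNorm.

Lemma row_continuous (R : realType) n (T : topologicalType) (F : T -> 'rV[R]_n) x :
  (forall i, {for x, continuous (fun y => F y ord0 i)}) -> {for x, continuous F}.
Proof.
move=> Fc; apply/cvgrPdist_lt => e e0.
have H : \forall y \near x, forall i, `|F x ord0 i - F y ord0 i| < e.
  apply: (@filter_forall _ _ (fun i y => `|F x ord0 i - F y ord0 i| < e) _ (nbhs_filter x)) => i.
  by have /cvgrPdist_lt/(_ _ e0) := Fc i.
by apply: filterS H => y H; apply: row_norm_lt => // i; rewrite !mxE; exact: H.
Qed.

Section ChainRule.
Context {R : realType} {n : nat}.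
Implicit Types (u g : 'rV[R]_n -> R) (O : set 'rV[R]_n) (z v : 'rV[R]_n).

Let trunc v (k : nat) : 'rV[R]_n := \row_i (if (i < k)%N then v ord0 i else 0).

Let truncS v (k : 'I_n) : trunc v k.+1 = trunc v k + v ord0 k *: 'e_k.
Proof.
apply/rowP => i; rewrite !mxE eqxx /= ltnS.
case: (ltngtP i k) => [ik|ki|/val_inj ->].
- by rewrite (_ : (i == k) = false) ?mulr0 ?addr0//; apply/negbTE; rewrite -val_eqE /= neq_ltn ik.
- by rewrite (_ : (i == k) = false) ?mulr0 ?addr0//; apply/negbTE; rewrite -val_eqE /= neq_ltn ki orbT.
- by rewrite eqxx mulr1 add0r.
Qed.

(** Differentiability from continuous partial derivatives: the way from z to z + v is cut into legs
    parallel to the axes, with corners z + [trunc v k]. On each leg the mean value theorem gives a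
    partial derivative at a nearby point. *)
Lemma C1_increment O u z (e : R) : open O -> smooth_on O u -> O z -> 0 < e ->
  \forall v \near (0 : 'rV[R]_n),
   `|u (z + v) - u z - \sum_i v ord0 i * partial i u z| <= e * \sum_i `|v ord0 i|.
Proof.
move=> oO us Oz e0.
have H1 : \forall y \near z, forall i, `|partial i u z - partial i u y| <= e.
  apply: (@filter_forall _ _ (fun i y => `|partial i u z - partial i u y| <= e) _ (nbhs_filter z)) => i.
  by have /cvgrPdist_le/(_ _ e0) := smooth_on_cont (smooth_on_partial i us) Oz.
have H : \forall y \near z, O y /\ forall i, `|partial i u z - partial i u y| <= e.
  near=> y; split; near: y; [exact: open_near|exact: H1].
have [r r0 rH] := near_row_norm H.
near=> v.
have vr : `|v| < r.
  near: v; exact: (@nbhs0_lt _ 'rV[R]_n).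
have trn (y : 'rV[R]_n) : (forall i, `|y ord0 i| <= `|v ord0 i|) -> `|y| < r.
  move=> yv; apply: le_lt_trans vr; apply: row_norm_le => // i.
  by apply: le_trans (yv i) _; exact: coord_le_norm.
suff K : forall k, (k <= n)%N ->
   `|u (z + trunc v k) - u z - \sum_(i < n | (i < k)%N) v ord0 i * partial i u z| <=
      e * \sum_(i < n | (i < k)%N) `|v ord0 i|.
  have := K n (leqnn n).
  have -> : trunc v n = v by apply/rowP => i; rewrite mxE ltn_ord.
  rewrite (eq_bigl predT); last by move=> i; rewrite ltn_ord.
  by rewrite [X in _ <= e * X -> _](eq_bigl predT) => // i; rewrite ltn_ord.
elim=> [_|k IH kn].
  rewrite !big_pred0// (_ : trunc v 0 = 0); last by apply/rowP => i; rewrite !mxE.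
  by rewrite addr0 subrr subrr normr0 mulr0.
pose i := Ordinal kn.
have E (F : 'I_n -> R) : \sum_(j < n | (j < k.+1)%N) F j = F i + \sum_(j < n | (j < k)%N) F j.
  rewrite (bigD1 i)//=; congr (_ + _); apply: eq_bigl => j.
  by rewrite ltnS -val_eqE /= andbC -ltn_neqAle.
rewrite !E (truncS v i) addrA.
have P (t : R) : 0 <= t <= 1 -> O (z + trunc v k + (t * v ord0 i) *: 'e_i) /\
     forall i0, `|partial i0 u z - partial i0 u (z + trunc v k + (t * v ord0 i) *: 'e_i)| <= e.
  move=> /andP[t0 t1]; apply: rH.
  have -> : z + trunc v k + (t * v ord0 i) *: 'e_i - z = trunc v k + (t * v ord0 i) *: 'e_i.
    by rewrite addrC !addrA addNr add0r.
  apply: trn => j; rewrite !mxE eqxx /=.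
  case: ltnP => jk.
    rewrite (_ : (j == i) = false) ?mulr0 ?addr0//; apply/negbTE.
    by rewrite -val_eqE /= neq_ltn jk.
  rewrite add0r; have [->|_] := eqVneq j i; last by rewrite mulr0 normr0.
  by rewrite mulr1 normrM ger0_norm// ler_piMl.
have [t t01|t t01 mvt] := @mvt_partial R n i u (z + trunc v k) (v ord0 i) _.
  by have [Oy _] := P t t01; exact: smooth_on_derivable us Oy.
have [_ /(_ i) D] := P t t01.
have -> : u (z + trunc v k + v ord0 i *: 'e_i) = u (z + trunc v k) +
   v ord0 i * partial i u (z + trunc v k + (t * v ord0 i) *: 'e_i).
  by rewrite -mvt [RHS]addrC subrK.
set p := partial i u (_ + _) in D *; set q := partial i u z in D *.
set S := \sum_(_ < n | _) _; set B := \sum_(_ < n | _) _.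
have -> : u (z + trunc v k) + v ord0 i * p - u z - (v ord0 i * q + S) =
   (u (z + trunc v k) - u z - S) - v ord0 i * (q - p) by ring.
apply: le_trans (ler_normB _ _) _; rewrite [leRHS]mulrDr [leLHS]addrC; apply: lerD.
  by rewrite normrM mulrC ler_wpM2r.
by apply: IH; exact: ltnW.
Unshelve. all: by end_near. Qed.

Lemma is_derive_curve O u (c : R -> 'rV[R]_n) (dc : 'I_n -> R) (t : R) :
  open O -> smooth_on O u -> O (c t) ->
  (forall i, is_derive t 1 (fun s => c s ord0 i) (dc i)) ->
  is_derive t 1 (fun s => u (c s)) (\sum_i dc i * partial i u (c t)).
Proof.
move=> oO us Oz dcE.
have cc : c (h *: 1 + t) @[h --> 0^'] --> c t.
  have : derivable c t 1.
    by apply/derivable_mxP => i j; rewrite (ord1 i); exact: ex_derive.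
  move=> /derivable1_diffP/differentiable_continuous cc.
  suff tc : (h *: 1 + t : R) @[h --> (0 : R)^'] --> t by exact: (cvg_comp _ _ tc cc).
  rewrite -[X in _ --> X](add0r t); apply: cvgD; last exact: cvg_cst.
  under eq_fun do rewrite [_ *: 1]mulr1.
  exact: nbhs_dnbhs.
have qc i : h^-1 * (c (h *: 1 + t) ord0 i - c t ord0 i) @[h --> 0^'] --> dc i.
  have [dci <-] := dcE i; exact: dci.
suff L : h^-1 *: (u (c (h *: 1 + t)) - u (c t)) @[h --> 0^'] -->
      (\sum_i dc i * partial i u (c t)).
  by split; [apply/cvg_ex; eexists; exact: L|exact/cvg_lim].
set z := c t.
pose q i h := h^-1 * (c (h *: 1 + t) ord0 i - c t ord0 i).
have Sc : \sum_i q i h * partial i u z @[h --> 0^'] --> \sum_i dc i * partial i u z.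
  apply: cvg_sumr => i.
  by apply: cvgMr_tmp; exact: qc.
rewrite -[X in _ --> X](addr0 _).
have -> : (fun h : R => h^-1 *: (u (c (h *: 1 + t)) - u z)) = (fun h =>
  \sum_i q i h * partial i u z +
    (h^-1 * (u (c (h *: 1 + t)) - u z) - \sum_i q i h * partial i u z)).
  by apply/funext => h; rewrite [RHS]addrC subrK.
apply: cvgD => //.
(* B bounds the sum of the [|q i h|] for small h, each being within 1 of [|dc i|]. The later
   division by B + 1 also covers an empty sum. *)
pose B := \sum_i (`|dc i| + 1).
have B0 : 0 <= B by apply: sumr_ge0 => i _; exact: addr_ge0.
apply/cvgr0Pnorm_le => e e0.
have e1 : 0 < e / (B + 1) by rewrite divr_gt0// ltr_wpDl.
have inc := C1_increment oO us Oz e1.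
have cz : c (h *: 1 + t) - z @[h --> 0^'] --> (0 : 'rV[R]_n).
  by rewrite -(subrr z); apply: cvgB => //; exact: cvg_cst.
have Hq : \forall h \near 0^', forall i, `|q i h| <= `|dc i| + 1.
  apply: (@filter_forall _ _ (fun i h => `|q i h| <= `|dc i| + 1) _ (dnbhs_filter 0)) => i.
  have /cvgrPdist_le/(_ _ ltr01) := qc i.
  apply: filterS => h; rewrite -/(q i h) => qh.
  have -> : q i h = dc i - (dc i - q i h) by rewrite opprB [RHS]addrC subrK.
  by apply: le_trans (ler_normB _ _) _; rewrite lerD2l.
have cz' : \forall h \near 0^', `|u (z + (c (h *: 1 + t) - z)) - u z -
    \sum_i (c (h *: 1 + t) - z) ord0 i * partial i u z| <=
    e / (B + 1) * \sum_i `|(c (h *: 1 + t) - z) ord0 i|.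
  exact: (cz _ inc).
near=> h.
have h0 : h != 0 by near: h; exact: nbhs_dnbhs_neq.
have hq : forall i, `|q i h| <= `|dc i| + 1 by near: h.
have inch : `|u (z + (c (h *: 1 + t) - z)) - u z -
    \sum_i (c (h *: 1 + t) - z) ord0 i * partial i u z| <=
    e / (B + 1) * \sum_i `|(c (h *: 1 + t) - z) ord0 i| by near: h.
have ce i : (c (h *: 1 + t) - z) ord0 i = h * q i h.
  by rewrite /q !mxE mulrA divff// mul1r.
have zc : z + (c (h *: 1 + t) - z) = c (h *: 1 + t) by rewrite [LHS]addrC subrK.
rewrite zc in inch.
have -> : h^-1 * (u (c (h *: 1 + t)) - u z) - \sum_i q i h * partial i u z =
  h^-1 * (u (c (h *: 1 + t)) - u z - \sum_i (c (h *: 1 + t) - z) ord0 i * partial i u z).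
  rewrite [RHS]mulrBr; congr (_ - _); rewrite big_distrr/=; apply: eq_bigr => i _.
  by rewrite ce !mulrA mulVf// mul1r.
rewrite normrM normfV ler_pdivrMl ?normr_gt0//; apply: le_trans inch _.
have -> : \sum_i `|(c (h *: 1 + t) - z) ord0 i| = `|h| * \sum_i `|q i h|.
  by rewrite big_distrr/=; apply: eq_bigr => i _; rewrite ce normrM.
rewrite mulrCA ler_wpM2l// mulrAC ler_pdivrMr ?ltr_wpDl// ler_wpM2l ?(ltW e0)//.
by apply: le_trans (ler_sum _ (fun i _ => hq i)) _; rewrite lerDl.
Unshelve. all: by end_near. Qed.

End ChainRule.

(** * Symmetry of second derivatives *)

Section Schwarz.
Context {R : realType} {n : nat}.
Implicit Types (u g : 'rV[R]_n -> R) (O : set 'rV[R]_n) (z v : 'rV[R]_n).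

Lemma is_derive_lineP u z v (t b : R) :
  is_derive t 1 (fun s => u (z + s *: v)) b -> is_derive (z + t *: v) v u b.
Proof.
have E : (fun h : R => h^-1 *: ((u \o shift (z + t *: v)) (h *: v) - u (z + t *: v))) =
  (fun h : R => h^-1 *: (((fun s => u (z + s *: v)) \o shift t) (h *: 1) - u (z + t *: v))).
  by apply/funext => h /=; rewrite /= [_%:A]mulr1 scalerDl addrCA [h *: v + _]addrC addrA.
move=> [du <-]; split; first by move: du; rewrite /derivable -E.
by rewrite /derive E.
Qed.

Lemma is_derive_comp_dir (f : R -> R) u z v (a b : R) :
  is_derive (u z) 1 f a -> is_derive z v u b ->
  is_derive z v (fun y => f (u y)) (a * b).
Proof.
move=> df [du <-]; rewrite -(addr0 z) -(scale0r v); apply: is_derive_lineP.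
have du' : derivable u (z + 0 *: v) v by rewrite scale0r addr0.
have dl := is_derive_line du'.
have df' : is_derive (u (z + 0 *: v)) 1 f a by rewrite scale0r addr0.
exact: is_derive1_comp df' dl.
Qed.

Lemma is_derive_shiftv u z v a (b : R) :
  is_derive (z + a) v u b -> is_derive z v (fun y => u (y + a)) b.
Proof.
have E : (fun h : R => h^-1 *: ((u \o shift (z + a)) (h *: v) - u (z + a))) =
  (fun h : R => h^-1 *: (((fun y => u (y + a)) \o shift z) (h *: v) - u (z + a))).
  by apply/funext => h /=; rewrite addrA.
move=> [du <-]; split; first by move: du; rewrite /derivable E.
by rewrite /derive E.
Qed.

(** The second difference is the increment along ['e_i] of y |-> u (y + h e_j) - u y; two
    applications of the mean value theorem turn it into h^2 times the mixed derivative at a nearby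
    point. *)
Let second_difference O u i j z (e : R) : open O -> smooth_on O u -> O z -> 0 < e ->
  \forall h \near 0^'+, `|(u (z + h *: 'e_i + h *: 'e_j) - u (z + h *: 'e_i)) -
    (u (z + h *: 'e_j) - u z) - h ^+ 2 * partial j (partial i u) z| <= e * h ^+ 2.
Proof.
move=> oO us Oz e0.
have H1 : \forall y \near z, `|partial j (partial i u) z - partial j (partial i u) y| <= e.
  have us2 := smooth_on_partial j (smooth_on_partial i us).
  by have /cvgrPdist_le/(_ _ e0) := smooth_on_cont us2 Oz.
have H : \forall y \near z, O y /\ `|partial j (partial i u) z - partial j (partial i u) y| <= e.
  by near=> y; split; near: y => //; exact: open_near.
have [r r0 rH] := near_row_norm H.
near=> h.
have h0 : 0 < h by [].
have hr : h < r / 2 by near: h; apply: nbhs_right_lt; rewrite divr_gt0.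
have P (s t : R) : 0 <= s <= 1 -> 0 <= t <= 1 ->
    O (z + (s * h) *: 'e_i + (t * h) *: 'e_j) /\ `|partial j (partial i u) z -
      partial j (partial i u) (z + (s * h) *: 'e_i + (t * h) *: 'e_j)| <= e.
  move=> /andP[s0 s1] /andP[t0 t1]; apply: rH.
  have -> : z + (s * h) *: 'e_i + (t * h) *: 'e_j - z = (s * h) *: 'e_i + (t * h) *: 'e_j.
    by rewrite addrC !addrA addNr add0r.
  apply: row_norm_lt => // k; rewrite !mxE eqxx /=.
  apply: le_lt_trans (ler_normD _ _) _.
  rewrite (splitr r); apply: ler_ltD.
    rewrite normrM ger0_norm ?mulr_ge0 ?(ltW h0)//.
    apply: le_trans (ltW hr); case: (_ == _); rewrite ?normr1 ?normr0 ?mulr1 ?mulr0 ?ler_piMl// ltW//.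
  apply: le_lt_trans hr.
  rewrite normrM ger0_norm ?mulr_ge0 ?(ltW h0)//.
  by case: (_ == _); rewrite ?normr1 ?normr0 ?mulr1 ?mulr0 ?ler_piMl// ltW.
have O0 (s : R) : 0 <= s <= 1 -> O (z + (s * h) *: 'e_i).
  move=> s01; have := (P s 0 s01 _).1; rewrite mul0r scale0r addr0; apply.
  by rewrite lexx ler01.
have O1 (s : R) : 0 <= s <= 1 -> O (z + (s * h) *: 'e_i + h *: 'e_j).
  move=> s01; have := (P s 1 s01 _).1; rewrite mul1r; apply.
  by rewrite lexx ler01.
pose G y := u (y + h *: 'e_j) - u y.
have dG (s : R) : 0 <= s <= 1 -> is_derive (z + (s * h) *: 'e_i) 'e_i G
   (partial i u (z + (s * h) *: 'e_i + h *: 'e_j) - partial i u (z + (s * h) *: 'e_i)).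
  move=> s01; apply: is_deriveB.
    by apply: is_derive_shiftv; apply: smooth_on_is_derive us _; exact: O1.
  by apply: smooth_on_is_derive us _; exact: O0.
have [s s01|s s01 ->] := @mvt_partial R n i G z h _.
  exact: (@ex_derive _ _ _ _ _ _ _ (dG s s01)).
rewrite [partial i G _](@derive_val _ _ _ _ _ _ _ (dG s s01)).
have [t t01|t t01 ->] := @mvt_partial R n j (partial i u) (z + (s * h) *: 'e_i) h _.
  by apply: smooth_on_derivable (smooth_on_partial i us) _; have [] := P s t s01 t01.
rewrite mulrA -expr2 -mulrBr normrM (ger0_norm (exprn_ge0 2 (ltW h0))) [leRHS]mulrC.
by apply: ler_wpM2l; [rewrite exprn_ge0// ltW|rewrite distrC; have [] := P s t s01 t01].
Unshelve. all: by end_near. Qed.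

Lemma partialC O u i j z : open O -> smooth_on O u -> O z ->
  partial i (partial j u) z = partial j (partial i u) z.
Proof.
move=> oO us Oz; apply/eqP; rewrite -subr_eq0 -normr_le0; apply/ler_addgt0Pr => e e0.
rewrite add0r.
have e2 : 0 < e / 2 by rewrite divr_gt0.
have A := second_difference i j oO us Oz e2.
have B := second_difference j i oO us Oz e2.
have [h [[A' B'] hp]] := @filter_ex _ _ (at_right_proper_filter (0 : R)) _
  (filterI (filterI A B) (nbhs_right_gt 0)).
have h0 : 0 < h ^+ 2 by rewrite exprn_gt0.
rewrite -(ler_pM2r h0) -[X in _ * X](gtr0_norm h0) -normrM.
(* Exchanging i and j leaves the second difference unchanged, so it drops out and only the two
   errors remain. *)
rewrite [X in `|X|](_ : _ =
 (u (z + h *: 'e_i + h *: 'e_j) - u (z + h *: 'e_i) - (u (z + h *: 'e_j) - u z) - h ^+ 2 * partial j (partial i u) z)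
 - (u (z + h *: 'e_j + h *: 'e_i) - u (z + h *: 'e_j) - (u (z + h *: 'e_i) - u z) - h ^+ 2 * partial i (partial j u) z)); last first.
  rewrite (addrAC z (h *: 'e_i)).
  move: (u (z + h *: 'e_j + h *: 'e_i)) (u (z + h *: 'e_i)) (u (z + h *: 'e_j)) (u z).
  move: (partial i (partial j u) z) (partial j (partial i u) z) (h ^+ 2) => a b c p q r s.
  by ring.
apply: le_trans (ler_normB _ _) _.
by rewrite (splitr e) mulrDl; exact: (lerD A' B').
Qed.

Lemma partials_insert O u s1 s2 i z : open O -> smooth_on O u -> O z ->
  partials (s1 ++ i :: s2) u z = partials (i :: s1 ++ s2) u z.
Proof.
move=> oO us; elim: s1 z => [//|j s1 IH] z Oz /=.
rewrite (@partial_near _ _ j _ (partials (i :: s1 ++ s2) u)) /=.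
  by apply: partialC oO _ Oz; exact: smooth_on_partials.
by apply: near_eq_on oO Oz _ => y Oy; exact: IH.
Qed.

Lemma partials_perm O u s s' z : open O -> smooth_on O u -> O z ->
  perm_eq s s' -> partials s u z = partials s' u z.
Proof.
move=> oO us; elim: s s' z => [|i s IH] s' z Oz.
  by rewrite perm_sym => /perm_nilP ->.
move=> ss'; have : i \in s' by rewrite -(perm_mem ss') mem_head.
move=> /splitPr E; move: ss'; case: E => s1 s2 ss'.
rewrite (partials_insert s1 s2 i oO us Oz) /=; apply: partial_near.
apply: near_eq_on oO Oz _ => y Oy; apply: IH => //.
have E : perm_eq (s1 ++ i :: s2) (i :: s1 ++ s2) by rewrite -[i :: s2]cat1s perm_catCA.
by have := perm_trans ss' E; rewrite perm_cons.
Qed.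

End Schwarz.

(** * Composition with functions of one variable and with the projection to space *)

Section Composition.
Context {R : realType} {n : nat}.
Implicit Types (u g : 'rV[R]_n -> R) (O : set 'rV[R]_n) (z v : 'rV[R]_n).

Lemma smooth_fun_is_derive (f : R -> R) k (x : R) : smooth_fun f ->
  is_derive x 1 (derive1n k f) (derive1n k.+1 f x).
Proof. by move=> fs; rewrite derive1nS derive1E; apply: derivableP; exact: fs. Qed.

Lemma smooth_fun_continuous (f : R -> R) k : smooth_fun f -> continuous (derive1n k f).
Proof.
by move=> fs x; apply/differentiable_continuous/derivable1_diffP; exact: fs.
Qed.

Lemma smooth_on_comp O (f : R -> R) u : open O -> smooth_fun f -> smooth_on O u ->
  smooth_on O (fun z => f (u z)).
Proof.
move=> oO fs us.
apply: (@smooth_on_alg R n O (fun h => exists k, h = fun z => derive1n k f (u z))) => //.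
- move=> h z [k ->] Oz; apply: (@continuous_comp _ _ _ u).
    exact: smooth_on_cont us Oz.
  exact: smooth_fun_continuous.
- move=> h i [k ->]; exists (fun z => derive1n k.+1 f (u z) * partial i u z).
    apply: SAmul; first by apply: SAgen; exists k.+1.
    exact/SAsmooth/smooth_on_partial.
  move=> z Oz; apply: (@is_derive_comp_dir R n (derive1n k f)).
    exact: smooth_fun_is_derive.
  exact: smooth_on_is_derive us Oz.
- by apply: SAgen; exists 0%N.
Qed.

End Composition.

Section Space.
Context {R : realType} {d : nat}.
Implicit Types (g : 'rV[R]_d -> R).

Lemma spaceD (y z : 'rV[R]_d.+1) : space (y + z) = space y + space z.
Proof. by apply/rowP => i; rewrite !mxE. Qed.

Lemma spaceZ (c : R) (z : 'rV[R]_d.+1) : space (c *: z) = c *: space z.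
Proof. by apply/rowP => i; rewrite !mxE. Qed.

Lemma space_lift (i : 'I_d) : space ('e_(lift ord0 i)) = (delta_mx ord0 i : 'rV[R]_d).
Proof. by apply/rowP => j; rewrite !mxE eqxx /= (inj_eq lift_inj). Qed.

Lemma space_e0 : space ('e_(ord0 : 'I_d.+1)) = (0 : 'rV[R]_d).
Proof. by apply/rowP => j; rewrite !mxE eqxx /=. Qed.

Lemma is_derive_space_lift g (i : 'I_d) z b : is_derive (space z) (delta_mx ord0 i) g b ->
  is_derive z ('e_(lift ord0 i)) (fun z => g (space z)) b.
Proof.
have E : (fun h : R => h^-1 *: ((g \o shift (space z)) (h *: delta_mx ord0 i) - g (space z))) =
  (fun h : R => h^-1 *: (((fun y => g (space y)) \o shift z) (h *: 'e_(lift ord0 i)) - g (space z))).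
  by apply/funext => h /=; rewrite spaceD spaceZ space_lift.
move=> [du <-]; split; first by move: du; rewrite /derivable E.
by rewrite /derive E.
Qed.

Lemma is_derive_space_time g z : is_derive z 'e_ord0 (fun z => g (space z)) 0.
Proof.
have E : (fun h : R => h^-1 *: (((fun y => g (space y)) \o shift z) (h *: 'e_ord0) - g (space z))) =
  fun=> 0.
  by apply/funext => h /=; rewrite spaceD spaceZ space_e0 scaler0 add0r subrr scaler0.
split; first by rewrite /derivable E; apply/cvg_ex; exists 0; exact: cvg_cst.
by rewrite /derive E; exact: lim_cst.
Qed.

Lemma space_continuous : continuous (@space R d).
Proof.
move=> z; apply: row_continuous => i.
rewrite (_ : (fun y => _) = fun y : 'rV[R]_d.+1 => y ord0 (lift ord0 i)); first exact: coord_continuous.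
by apply/funext => y; rewrite mxE.
Qed.

Lemma smooth_on_space g : smooth_on setT g -> smooth_on setT (fun z => g (space z)).
Proof.
move=> gs; apply: (@smooth_on_alg R d.+1 setT
  (fun h => exists2 k, smooth_on setT k & h = fun z => k (space z))) => //.
- exact: openT.
- move=> h z [k ks ->] _; apply: (@continuous_comp _ _ _ (@space R d)).
    exact: space_continuous.
  exact: smooth_on_cont ks _.
- move=> h i [k ks ->]; have [->|[j ->]] : i = ord0 \/ exists j, i = lift ord0 j.
    by case: (unliftP ord0 i) => [j ->|->]; [right; exists j|left].
    exists (fun=> 0); first exact/SAsmooth/smooth_on_cst/openT.
    by move=> z _; exact: is_derive_space_time.
  exists (fun z => partial j k (space z)).
    by apply: SAgen; exists (partial j k); [exact: smooth_on_partial|].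
  by move=> z _; apply: is_derive_space_lift; exact: smooth_on_is_derive ks _.
- by apply: SAgen; exists g.
Qed.

End Space.

Lemma continuous_pointwise (T U : topologicalType) (f : T -> U) :
  (forall x, {for x, continuous f}) -> continuous f.
Proof. by []. Qed.

Section PointwiseContinuity.
Context {R : realType} {T : topologicalType}.
Implicit Types f g : T -> R.

Lemma continuous_at_mul f g x : {for x, continuous f} -> {for x, continuous g} ->
  {for x, continuous (fun y => f y * g y)}.
Proof. by move=> ? ?; exact: continuousM. Qed.

Lemma continuous_at_add f g x : {for x, continuous f} -> {for x, continuous g} ->
  {for x, continuous (fun y => f y + g y)}.
Proof. by move=> ? ?; exact: continuousD. Qed.

Lemma continuous_at_sub f g x : {for x, continuous f} -> {for x, continuous g} ->
  {for x, continuous (fun y => f y - g y)}.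
Proof. by move=> ? ?; exact: continuousB. Qed.

Lemma continuous_at_sum (I : Type) (r : seq I) (F : I -> T -> R) x :
  (forall i, {for x, continuous (F i)}) -> {for x, continuous (fun y => \sum_(i <- r) F i y)}.
Proof. by move=> Fc; apply: cvg_sumr => i; exact: Fc. Qed.

Lemma continuous_mul f g : continuous f -> continuous g ->
  continuous (fun y => f y * g y).
Proof. by move=> fc gc x; apply: continuous_at_mul; [exact: fc|exact: gc]. Qed.

Lemma continuous_add f g : continuous f -> continuous g ->
  continuous (fun y => f y + g y).
Proof. by move=> fc gc x; apply: continuous_at_add; [exact: fc|exact: gc]. Qed.

Lemma continuous_sub f g : continuous f -> continuous g ->
  continuous (fun y => f y - g y).
Proof. by move=> fc gc x; apply: continuous_at_sub; [exact: fc|exact: gc]. Qed.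

Lemma continuous_sum (I : Type) (r : seq I) (F : I -> T -> R) :
  (forall i, continuous (F i)) -> continuous (fun y => \sum_(i <- r) F i y).
Proof. by move=> Fc x; apply: continuous_at_sum => i; exact: Fc. Qed.

Lemma continuous_const (c : R) : continuous (fun _ : T => c).
Proof. by move=> x; exact: cvg_cst. Qed.

End PointwiseContinuity.

(** * Parameter integrals *)

Section ContinuousFunctional.
Context {R : realType}.

(** An integral over a compact set A of mass at most C, seen only through linearity and the sup
    bound on continuous functions. These suffice for continuity and differentiation under the
    integral sign, and they pass to iterated integrals. *)
Record cfunctional (P : topologicalType) (A : set P) (C : R) (J : (P -> R) -> R) : Prop :=
  CFunctional {
    cf_compact : compact A ;
    cf_ge0 : 0 <= C ;
    cf_lin : forall (g h : P -> R) (c : R), continuous g -> continuous h ->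
      J (fun p => g p + c * h p) = J g + c * J h ;
    cf_bound : forall (g : P -> R) (M : R), continuous g -> (forall p, A p -> `|g p| <= M) ->
      `|J g| <= C * M }.

Section Functional.
Context {P : topologicalType} {A : set P} {C : R} {J : (P -> R) -> R}.
Hypothesis JP : cfunctional A C J.

Lemma cfD (g h : P -> R) : continuous g -> continuous h ->
  J (fun p => g p + h p) = J g + J h.
Proof.
move=> gc hc; rewrite -[J h]mul1r -(cf_lin JP)//.
by congr J; apply/funext => p; rewrite mul1r.
Qed.

Lemma cfZ (c : R) (g : P -> R) : continuous g -> J (fun p => c * g p) = c * J g.
Proof.
move=> gc; have z0 : J (fun=> 0) = 0.
  have E : (fun p : P => (fun=> 0) p + 1 * (fun=> 0) p) = (fun=> 0) :> (P -> R).
    by apply/funext => p; rewrite mulr0 addr0.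
  have : J (fun=> 0) = J (fun=> 0) + 1 * J (fun=> 0).
    by rewrite -[in LHS]E; apply: (cf_lin JP); exact: cst_continuous.
  by rewrite mul1r => /eqP; rewrite -subr_eq0 opprD addrA subrr sub0r oppr_eq0 => /eqP.
rewrite -[RHS]add0r -z0 -(cf_lin JP)//; last exact: cst_continuous.
by congr J; apply/funext => p; rewrite add0r.
Qed.

Lemma cfB (g h : P -> R) : continuous g -> continuous h ->
  J (fun p => g p - h p) = J g - J h.
Proof.
move=> gc hc; rewrite -[J h]mul1r -mulNr -(cf_lin JP)//.
by congr J; apply/funext => p; rewrite mulN1r.
Qed.

Lemma cf_sum (I : Type) (r : seq I) (g : I -> P -> R) : (forall i, continuous (g i)) ->
  J (fun p => \sum_(i <- r) g i p) = \sum_(i <- r) J (g i).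
Proof.
move=> gc; elim: r => [|i r IH].
  rewrite big_nil (_ : (fun p => _) = fun p => 0 * 0); last first.
    by apply/funext => p; rewrite big_nil mul0r.
  by rewrite (@cfZ 0 (fun=> 0)) ?mul0r//; exact: continuous_const.
rewrite big_cons -IH -cfD//; last exact: continuous_sum.
by congr J; apply/funext => p; rewrite big_cons.
Qed.

(** Tube lemma: joint continuity along {z0} x A is uniform in p because A is compact. *)
Lemma near_unif (Z : topologicalType) (g : Z -> P -> R) z0 (e : R) : 0 < e ->
  (forall p, A p -> {for (z0, p), continuous (fun q : Z * P => g q.1 q.2)}) ->
  \forall z \near z0, forall p, A p -> `|g z0 p - g z p| <= e.
Proof.
move=> e0 gc.
have /compact_near_coveringP cA := cf_compact JP.
apply: (cA Z (nbhs z0) (fun z p => `|g z0 p - g z p| <= e)) => p Ap.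
have e2 : 0 < e / 2 by rewrite divr_gt0.
have /cvgrPdist_le/(_ _ e2) H := gc p Ap.
have H1 : \forall q \near p & z \near z0, `|g z0 p - g z0 q| <= e / 2.
  have : (z0, qz.1) @[qz --> (p, z0)] --> (z0, p).
    by apply: cvg_pair; [exact: cvg_cst|exact: cvg_fst].
  by move=> /(_ _ H).
have H2 : \forall q \near p & z \near z0, `|g z0 p - g z q| <= e / 2.
  have : (qz.2, qz.1) @[qz --> (p, z0)] --> (z0, p).
    by apply: cvg_pair; [exact: cvg_snd|exact: cvg_fst].
  by move=> /(_ _ H).
apply: filterS2 H1 H2 => -[q z] /= a b.
by rewrite -(subrKA (g z0 p)) (le_trans (ler_normD _ _))// (splitr e) lerD// distrC.
Qed.

Lemma cf_continuous (Z : topologicalType) (g : Z -> P -> R) z0 :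
  (\forall z \near z0, continuous (g z)) ->
  (forall p, A p -> {for (z0, p), continuous (fun q : Z * P => g q.1 q.2)}) ->
  {for z0, continuous (fun z => J (g z))}.
Proof.
move=> gn gc; apply/cvgrPdist_le => e e0.
have C0 := cf_ge0 JP.
have e1 : 0 < e / (C + 1) by rewrite divr_gt0// ltr_wpDl.
have H := near_unif e1 gc.
near=> z.
have gz : continuous (g z) by near: z.
have g0 : continuous (g z0) := nbhs_singleton gn.
rewrite -cfB//; apply: le_trans (_ : C * (e / (C + 1)) <= _).
  apply: (cf_bound JP); first by move=> p; apply: continuousB; [exact: g0|exact: gz].
  by near: z.
rewrite mulrCA ger_pMr// ler_pdivrMr ?mul1r ?ltr_wpDl//.
by rewrite lerDl.
Unshelve. all: by end_near. Qed.

(** For each p the difference quotient equals g' at an intermediate point; by [near_unif] it is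
    close to g' x0 uniformly in p, and the sup bound of J concludes. *)
Lemma cf_is_derive (g g' : R -> P -> R) x0 :
  (\forall x \near x0, [/\ continuous (g x), continuous (g' x) &
     forall p, is_derive x 1 (g ^~ p) (g' x p)]) ->
  (forall p, A p -> {for (x0, p), continuous (fun q : R * P => g' q.1 q.2)}) ->
  is_derive x0 1 (fun x => J (g x)) (J (g' x0)).
Proof.
move=> gn gc.
suff L : h^-1 *: (J (g (h *: 1 + x0)) - J (g x0)) @[h --> 0^'] --> J (g' x0).
  by split; [apply/cvg_ex; eexists; exact: L|exact/cvg_lim].
apply/cvgrPdist_le => e e0.
have C0 := cf_ge0 JP.
have e1 : 0 < e / (C + 1) by rewrite divr_gt0// ltr_wpDl.
have H := near_unif e1 gc.
have [r r0 rH] : exists2 r : R, 0 < r & forall x, `|x - x0| < r -> [/\ continuous (g x), continuous (g' x) ,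
     forall p, is_derive x 1 (g ^~ p) (g' x p) &
   forall p, A p -> `|g' x0 p - g' x p| <= e / (C + 1)].
  have /nbhs_normP[r1 /= r10 r1H] := gn.
  have /nbhs_normP[r2 /= r20 r2H] := H.
  exists (Num.min r1 r2); first by rewrite lt_min r10 r20.
  move=> x; rewrite lt_min distrC => /andP[xr1 xr2].
  by have [] := r1H x xr1; split => //; exact: (r2H x xr2).
near=> h.
have h0 : h != 0 by near: h; exact: nbhs_dnbhs_neq.
have hr : `|h| < r by near: h; exact: dnbhs0_lt.
have hx : `|h *: 1 + x0 - x0| < r by rewrite addrK [_ *: 1]mulr1.
have xx : `|x0 - x0| < r by rewrite subrr normr0.
have [gh _ _ _] := rH _ hx.
have [g0 g'0 _ _] := rH _ xx.
have bc : continuous (fun p => g (h *: 1 + x0) p - g x0 p).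
  exact: continuous_sub gh g0.
have kc : continuous (fun p => h^-1 * (g (h *: 1 + x0) p - g x0 p)).
  exact: continuous_mul (@continuous_const _ _ _) bc.
have -> : J (g' x0) - h^-1 *: (J (g (h *: 1 + x0)) - J (g x0)) =
   J (fun p => g' x0 p - h^-1 * (g (h *: 1 + x0) p - g x0 p)).
  by rewrite cfB// cfZ// cfB.
apply: le_trans (_ : C * (e / (C + 1)) <= _); last first.
  by rewrite mulrCA ger_pMr// ler_pdivrMr ?mul1r ?ltr_wpDl// lerDl.
apply: (cf_bound JP) => p; first exact: continuous_sub g'0 kc p.
move=> Ap.
(* The point c depends on p, but the radius r does not. *)
have [c cP ->] : exists2 c, `|c - x0| < r & g (h *: 1 + x0) p - g x0 p = g' c p * h.
  rewrite [h *: 1]mulr1.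
  have [h1|h1] := ltP 0 h.
    have [|x| |c cI E] := @MVT R (g ^~ p) (g' ^~ p) x0 (h + x0).
    - by rewrite ltrDr.
    - rewrite in_itv /= => /andP[x1 x2]; have [|_ _ D _] := rH x; last exact: D.
      by rewrite gtr0_norm ?subr_gt0// ltrBlDr (lt_trans x2)// ltrD2r -(gtr0_norm h1).
    - apply: derivable_within_continuous => x; rewrite in_itv /= => /andP[x1 x2].
      have [|_ _ D _] := rH x; last exact: (@ex_derive _ _ _ _ _ _ _ (D p)).
      by rewrite ger0_norm ?subr_ge0// ltrBlDr (le_lt_trans x2)// ltrD2r -(gtr0_norm h1).
    exists c; last by rewrite E addrK.
    move: cI; rewrite in_itv /= => /andP[x1 x2].
    by rewrite gtr0_norm ?subr_gt0// ltrBlDr (lt_trans x2)// ltrD2r -(gtr0_norm h1).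
  have {}h1 : h < 0 by rewrite lt_neqAle h0 h1.
  have hn : `|h| = - h by rewrite ltr0_norm.
  have [|x| |c cI E] := @MVT R (g ^~ p) (g' ^~ p) (h + x0) x0.
  - by rewrite gtrDr.
  - rewrite in_itv /= => /andP[x1 x2]; have [|_ _ D _] := rH x; last exact: D.
    by rewrite ltr0_norm ?subr_lt0//; lra.
  - apply: derivable_within_continuous => x; rewrite in_itv /= => /andP[x1 x2].
    have [|_ _ D _] := rH x; last exact: (@ex_derive _ _ _ _ _ _ _ (D p)).
    by rewrite ler0_norm ?subr_le0//; lra.
  exists c; last by rewrite -[LHS]opprB E; ring.
  move: cI; rewrite in_itv /= => /andP[x1 x2].
  by rewrite ltr0_norm ?subr_lt0//; lra.
rewrite [_ * h]mulrC mulKf//.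
by have [_ _ _] := rH c cP; apply.
Unshelve. all: by end_near. Qed.

Lemma cf_is_derive_dir n (G G' : 'rV[R]_n -> P -> R) z v :
  (forall y, continuous (G y)) -> (forall y, continuous (G' y)) ->
  (forall y p, is_derive y v (G ^~ p) (G' y p)) ->
  (forall y p, A p -> {for (y, p), continuous (fun q : 'rV[R]_n * P => G' q.1 q.2)}) ->
  is_derive z v (fun y => J (G y)) (J (G' z)).
Proof.
move=> Gc G'c GG' jc.
rewrite -[X in is_derive X](addr0 z) -(scale0r v); apply: is_derive_lineP.
have -> : G' z = G' (z + 0 *: v) by rewrite scale0r addr0.
apply: (@cf_is_derive (fun s => G (z + s *: v)) (fun s => G' (z + s *: v))).
  near=> x; split => // p.
  have := GG' (z + x *: v) p => -[D <-]; exact: is_derive_line.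
move=> p Ap.
have lc : (z + q.1 *: v, q.2) @[q --> ((0 : R), p)] --> (z + 0 *: v, p).
  apply: (@cvg_pair _ _ _ _ (nbhs (z + 0 *: v)) (nbhs p)); last exact: cvg_snd.
  apply: (@cvgD _ 'rV[R]_n); first exact: cvg_cst.
  by apply: cvgZr_tmp; exact: cvg_fst.
apply: (@continuous_comp _ _ _ (fun q : R * P => (z + q.1 *: v, q.2)) (fun q => G' q.1 q.2)) => //.
exact: jc.
Unshelve. all: by end_near. Qed.

End Functional.

Lemma slice_continuous (X Y Z : topologicalType) (g : X * Y -> Z) x :
  continuous g -> continuous (fun y => g (x, y)).
Proof.
move=> gc y; apply: (@continuous_comp _ _ _ (fun y => (x, y)) g); last exact: gc.
by apply: cvg_pair; [exact: cvg_cst|exact: cvg_id].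
Qed.

(** Multiple integrals are defined as iterated ones; continuity of the inner integral in the outer
    variable is [cf_continuous]. *)
Lemma cfunctional_prod (P Q : topologicalType) (A : set P) (B : set Q) C D J J' :
  cfunctional A C J -> cfunctional B D J' ->
  cfunctional (A `*` B) (C * D) (fun g : P * Q -> R => J (fun x => J' (fun y => g (x, y)))).
Proof.
move=> JP JQ.
have sl (g : P * Q -> R) : continuous g -> continuous (fun x => J' (fun y => g (x, y))).
  move=> gc x; apply: (cf_continuous JQ).
    by near=> z; exact: slice_continuous.
  by move=> p _ ; have -> : (fun q : P * Q => g (q.1, q.2)) = g; [apply/funext => -[]|exact: gc].
split.
- exact: compact_setX (cf_compact JP) (cf_compact JQ).
- by rewrite mulr_ge0 ?(cf_ge0 JP) ?(cf_ge0 JQ).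
- move=> g h c gc hc.
  have -> : (fun x => J' (fun y => g (x, y) + c * h (x, y))) =
      (fun x => J' (fun y => g (x, y)) + c * J' (fun y => h (x, y))).
    by apply/funext => x; apply: (cf_lin JQ c); exact: slice_continuous.
  by rewrite (cf_lin JP c)//; exact: sl.
- move=> g M gc gM; rewrite -mulrA; apply: (cf_bound JP); first exact: sl.
  move=> x Ax; apply: (cf_bound JQ); first exact: slice_continuous.
  by move=> y By; exact: gM.
Unshelve. all: by end_near. Qed.

End ContinuousFunctional.

Section IntervalIntegral.
Context {R : realType}.
Implicit Types (g : R -> R) (a b : R).

Definition itv_int a b g : R := \int[@lebesgue_measure R]_(x in `[a, b]) g x.

Let integrable_itv a b g : continuous g ->
  (@lebesgue_measure R).-integrable `[a, b] (EFin \o g).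
Proof.
move=> gc; apply: continuous_compact_integrable; first exact: segment_compact.
exact: continuous_subspaceT.
Qed.

Lemma cfunctional_itv a b : a < b -> cfunctional `[a, b]%classic (b - a) (itv_int a b).
Proof.
move=> ab; split.
- exact: segment_compact.
- by rewrite subr_ge0 ltW.
- move=> g h c gc hc; rewrite /itv_int RintegralD//.
  + by rewrite RintegralZl//; exact: integrable_itv.
  + exact: integrable_itv.
  + by apply: integrable_itv; exact: continuous_mul (@continuous_const _ _ _) hc.
- move=> g M gc gM; apply: le_trans (le_normr_Rintegral _ _) _ => //.
    exact: integrable_itv.
  have -> : (b - a) * M = \int[@lebesgue_measure R]_(x in `[a, b]) M.
    rewrite Rintegral_cst//= lebesgue_measure_itv /= lte_fin ab mulrC.
    by rewrite -EFinD.
  apply: le_Rintegral => //.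
  + by apply: integrable_itv => x; apply: (@continuous_comp _ _ _ g); [exact: gc|exact: norm_continuous].
  + by apply: integrable_itv; exact: continuous_const.
Qed.

Lemma itv_int_FTC a b (G g : R -> R) : a < b -> continuous g ->
  (forall x : R, is_derive x 1 G (g x)) -> itv_int a b g = G b - G a.
Proof.
move=> ab gc dG; have Gc : continuous G.
  by move=> x; apply/differentiable_continuous/derivable1_diffP; exact: ex_derive.
rewrite /itv_int /Rintegral (@continuous_FTC2 _ g G a b) ?fineK//.
- exact: continuous_subspaceT.
- split.
  + by move=> x _; exact: ex_derive.
  + exact/cvg_at_right_filter/Gc.
  + exact/cvg_at_left_filter/Gc.
- by move=> x _; rewrite derive1E; exact: derive_val.
Qed.

(** The fundamental theorem is applied to x |-> J (G (x, .)), differentiated under J, so the order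
    of integration is never exchanged. *)
Lemma itv_int_cf_FTC (P : topologicalType) (A : set P) C J a b (G g : R * P -> R) :
  a < b -> cfunctional A C J -> continuous G -> continuous g ->
  (forall (x : R) p, is_derive x 1 (fun y => G (y, p)) (g (x, p))) ->
  itv_int a b (fun x => J (fun p => g (x, p))) =
  J (fun p => G (b, p)) - J (fun p => G (a, p)).
Proof.
move=> ab JP Gc gc dG.
have gg : (fun q : R * P => g (q.1, q.2)) = g by apply/funext => -[].
apply: (@itv_int_FTC a b (fun x => J (fun p => G (x, p)))) => //.
  move=> x; apply: (cf_continuous JP); last by move=> p _; rewrite gg; exact: gc.
  by near=> y; exact: slice_continuous.
move=> x; apply: (@cf_is_derive _ _ _ _ _ JP (fun x p => G (x, p)) (fun x p => g (x, p))).
  by near=> y; split => //; exact: slice_continuous.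
by move=> p _; rewrite gg; exact: gc.
Unshelve. all: by end_near. Qed.

End IntervalIntegral.

(** * Integration over the unit sphere *)

Section Sphere.
Context {R : realType}.
Implicit Types (p : R * R).

(* Integration over the unit sphere in polar coordinates p = (theta, phi); the
   area density sin theta is left to the integrand. *)
Definition sph_int (g : R * R -> R) : R :=
  itv_int 0 pi (fun th => itv_int 0 (pi *+ 2) (fun ph => g (th, ph))).

Definition sph_dom : set (R * R) := `[0, pi]%classic `*` `[0, pi *+ 2]%classic.

Definition sph_cst : R := (pi - 0) * (pi *+ 2 - 0).

Lemma cfunctional_sph : cfunctional sph_dom sph_cst sph_int.
Proof.
apply: cfunctional_prod; apply: cfunctional_itv; first exact: pi_gt0.
by rewrite mulr2n addr_gt0// pi_gt0.
Qed.

(** With [sph_int_dphi] this replaces the divergence theorem on the sphere: theta-derivatives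
    integrate to zero if G vanishes at both poles, phi-derivatives if G is periodic. *)
Lemma sph_int_dtheta (G g : R * R -> R) : continuous G -> continuous g ->
  (forall th ph : R, is_derive th 1 (fun y => G (y, ph)) (g (th, ph))) ->
  (forall ph, G (0, ph) = 0) -> (forall ph, G (pi, ph) = 0) -> sph_int g = 0.
Proof.
move=> Gc gc dG G0 Gpi; have pi2 : (0 : R) < pi *+ 2 by rewrite mulr2n addr_gt0// pi_gt0.
have cI := cfunctional_itv pi2.
rewrite /sph_int (itv_int_cf_FTC (pi_gt0 R) cI Gc gc)//.
have -> : (fun ph => G (pi, ph)) = (fun ph => G (0, ph)).
  by apply/funext => ph; rewrite G0 Gpi.
by rewrite subrr.
Qed.

Lemma sph_int_dphi (G g : R * R -> R) : continuous g ->
  (forall th ph : R, is_derive ph 1 (fun y => G (th, y)) (g (th, ph))) ->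
  (forall th, G (th, 0) = G (th, pi *+ 2)) -> sph_int g = 0.
Proof.
move=> gc dG Gp; have pi2 : (0 : R) < pi *+ 2 by rewrite mulr2n addr_gt0// pi_gt0.
rewrite /sph_int (_ : (fun th => _) = fun=> 0); last first.
  apply/funext => th; rewrite (@itv_int_FTC _ 0 (pi *+ 2) (fun y => G (th, y)))//.
    by rewrite Gp subrr.
  exact: slice_continuous.
rewrite (@itv_int_FTC _ 0 pi (fun=> 0)) ?subrr ?pi_gt0//.
exact: continuous_const.
Qed.

Let dscalel (f : R -> R) (c x df : R) : is_derive x 1 f df ->
  is_derive x 1 (fun y => c * f y) (c * df).
Proof. by move=> D; exact: is_deriveZ. Qed.

Let dscale (f : R -> R) (c x df : R) : is_derive x 1 f df ->
  is_derive x 1 (fun y => f y * c) (df * c).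
Proof.
move=> D; rewrite mulrC (_ : (fun y => _) = (fun y => c * f y)); first exact: dscalel.
by apply/funext => y; rewrite mulrC.
Qed.

Lemma sph_int_sin : sph_int (fun p => sin p.1) = (pi *+ 2) * 2.
Proof.
have pi2 : (0 : R) < pi *+ 2 by rewrite mulr2n addr_gt0// pi_gt0.
rewrite /sph_int (_ : (fun th => _) = fun th => (pi *+ 2) * sin th); last first.
  apply/funext => th /=.
  have D (x : R) : is_derive x 1 (fun y => sin th * y) (sin th).
    by have := dscalel (sin th) (is_derive_id x 1); rewrite mulr1.
  rewrite (itv_int_FTC pi2 (@continuous_const _ _ (sin th)) D).
  by rewrite mulr0 subr0 mulrC.
have D (x : R) : is_derive x 1 (fun th => - (pi *+ 2) * cos th) (pi *+ 2 * sin x).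
  by have := dscalel (- (pi *+ 2)) (is_derive_cos x); rewrite mulrNN.
rewrite (itv_int_FTC (pi_gt0 R) _ D); first by rewrite cospi cos0; ring.
by apply: continuous_mul; [exact: continuous_const|exact: continuous_sin].
Qed.

Lemma sph_int_sin_gt0 : 0 < sph_int (fun p => sin p.1).
Proof. by rewrite sph_int_sin mulr_gt0// mulr2n addr_gt0// pi_gt0. Qed.

(* Components of the point omega of the unit sphere, of alpha = d omega / d theta,
   and of beta, where d omega / d phi = sin theta * beta. *)
Definition omega (i : nat) p : R :=
  match i with
  | 0 => sin p.1 * cos p.2
  | 1 => sin p.1 * sin p.2
  | _ => cos p.1
  end.

Definition alpha (i : nat) p : R :=
  match i with
  | 0 => cos p.1 * cos p.2
  | 1 => cos p.1 * sin p.2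
  | _ => - sin p.1
  end.

Definition beta (i : nat) p : R :=
  match i with
  | 0 => - sin p.2
  | 1 => cos p.2
  | _ => 0
  end.

Lemma sin1_continuous : continuous (fun p : R * R => sin p.1).
Proof. by move=> p; apply: (@continuous_comp _ _ _ fst (@sin R)); [exact: cvg_fst|exact: continuous_sin]. Qed.
Lemma cos1_continuous : continuous (fun p : R * R => cos p.1).
Proof. by move=> p; apply: (@continuous_comp _ _ _ fst (@cos R)); [exact: cvg_fst|exact: continuous_cos]. Qed.
Lemma sin2_continuous : continuous (fun p : R * R => sin p.2).
Proof. by move=> p; apply: (@continuous_comp _ _ _ snd (@sin R)); [exact: cvg_snd|exact: continuous_sin]. Qed.
Lemma cos2_continuous : continuous (fun p : R * R => cos p.2).
Proof. by move=> p; apply: (@continuous_comp _ _ _ snd (@cos R)); [exact: cvg_snd|exact: continuous_cos]. Qed.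

Lemma omega_continuous i : continuous (omega i).
Proof.
case: i => [|[|i]] /=.
- exact: continuous_mul sin1_continuous cos2_continuous.
- exact: continuous_mul sin1_continuous sin2_continuous.
- exact: cos1_continuous.
Qed.

Lemma alpha_continuous i : continuous (alpha i).
Proof.
case: i => [|[|i]] /=.
- exact: continuous_mul cos1_continuous cos2_continuous.
- exact: continuous_mul cos1_continuous sin2_continuous.
- by move=> p; apply: continuousN; exact: sin1_continuous.
Qed.

Lemma beta_continuous i : continuous (beta i).
Proof.
case: i => [|[|i]] /=.
- by move=> p; apply: continuousN; exact: sin2_continuous.
- exact: cos2_continuous.
- exact: continuous_const.
Qed.

Lemma is_derive_omega_theta (i : nat) (th ph : R) :
  is_derive th 1 (fun y => omega i (y, ph)) (alpha i (th, ph)).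
Proof.
by case: i => [|[|i]] /=;
  [exact: (dscale _ (is_derive_sin th))|exact: (dscale _ (is_derive_sin th))|exact: is_derive_cos].
Qed.

Lemma is_derive_alpha_theta (i : nat) (th ph : R) :
  is_derive th 1 (fun y => alpha i (y, ph)) (- omega i (th, ph)).
Proof.
case: i => [|[|i]] /=.
- by rewrite -mulNr; exact: (dscale _ (is_derive_cos th)).
- by rewrite -mulNr; exact: (dscale _ (is_derive_cos th)).
- exact: is_deriveN.
Qed.

Lemma is_derive_omega_phi (i : nat) (th ph : R) :
  is_derive ph 1 (fun y => omega i (th, y)) (sin th * beta i (th, ph)).
Proof.
case: i => [|[|i]] /=; [exact: (dscalel _ (is_derive_cos ph))|
  exact: (dscalel _ (is_derive_sin ph))|].
by rewrite mulr0; exact: is_derive_cst.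
Qed.

(** The derivative (- cos phi, - sin phi, 0) is written in the frame, so that its alpha part cancels
    against the theta-derivative of sin theta in the divergence below. *)
Lemma is_derive_beta_phi (i : nat) (th ph : R) : is_derive ph 1 (fun y => beta i (th, y))
  (- (sin th * omega i (th, ph) + cos th * alpha i (th, ph))).
Proof.
have cs := cos2Dsin2 th.
case: i => [|[|i]] /=.
- rewrite !mulrA -mulrDl -!expr2 [_ + _]addrC cs mul1r.
  exact: is_deriveN.
- by rewrite !mulrA -mulrDl -!expr2 [_ + _]addrC cs mul1r; exact: is_derive_cos.
- by rewrite mulrN mulrC subrr oppr0; exact: is_derive_cst.
Qed.

(** Completeness relation of the orthonormal frame omega, alpha, beta of R^3. It is componentwise,
    hence can be restricted to the first d components. *)
Lemma sphere_frame (i j : nat) p : (i < 3)%N -> (j < 3)%N ->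
  omega i p * omega j p + alpha i p * alpha j p + beta i p * beta j p = (i == j)%:R.
Proof.
have c1 := cos2Dsin2 p.1; have c2 := cos2Dsin2 p.2.
have c1' (x : R) : sin p.1 ^+ 2 * x = x - cos p.1 ^+ 2 * x by rewrite -[X in _ = X - _]mul1r -c1; ring.
have c2' : sin p.2 ^+ 2 = 1 - cos p.2 ^+ 2 by rewrite -c2; ring.
case: i => [|[|[|i]]] // _; case: j => [|[|[|j]]] // _ /=.
- transitivity (sin p.1 ^+ 2 * cos p.2 ^+ 2 + cos p.1 ^+ 2 * cos p.2 ^+ 2 + sin p.2 ^+ 2); first by ring.
  by rewrite c1' c2'; ring.
- transitivity (sin p.1 ^+ 2 * (cos p.2 * sin p.2) + (cos p.1 ^+ 2 - 1) * (cos p.2 * sin p.2)); first by ring.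
  by rewrite c1'; ring.
- by ring.
- transitivity (sin p.1 ^+ 2 * (cos p.2 * sin p.2) + (cos p.1 ^+ 2 - 1) * (cos p.2 * sin p.2)); first by ring.
  by rewrite c1'; ring.
- transitivity (sin p.1 ^+ 2 * sin p.2 ^+ 2 + cos p.1 ^+ 2 * sin p.2 ^+ 2 + cos p.2 ^+ 2); first by ring.
  by rewrite c1' c2'; ring.
- by ring.
- by ring.
- by ring.
- by rewrite -c1; ring.
Qed.

End Sphere.

Lemma is_derive_bigsum (R : realType) (V : normedModType R) n (F : 'I_n -> V -> R)
    (dF : 'I_n -> R) x v : (forall i, is_derive x v (F i) (dF i)) ->
  is_derive x v (fun y => \sum_(i < n) F i y) (\sum_(i < n) dF i).
Proof.
move=> D; rewrite (_ : (fun y => _) = \sum_(i < n) F i); first exact: is_derive_sum.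
by apply/funext => y; rewrite fct_sumE.
Qed.

Section DeriveR.
Context {R : realType} {V : normedModType R}.
Implicit Types (f g : V -> R).

Lemma is_derive_add f g x v a b : is_derive x v f a -> is_derive x v g b ->
  is_derive x v (fun y => f y + g y) (a + b).
Proof. by move=> ? ?; exact: is_deriveD. Qed.

Lemma is_derive_sub f g x v a b : is_derive x v f a -> is_derive x v g b ->
  is_derive x v (fun y => f y - g y) (a - b).
Proof. by move=> ? ?; exact: is_deriveB. Qed.

Lemma is_derive_mul f g x v a b : is_derive x v f a -> is_derive x v g b ->
  is_derive x v (fun y => f y * g y) (a * g x + f x * b).
Proof.
move=> ? ?; rewrite addrC [a * _]mulrC; exact: is_deriveM.
Qed.

Lemma is_derive_mull f x v a (c : R) : is_derive x v f a ->
  is_derive x v (fun y => c * f y) (c * a).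
Proof. by move=> ?; exact: is_deriveZ. Qed.

Lemma is_derive_mulr f x v a (c : R) : is_derive x v f a ->
  is_derive x v (fun y => f y * c) (a * c).
Proof.
move=> D; rewrite mulrC (_ : (fun y => _) = (fun y => c * f y)); first exact: is_derive_mull.
by apply/funext => y; rewrite mulrC.
Qed.

End DeriveR.

(** * The backward light cone and derivatives along it *)

Section Cone.
Context {R : realType} {d : nat}.
Implicit Types (z y : 'rV[R]_d.+1) (q : R * (R * R)) (p : R * R) (s : R).
Implicit Types (G F : 'rV[R]_d.+1 -> R) (O : set 'rV[R]_d.+1).

Definition cdir s p : 'rV[R]_d.+1 :=
  \row_j (if unlift ord0 j is Some i then s * omega i p else - s).

(* The point (t (1 - s), x + t s omega(p)) of the backward cone of z = (t, x). *)
Definition cpt z q : 'rV[R]_d.+1 := z + time z *: cdir q.1 q.2.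

Lemma cptE0 z q : cpt z q ord0 ord0 = time z * (1 - q.1).
Proof. by rewrite !mxE unlift_none /time; ring. Qed.

Lemma cptEl z q (i : 'I_d) :
  cpt z q ord0 (li i) = z ord0 (li i) + time z * (q.1 * omega i q.2).
Proof. by rewrite !mxE liftK. Qed.

Lemma ord_cases (P : 'I_d.+1 -> Prop) : P ord0 -> (forall i, P (li i)) -> forall i, P i.
Proof. by move=> P0 Pl i; case: (unliftP ord0 i) => [j ->|->]. Qed.

Lemma time_continuous : continuous (@time R d).
Proof. exact: coord_continuous. Qed.

Lemma cpt_continuous : continuous (fun x : 'rV[R]_d.+1 * (R * (R * R)) => cpt x.1 x.2).
Proof.
have c1 : continuous (fun x : 'rV[R]_d.+1 * (R * (R * R)) => time x.1).
  by move=> x; apply: (@continuous_comp _ _ _ fst (@time R d)); [exact: cvg_fst|exact: time_continuous].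
have cs : continuous (fun x : 'rV[R]_d.+1 * (R * (R * R)) => x.2.1).
  by move=> x; apply: (@continuous_comp _ _ _ snd fst); [exact: cvg_snd|exact: cvg_fst].
suff C j : continuous (fun x : 'rV[R]_d.+1 * (R * (R * R)) => cpt x.1 x.2 ord0 j).
  by move=> x; apply: row_continuous => j; exact: C.
move: j; apply: ord_cases => [|i].
  rewrite (_ : (fun x => _) = fun x : 'rV[R]_d.+1 * (R * (R * R)) => time x.1 * (1 - x.2.1)).
    by apply: continuous_mul => //; apply: continuous_sub => //; exact: continuous_const.
  by apply/funext => x; rewrite cptE0.
rewrite (_ : (fun x => _) = fun x : 'rV[R]_d.+1 * (R * (R * R)) =>
    x.1 ord0 (li i) + time x.1 * (x.2.1 * omega i x.2.2)).
  apply: continuous_add.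
    by move=> x; apply: (@continuous_comp _ _ _ fst (fun z => z ord0 (li i)));
      [exact: cvg_fst|exact: coord_continuous].
  apply: continuous_mul => //; apply: continuous_mul => // x.
  apply: (@continuous_comp _ _ _ (fun w : 'rV[R]_d.+1 * (R * (R * R)) => w.2.2) (omega i)).
    by apply: (@continuous_comp _ _ _ snd snd); [exact: cvg_snd|exact: cvg_snd].
  exact: omega_continuous.
by apply/funext => x; rewrite cptEl.
Qed.

(** Derivative along a frame vector a = omega, alpha or beta, the radial one for omega. A function
    of d variables is constant in the missing coordinates of R^3, so the sum stops at d; [quad] is
    the second derivative of this kind. *)
Definition lin (a : nat -> R * R -> R) p G y : R :=
  \sum_(i < d) a i p * partial (li i) G y.

Definition quad (a b : nat -> R * R -> R) p G y : R :=
  \sum_(i < d) a i p * lin b p (partial (li i) G) y.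

Definition lap G y : R := \sum_(i < d) partial (li i) (partial (li i) G) y.

Definition box G y : R := partial ord0 (partial ord0 G) y - lap G y.

Lemma sum_split (c : 'I_d.+1 -> R) : \sum_i c i = c ord0 + \sum_(i < d) c (li i).
Proof. by rewrite big_ord_recl. Qed.

Section OnOpen.
Variables (O : set 'rV[R]_d.+1) (G : 'rV[R]_d.+1 -> R).
Hypotheses (oO : open O) (Gs : smooth_on O G).

Lemma smooth_lin a p : smooth_on O (lin a p G).
Proof.
exact: smooth_on_sum _ oO (fun i => smooth_onZ _ oO (smooth_on_partial _ Gs)).
Qed.

Lemma smooth_lap : smooth_on O (lap G).
Proof.
exact: smooth_on_sum _ oO (fun i => smooth_on_partial _ (smooth_on_partial _ Gs)).
Qed.

Lemma smooth_box : smooth_on O (box G).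
Proof.
exact: smooth_onB oO (smooth_on_partial _ (smooth_on_partial _ Gs)) smooth_lap.
Qed.

Lemma partial_lin a p j y : O y -> partial j (lin a p G) y = lin a p (partial j G) y.
Proof.
move=> Oy; have D : is_derive y 'e_j (lin a p G) (lin a p (partial j G) y).
  apply: is_derive_bigsum => i; apply: is_derive_mull.
  rewrite (partialC _ _ oO Gs Oy); apply: smooth_on_is_derive Oy.
  exact: smooth_on_partial.
exact: (@derive_val _ _ _ _ _ _ _ D).
Qed.

Lemma is_derive_cpt_s z s p : O (cpt z (s, p)) ->
  is_derive s 1 (fun s => G (cpt z (s, p)))
   (time z * (lin omega p G (cpt z (s, p)) - partial ord0 G (cpt z (s, p)))).
Proof.
move=> Oy; pose dc (i : 'I_d.+1) := if unlift ord0 i is Some i then time z * omega i p else - time z.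
have -> : time z * (lin omega p G (cpt z (s, p)) - partial ord0 G (cpt z (s, p))) =
   \sum_i dc i * partial i G (cpt z (s, p)).
  rewrite sum_split /dc unlift_none mulrBr addrC mulNr; congr (_ + _).
  by rewrite mulr_sumr; apply: eq_bigr => i _; rewrite liftK mulrA.
apply: (is_derive_curve (c := fun s => cpt z (s, p)) oO Gs Oy).
apply: ord_cases => [|i]; rewrite /dc ?unlift_none ?liftK.
  rewrite (_ : (fun s => _) = fun s => time z * (1 - s)); last first.
    by apply/funext => x; rewrite cptE0.
  have := is_derive_mull (time z) (is_derive_sub (is_derive_cst (1 : R) s (1 : R)) (is_derive_id s (1 : R))).
  by rewrite sub0r mulrN1.
rewrite (_ : (fun s => _) = fun s => z ord0 (li i) + time z * (s * omega i p)); last first.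
  by apply/funext => x; rewrite cptEl.
have := is_derive_add (is_derive_cst (z ord0 (li i)) s (1 : R))
  (is_derive_mull (time z) (is_derive_mulr (omega i p) (is_derive_id s (1 : R)))).
by rewrite add0r mul1r.
Qed.

Lemma is_derive_cpt_theta z s th ph : O (cpt z (s, (th, ph))) ->
  is_derive th 1 (fun x => G (cpt z (s, (x, ph))))
   (time z * s * lin alpha (th, ph) G (cpt z (s, (th, ph)))).
Proof.
move=> Oy; pose dc (i : 'I_d.+1) :=
  if unlift ord0 i is Some i then time z * s * alpha i (th, ph) else 0.
have -> : time z * s * lin alpha (th, ph) G (cpt z (s, (th, ph))) =
   \sum_i dc i * partial i G (cpt z (s, (th, ph))).
  rewrite sum_split /dc unlift_none mul0r add0r.
  by rewrite mulr_sumr; apply: eq_bigr => i _; rewrite liftK mulrA.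
apply: (is_derive_curve (c := fun x => cpt z (s, (x, ph))) oO Gs Oy).
apply: ord_cases => [|i]; rewrite /dc ?unlift_none ?liftK.
  rewrite (_ : (fun s => _) = fun=> time z * (1 - s)); first exact: is_derive_cst.
  by apply/funext => x; rewrite cptE0.
rewrite (_ : (fun s => _) = fun x => z ord0 (li i) + time z * s * omega i (x, ph)); last first.
  by apply/funext => x; rewrite cptEl mulrA.
have := is_derive_add (is_derive_cst (z ord0 (li i)) th (1 : R))
  (is_derive_mull (time z * s) (is_derive_omega_theta i th ph)).
by rewrite add0r.
Qed.

Lemma is_derive_cpt_phi z s th ph : O (cpt z (s, (th, ph))) ->
  is_derive ph 1 (fun x => G (cpt z (s, (th, x))))
   (time z * s * (sin th * lin beta (th, ph) G (cpt z (s, (th, ph))))).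
Proof.
move=> Oy; pose dc (i : 'I_d.+1) :=
  if unlift ord0 i is Some i then time z * s * (sin th * beta i (th, ph)) else 0.
have -> : time z * s * (sin th * lin beta (th, ph) G (cpt z (s, (th, ph)))) =
   \sum_i dc i * partial i G (cpt z (s, (th, ph))).
  rewrite sum_split /dc unlift_none mul0r add0r.
  by rewrite !mulr_sumr; apply: eq_bigr => i _; rewrite liftK !mulrA.
apply: (is_derive_curve (c := fun x => cpt z (s, (th, x))) oO Gs Oy).
apply: ord_cases => [|i]; rewrite /dc ?unlift_none ?liftK.
  rewrite (_ : (fun s => _) = fun=> time z * (1 - s)); first exact: is_derive_cst.
  by apply/funext => x; rewrite cptE0.
rewrite (_ : (fun s => _) = fun x => z ord0 (li i) + time z * s * omega i (th, x)); last first.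
  by apply/funext => x; rewrite cptEl mulrA.
have := is_derive_add (is_derive_cst (z ord0 (li i)) ph (1 : R))
  (is_derive_mull (time z * s) (is_derive_omega_phi i th ph)).
by rewrite add0r.
Qed.

End OnOpen.

Lemma is_derive_cpt_lift G z q i b : is_derive (cpt z q) 'e_(li i) G b ->
  is_derive z 'e_(li i) (fun z => G (cpt z q)) b.
Proof.
have E : (fun h : R => h^-1 *: ((G \o shift (cpt z q)) (h *: 'e_(li i)) - G (cpt z q))) =
  (fun h : R => h^-1 *: (((fun y => G (cpt y q)) \o shift z) (h *: 'e_(li i)) - G (cpt z q))).
  apply/funext => h /=; do 3 congr (_ _).
  by rewrite /cpt /time !mxE eqxx /= mulr0 add0r addrA.
move=> [du <-]; split; first by move: du; rewrite /derivable E.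
by rewrite /derive E.
Qed.

Lemma is_derive_cpt_time O G z q : open O -> smooth_on O G -> O (cpt z q) ->
  is_derive z 'e_ord0 (fun z => G (cpt z q))
    ((1 - q.1) * partial ord0 G (cpt z q) + q.1 * lin omega q.2 G (cpt z q)).
Proof.
move=> oO Gs Oy; rewrite -[X in is_derive X](addr0 z) -(scale0r 'e_ord0).
apply: is_derive_lineP.
pose dc (i : 'I_d.+1) := if unlift ord0 i is Some i then q.1 * omega i q.2 else 1 - q.1.
have -> : (1 - q.1) * partial ord0 G (cpt z q) + q.1 * lin omega q.2 G (cpt z q) =
   \sum_i dc i * partial i G (cpt (z + 0 *: 'e_ord0) q).
  rewrite scale0r addr0 sum_split /dc unlift_none; congr (_ + _).
  by rewrite mulr_sumr; apply: eq_bigr => i _; rewrite liftK mulrA.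
apply: (is_derive_curve (c := fun s => cpt (z + s *: 'e_ord0) q) oO Gs).
  by rewrite scale0r addr0.
have tE (s : R) : time (z + s *: 'e_ord0) = time z + s.
  by rewrite /time !mxE !eqxx mulr1.
apply: ord_cases => [|i]; rewrite /dc ?unlift_none ?liftK.
  rewrite (_ : (fun s => _) = fun s => (time z + s) * (1 - q.1)); last first.
    by apply/funext => x; rewrite cptE0 tE.
  have := is_derive_mulr (1 - q.1) (is_derive_add (is_derive_cst (time z) (0 : R) (1 : R)) (is_derive_id (0 : R) (1 : R))).
  by rewrite add0r mul1r.
rewrite (_ : (fun s => _) = fun s => z ord0 (li i) + (time z + s) * (q.1 * omega i q.2)); last first.
  by apply/funext => x; rewrite cptEl tE !mxE eqxx /= mulr0 addr0.
have := is_derive_add (is_derive_cst (z ord0 (li i)) (0 : R) (1 : R)) (is_derive_mulr (q.1 * omega i q.2) (is_derive_add (is_derive_cst (time z) (0 : R) (1 : R)) (is_derive_id (0 : R) (1 : R)))).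
by rewrite !add0r mul1r.
Qed.

End Cone.

Lemma slice_continuous_at (X Y Z : topologicalType) (g : X * Y -> Z) x y :
  {for (x, y), continuous g} -> {for y, continuous (fun y => g (x, y))}.
Proof.
move=> gc; apply: (@continuous_comp _ _ _ (fun y => (x, y)) g); last exact: gc.
by apply: cvg_pair; [exact: cvg_cst|exact: cvg_id].
Qed.

(** * Spherical means and the wave operator *)

Section SphericalMeans.
Context {R : realType} {d : nat}.
Hypothesis d3 : (d <= 3)%N.
Implicit Types (z y : 'rV[R]_d.+1) (q : R * (R * R)) (p : R * R) (s : R).
Implicit Types (G F : 'rV[R]_d.+1 -> R) (O : set 'rV[R]_d.+1).

(** Insert the completeness relation [sphere_frame] into the sum of delta_ij d_i d_j F. Here d <= 3
    enters: every index must be a component of the frame. *)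
Lemma lap_frame p F y :
  lap F y = quad omega omega p F y + quad alpha alpha p F y + quad beta beta p F y.
Proof.
rewrite /quad /lap -!big_split /=; apply: eq_bigr => i _.
have -> : omega i p * lin omega p (partial (li i) F) y + alpha i p * lin alpha p (partial (li i) F) y +
   beta i p * lin beta p (partial (li i) F) y = \sum_(j < d) (i == j)%:R * partial (li j) (partial (li i) F) y.
  rewrite /lin !mulr_sumr -!big_split /=; apply: eq_bigr => j _.
  rewrite -(@sphere_frame R i j p) ?(leq_trans (ltn_ord _))//.
  by rewrite !mulrDl !mulrA.
rewrite (bigD1 i)//= eqxx mul1r big1 ?addr0// => j ji.
by rewrite eq_sym (negbTE ji) mul0r.
Qed.

Section OnOpen.
Variables (O : set 'rV[R]_d.+1) (F : 'rV[R]_d.+1 -> R) (z : 'rV[R]_d.+1).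
Hypotheses (oO : open O) (Fs : smooth_on O F).

Lemma continuous_cpt q : {for q, continuous (cpt z)}.
Proof.
exact: (@slice_continuous_at _ _ _ (fun x : 'rV[R]_d.+1 * (R * (R * R)) => cpt x.1 x.2) z q
  (@cpt_continuous R d (z, q))).
Qed.

Lemma continuous_at_cpt G q : smooth_on O G -> O (cpt z q) ->
  {for q, continuous (fun q => G (cpt z q))}.
Proof.
move=> Gs Oq; apply: (@continuous_comp _ _ _ (cpt z) G); first exact: continuous_cpt.
exact: smooth_on_cont Gs Oq.
Qed.

Lemma continuous_at_ang (a : R * R -> R) q : continuous a ->
  {for q, continuous (fun q : R * (R * R) => a q.2)}.
Proof. by move=> ac; apply: (@continuous_comp _ _ _ snd a); [exact: cvg_snd|exact: ac]. Qed.

Lemma continuous_at_lin (a : nat -> R * R -> R) G q : (forall i, continuous (a i)) ->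
  smooth_on O G -> O (cpt z q) ->
  {for q, continuous (fun q => lin a q.2 G (cpt z q))}.
Proof.
move=> ac Gs Oq; apply: continuous_at_sum => i; apply: continuous_at_mul.
  exact: continuous_at_ang.
exact: continuous_at_cpt (smooth_on_partial _ Gs) Oq.
Qed.

Lemma continuous_at_quad (a b : nat -> R * R -> R) G q :
  (forall i, continuous (a i)) -> (forall i, continuous (b i)) ->
  smooth_on O G -> O (cpt z q) ->
  {for q, continuous (fun q => quad a b q.2 G (cpt z q))}.
Proof.
move=> ac bc Gs Oq; apply: continuous_at_sum => i; apply: continuous_at_mul.
  exact: continuous_at_ang.
exact: continuous_at_lin bc (smooth_on_partial _ Gs) Oq.
Qed.

Lemma is_derive_lin_theta (a : nat -> R * R -> R) (da : nat -> R) s (th ph : R) :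
  (forall i, is_derive th 1 (fun x => a i (x, ph)) (da i)) -> O (cpt z (s, (th, ph))) ->
  is_derive th 1 (fun x => lin a (x, ph) F (cpt z (s, (x, ph))))
   (\sum_(i < d) da i * partial (li i) F (cpt z (s, (th, ph))) +
    time z * s * quad a alpha (th, ph) F (cpt z (s, (th, ph)))).
Proof.
move=> D Oy; rewrite /quad mulr_sumr -big_split /=; apply: is_derive_bigsum => i.
rewrite [time z * s * _]mulrCA.
exact: (is_derive_mul (D i) (is_derive_cpt_theta oO (smooth_on_partial _ Fs) Oy)).
Qed.

Lemma is_derive_lin_phi (a : nat -> R * R -> R) (da : nat -> R) s (th ph : R) :
  (forall i, is_derive ph 1 (fun x => a i (th, x)) (da i)) -> O (cpt z (s, (th, ph))) ->
  is_derive ph 1 (fun x => lin a (th, x) F (cpt z (s, (th, x))))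
   (\sum_(i < d) da i * partial (li i) F (cpt z (s, (th, ph))) +
    time z * s * (sin th * quad a beta (th, ph) F (cpt z (s, (th, ph))))).
Proof.
move=> D Oy; rewrite /quad !mulr_sumr -big_split /=; apply: is_derive_bigsum => i.
rewrite [sin th * _]mulrCA [time z * s * _]mulrCA.
exact: (is_derive_mul (D i) (is_derive_cpt_phi oO (smooth_on_partial _ Fs) Oy)).
Qed.

(** [dP] is the theta-derivative of sin theta times the alpha-derivative of F, and [dQ] the
    phi-derivative of its beta-derivative: the two parts of the divergence of the tangential
    gradient on the sphere of radius t s. *)
Let dP s p := cos p.1 * lin alpha p F (cpt z (s, p)) + sin p.1 *
  (- lin omega p F (cpt z (s, p)) + time z * s * quad alpha alpha p F (cpt z (s, p))).

Let dQ s p := - (sin p.1 * lin omega p F (cpt z (s, p)) + cos p.1 * lin alpha p F (cpt z (s, p))) +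
   time z * s * (sin p.1 * quad beta beta p F (cpt z (s, p))).

Let Os s := forall p, O (cpt z (s, p)).

Let dPc s : Os s -> continuous (dP s).
Proof.
move=> Op; apply: continuous_pointwise => p.
have c1 := continuous_at_lin (@alpha_continuous R) Fs (Op p).
have c2 := continuous_at_lin (@omega_continuous R) Fs (Op p).
have c3 := continuous_at_quad (@alpha_continuous R) (@alpha_continuous R) Fs (Op p).
rewrite /dP; apply: continuous_at_add; apply: continuous_at_mul.
- exact: cos1_continuous.
- exact: (slice_continuous_at c1).
- exact: sin1_continuous.
- apply: continuous_at_add; first by apply: continuousN; exact: (slice_continuous_at c2).
  by apply: continuous_at_mul; [exact: continuous_const|exact: (slice_continuous_at c3)].
Qed.

Let dQc s : Os s -> continuous (dQ s).
Proof.
move=> Op; apply: continuous_pointwise => p.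
have c1 := continuous_at_lin (@alpha_continuous R) Fs (Op p).
have c2 := continuous_at_lin (@omega_continuous R) Fs (Op p).
have c3 := continuous_at_quad (@beta_continuous R) (@beta_continuous R) Fs (Op p).
rewrite /dQ; apply: continuous_at_add.
  apply: continuousN; apply: continuous_at_add; apply: continuous_at_mul.
  - exact: sin1_continuous.
  - exact: (slice_continuous_at c2).
  - exact: cos1_continuous.
  - exact: (slice_continuous_at c1).
apply: continuous_at_mul; first exact: continuous_const.
apply: continuous_at_mul; first exact: sin1_continuous.
exact: (slice_continuous_at c3).
Qed.

Let sph_dP s : Os s -> sph_int (dP s) = 0.
Proof.
move=> Op; apply: (@sph_int_dtheta _ (fun p => sin p.1 * lin alpha p F (cpt z (s, p)))).
- apply: continuous_pointwise => p; apply: continuous_at_mul; first exact: sin1_continuous.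
  by apply: (slice_continuous_at (continuous_at_lin _ Fs (Op p))); exact: alpha_continuous.
- exact: dPc.
- move=> th ph /=; apply: is_derive_mul.
  have := @is_derive_lin_theta alpha (fun i => - omega i (th, ph)) s th ph
    (fun i => is_derive_alpha_theta i th ph) (Op _).
  rewrite (_ : \sum_(i < d) _ = - lin omega (th, ph) F (cpt z (s, (th, ph))))//.
  by rewrite -sumrN; apply: eq_bigr => i _; rewrite mulNr.
- by move=> ph /=; rewrite sin0 mul0r.
- by move=> ph /=; rewrite sinpi mul0r.
Qed.

Let sph_dQ s : Os s -> sph_int (dQ s) = 0.
Proof.
move=> Op; apply: (@sph_int_dphi _ (fun p => lin beta p F (cpt z (s, p)))).
- exact: dQc.
- move=> th ph /=.
  have := @is_derive_lin_phi beta _ s th ph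
    (fun i => is_derive_beta_phi i th ph) (Op _).
  rewrite (_ : \sum_(i < d) _ = - (sin th * lin omega (th, ph) F (cpt z (s, (th, ph))) +
    cos th * lin alpha (th, ph) F (cpt z (s, (th, ph)))))//.
  rewrite /lin !mulr_sumr -big_split -sumrN; apply: eq_bigr => i _ /=.
  by rewrite mulNr mulrDl !mulrA.
- move=> th /=.
  have -> : cpt z (s, (th, 0)) = cpt z (s, (th, pi *+ 2)).
    rewrite /cpt; congr (_ + _ *: _); apply/rowP => j; rewrite !mxE /=.
    case: (unlift ord0 j) => // k; congr (_ * _).
    by case: (nat_of_ord k) => [|[|n]] //=; rewrite ?sin2pi ?sin0 ?cos2pi ?cos0.
  apply: eq_bigr => i _; congr (_ * _).
  by case: (nat_of_ord i) => [|[|n]] //=; rewrite ?sin2pi ?sin0 ?cos2pi ?cos0.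
Qed.

(** With rho = t s this is the polar form Delta = d_r^2 + (2 / rho) d_r + Delta_S / rho^2,
    multiplied by rho sin theta so that nothing is singular at s = 0. The right side is the
    Laplace-Beltrami part, whose integral vanishes. *)
Lemma sphere_laplacian_pointwise s p :
  sin p.1 * (time z * s * (lap F (cpt z (s, p)) - quad omega omega p F (cpt z (s, p))) -
     2 * lin omega p F (cpt z (s, p))) = dP s p + dQ s p.
Proof.
rewrite (lap_frame p) /dP /dQ.
move: (quad omega omega p F _) (quad alpha alpha p F _) (quad beta beta p F _) => a b c.
move: (lin alpha p F _) (lin omega p F _) (sin p.1) (cos p.1) (time z) => A W si co t.
by ring.
Qed.

Lemma sphere_laplacian s : (forall p, O (cpt z (s, p))) ->
  sph_int (fun p => sin p.1 * (time z * s * (lap F (cpt z (s, p)) -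
     quad omega omega p F (cpt z (s, p))) - 2 * lin omega p F (cpt z (s, p)))) = 0.
Proof.
move=> Op; rewrite (_ : (fun p => _) = fun p => dP s p + dQ s p).
  by rewrite (cfD cfunctional_sph (dPc Op) (dQc Op)) sph_dP// sph_dQ// addr0.
by apply/funext => p; exact: sphere_laplacian_pointwise.
Qed.

(* Values on the backward cone are related to data at an earlier time by the
   conical averages of [t s (d_t + d_r) F + F]. *)
Definition cone_data q : R := sin q.2.1 *
  (time z * q.1 * (partial ord0 F (cpt z q) + lin omega q.2 F (cpt z q)) + F (cpt z q)).

Let dcone q := sin q.2.1 * (2 * time z * lin omega q.2 F (cpt z q) + time z ^+ 2 * q.1 *
   (quad omega omega q.2 F (cpt z q) - partial ord0 (partial ord0 F) (cpt z q))).

Let continuous_dcone q : O (cpt z q) -> {for q, continuous dcone}.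
Proof.
move=> Oq; rewrite /dcone; apply: continuous_at_mul.
  by apply: (@continuous_at_ang (fun p => sin p.1)); exact: sin1_continuous.
apply: continuous_at_add; apply: continuous_at_mul.
- exact: continuous_const.
- by apply: continuous_at_lin => //; exact: omega_continuous.
- by apply: continuous_at_mul; [exact: continuous_const|exact: cvg_fst].
- apply: continuous_at_sub.
    by apply: continuous_at_quad => //; exact: omega_continuous.
  exact: continuous_at_cpt (smooth_on_partial _ (smooth_on_partial _ Fs)) Oq.
Qed.

Lemma continuous_cone_data q : O (cpt z q) -> {for q, continuous cone_data}.
Proof.
move=> Oq; rewrite /cone_data; apply: continuous_at_mul.
  by apply: (@continuous_at_ang (fun p => sin p.1)); exact: sin1_continuous.
apply: continuous_at_add; last exact: continuous_at_cpt.
apply: continuous_at_mul.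
  by apply: continuous_at_mul; [exact: continuous_const|exact: cvg_fst].
apply: continuous_at_add; last by apply: continuous_at_lin => //; exact: omega_continuous.
exact: continuous_at_cpt (smooth_on_partial _ Fs) Oq.
Qed.

(** Along the cone d/ds acts as t (d_r - d_t), and (d_r - d_t)(d_t + d_r) = d_r^2 - d_t^2: the mixed
    derivatives cancel. *)
Lemma is_derive_cone_data s p : O (cpt z (s, p)) ->
  is_derive s 1 (fun s => cone_data (s, p)) (dcone (s, p)).
Proof.
move=> Oy; rewrite /cone_data /dcone /=; apply: is_derive_mull.
have D0 := is_derive_cpt_s oO (smooth_on_partial ord0 Fs) Oy.
have D1 := is_derive_cpt_s oO (@smooth_lin _ _ _ _ oO Fs omega p) Oy.
have D := is_derive_cpt_s oO Fs Oy.
have E1 : lin omega p (lin omega p F) (cpt z (s, p)) = quad omega omega p F (cpt z (s, p)).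
  by rewrite /quad [LHS]/lin; apply: eq_bigr => i _; rewrite (partial_lin oO Fs).
rewrite E1 (partial_lin oO Fs _ _ _ Oy) in D1.
have := is_derive_add (is_derive_mul (is_derive_mull (time z) (is_derive_id s (1 : R)))
  (is_derive_add D0 D1)) D.
set X := (X in is_derive _ _ _ X -> _); set Y := (Y in _ -> is_derive _ _ _ Y).
suff -> : X = Y by [].
rewrite /X /Y.
move: (quad omega omega p F _) (lin omega p F _) (lin omega p (partial ord0 F) _).
move: (partial ord0 F _) (partial ord0 (partial ord0 F) _) (time z) => a b t A W B.
by ring.
Qed.

(** Kirchhoff's formula in differential form; integration over s from 0 to 1 would give the usual
    representation of F(z) by earlier data and box F. *)
Lemma is_derive_cone_mean s : (\forall s' \near s, forall p, O (cpt z (s', p))) ->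
  is_derive s 1 (fun s => sph_int (fun p => cone_data (s, p)))
    (- (time z ^+ 2 * s * sph_int (fun p => sin p.1 * box F (cpt z (s, p))))).
Proof.
move=> On; have Op := nbhs_singleton On.
have JP := @cfunctional_sph R.
have := @cf_is_derive _ _ _ _ _ JP (fun s p => cone_data (s, p)) (fun s p => dcone (s, p)) s.
have cb : continuous (fun p => sin p.1 * box F (cpt z (s, p))).
  apply: continuous_pointwise => p; apply: continuous_at_mul; first exact: sin1_continuous.
  apply: (@slice_continuous_at _ _ _ (fun q => box F (cpt z q))).
  exact: continuous_at_cpt (smooth_box oO Fs) (Op p).
suff -> : sph_int (fun p => dcone (s, p)) =
   - (time z ^+ 2 * s * sph_int (fun p => sin p.1 * box F (cpt z (s, p)))).
  apply.
    apply: filterS On => x Ox; split.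
    - by apply: continuous_pointwise => p; apply: slice_continuous_at; exact: continuous_cone_data.
    - by apply: continuous_pointwise => p; apply: slice_continuous_at; exact: continuous_dcone.
    - by move=> p; exact: is_derive_cone_data.
  move=> p _; rewrite (_ : (fun q => _) = dcone); first exact: continuous_dcone.
  by apply/funext => -[].
set g := fun p => sin p.1 * (time z * s * (lap F (cpt z (s, p)) -
     quad omega omega p F (cpt z (s, p))) - 2 * lin omega p F (cpt z (s, p))).
have gc : continuous g.
  rewrite (_ : g = fun p => dP s p + dQ s p).
    exact: continuous_add (dPc Op) (dQc Op).
  by apply/funext => p; exact: sphere_laplacian_pointwise.
have g0 : sph_int g = 0 := sphere_laplacian Op.
have kc (k : R) (h : R * R -> R) : continuous h -> continuous (fun p => k * h p).
  by move=> hc; exact: continuous_mul (@continuous_const _ _ k) hc.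
(* The term 2 t d_r F + t^2 s d_r^2 F is traded for t^2 s Delta F by means of g, whose integral is
   zero. *)
transitivity (- time z * sph_int g - time z ^+ 2 * s * sph_int (fun p => sin p.1 * box F (cpt z (s, p)))).
  rewrite -(cfZ JP (- time z) gc) -(cfZ JP (time z ^+ 2 * s) cb) -(cfB JP (kc _ _ gc) (kc _ _ cb)).
  congr sph_int; apply/funext => p; rewrite /dcone /box /g /=.
  move: (quad omega omega p F _) (lin omega p F _) (lap F _).
  move: (partial ord0 (partial ord0 F) _) (sin p.1) (time z) => a b t A W B.
  by ring.
by rewrite g0 mulr0 sub0r.
Qed.

End OnOpen.

End SphericalMeans.

(** * Duhamel's formula *)

Section Duhamel.
Context {R : realType} {d : nat}.
Implicit Types (z y : 'rV[R]_d.+1) (q : R * (R * R)) (p : R * R) (s : R).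
Implicit Types (G F : 'rV[R]_d.+1 -> R).
Local Notation P3 := (R * (R * R))%type.
Local Notation ZP := ('rV[R]_d.+1 * P3)%type.

Definition cone_int (g : P3 -> R) : R := itv_int 0 1 (fun s => sph_int (fun p => g (s, p))).

Definition cone_dom : set P3 := `[0, 1]%classic `*` @sph_dom R.

Lemma cfunctional_cone : cfunctional cone_dom ((1 - 0) * sph_cst) cone_int.
Proof.
apply: cfunctional_prod; last exact: cfunctional_sph.
by apply: cfunctional_itv; exact: ltr01.
Qed.
Let KP := cfunctional_cone.

Lemma cpt0 z p : cpt z (0, p) = z.
Proof.
rewrite /cpt (_ : cdir 0 p = 0) ?scaler0 ?addr0//; apply/rowP => j; rewrite !mxE /=.
by case: unlift => [i|]; rewrite ?mul0r ?oppr0.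
Qed.

Lemma continuous_cpt2 G : continuous G -> continuous (fun x : ZP => G (cpt x.1 x.2)).
Proof.
move=> Gc; apply: continuous_pointwise => x.
apply: (@continuous_comp _ _ _ (fun x : ZP => cpt x.1 x.2) G); last exact: Gc.
exact: cpt_continuous.
Qed.

Lemma continuous_sndP (c : P3 -> R) : continuous c -> continuous (fun x : ZP => c x.2).
Proof.
move=> cc; apply: continuous_pointwise => x.
by apply: (@continuous_comp _ _ _ snd c); [exact: cvg_snd|exact: cc].
Qed.

Lemma continuous_ang3 (a : R * R -> R) : continuous a -> continuous (fun q : P3 => a q.2).
Proof.
move=> ac; apply: continuous_pointwise => x.
by apply: (@continuous_comp _ _ _ snd a); [exact: cvg_snd|exact: ac].
Qed.

Lemma continuous_fst3 : continuous (fun q : P3 => q.1).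
Proof. by move=> q; exact: cvg_fst. Qed.

Lemma continuous_fst_time : continuous (fun x : ZP => time x.1).
Proof.
apply: continuous_pointwise => x.
by apply: (@continuous_comp _ _ _ fst (@time R d)); [exact: cvg_fst|exact: time_continuous].
Qed.

Lemma smooth_continuous G : smooth_on setT G -> continuous G.
Proof. by move=> Gs; apply: continuous_pointwise => x; exact: smooth_on_cont Gs _. Qed.

Lemma continuous_lin2 (a : nat -> R * R -> R) G : (forall i, continuous (a i)) ->
  smooth_on setT G -> continuous (fun x : ZP => lin a x.2.2 G (cpt x.1 x.2)).
Proof.
move=> ac Gs; apply: continuous_sum => i; apply: continuous_mul.
  by apply: (@continuous_sndP (fun q => a i q.2)); exact: continuous_ang3.
by apply: continuous_cpt2; apply: smooth_continuous; exact: smooth_on_partial.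
Qed.

Lemma continuous_quad2 (a b : nat -> R * R -> R) G : (forall i, continuous (a i)) ->
  (forall i, continuous (b i)) ->
  smooth_on setT G -> continuous (fun x : ZP => quad a b x.2.2 G (cpt x.1 x.2)).
Proof.
move=> ac bc Gs; apply: continuous_sum => i; apply: continuous_mul.
  by apply: (@continuous_sndP (fun q => a i q.2)); exact: continuous_ang3.
exact: continuous_lin2 bc (smooth_on_partial _ Gs).
Qed.

Lemma is_derive_cone_int (g g' : ZP -> R) z v : continuous g -> continuous g' ->
  (forall y q, is_derive y v (fun y => g (y, q)) (g' (y, q))) ->
  is_derive z v (fun y => cone_int (fun q => g (y, q))) (cone_int (fun q => g' (z, q))).
Proof.
move=> gc g'c D; apply: (@cf_is_derive_dir R P3 _ _ _ KP d.+1 (fun y q => g (y, q)) (fun y q => g' (y, q))).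
- by move=> y; exact: slice_continuous.
- by move=> y; exact: slice_continuous.
- move=> y q _; rewrite (_ : (fun x => _) = g'); first exact: g'c.
  by apply/funext => -[].
Qed.

Definition cone_av (c : P3 -> R) G z : R := cone_int (fun q => c q * G (cpt z q)).

Lemma continuous_av (c : P3 -> R) G : continuous c -> smooth_on setT G ->
  continuous (fun x : ZP => c x.2 * G (cpt x.1 x.2)).
Proof.
move=> cc Gs; apply: continuous_mul; first exact: continuous_sndP.
by apply: continuous_cpt2; exact: smooth_continuous.
Qed.

Lemma is_derive_cone_av_lift (c : P3 -> R) G i z : continuous c -> smooth_on setT G ->
  is_derive z 'e_(li i) (cone_av c G) (cone_av c (partial (li i) G) z).
Proof.
move=> cc Gs; apply: (@is_derive_cone_int (fun x => c x.2 * G (cpt x.1 x.2))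
  (fun x => c x.2 * partial (li i) G (cpt x.1 x.2))).
- exact: continuous_av.
- exact: continuous_av cc (smooth_on_partial _ Gs).
- move=> y q /=; apply: is_derive_mull; apply: is_derive_cpt_lift.
  exact: smooth_on_is_derive Gs _.
Qed.

(** For fixed q the point [cpt z q] moves with velocity (1 - s, s omega) in t. The derivative is
    thus a sum of cone averages with new continuous weights, which is the closure property behind
    the smoothness of all cone averages. *)
Lemma is_derive_cone_av_time (c : P3 -> R) G z : continuous c -> smooth_on setT G ->
  is_derive z 'e_ord0 (cone_av c G)
   (cone_av (fun q => c q * (1 - q.1)) (partial ord0 G) z +
    \sum_(i < d) cone_av (fun q => c q * q.1 * omega i q.2) (partial (li i) G) z).
Proof.
move=> cc Gs.
pose h q := \sum_(i < d) c q * q.1 * omega i q.2 * partial (li i) G (cpt z q).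
have hc (i : 'I_d) : continuous (fun q : P3 => c q * q.1 * omega i q.2 * partial (li i) G (cpt z q)).
  apply: (@slice_continuous _ _ _ (fun x : ZP => c x.2 * x.2.1 * omega i x.2.2 * partial (li i) G (cpt x.1 x.2)) z).
  apply: (@continuous_av (fun q => c q * q.1 * omega i q.2)); last exact: smooth_on_partial.
  apply: continuous_mul; first by apply: continuous_mul => //; exact: continuous_fst3.
  by apply: continuous_ang3; exact: omega_continuous.
have -> : \sum_(i < d) cone_av (fun q => c q * q.1 * omega i q.2) (partial (li i) G) z = cone_int h.
  by rewrite /h (cf_sum KP).
have hcc : continuous h by exact: continuous_sum.
have c1 : continuous (fun x : ZP => c x.2 * ((1 - x.2.1) * partial ord0 G (cpt x.1 x.2) +
    x.2.1 * lin omega x.2.2 G (cpt x.1 x.2))).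
  apply: continuous_mul; first exact: continuous_sndP.
  apply: continuous_add; apply: continuous_mul.
  - apply: continuous_sub; first exact: continuous_const.
    by apply: continuous_sndP; exact: continuous_fst3.
  - by apply: continuous_cpt2; apply: smooth_continuous; exact: smooth_on_partial.
  - by apply: continuous_sndP; exact: continuous_fst3.
  - by apply: continuous_lin2 => //; exact: omega_continuous.
have -> : cone_av (fun q => c q * (1 - q.1)) (partial ord0 G) z + cone_int h =
  cone_int (fun q => c q * ((1 - q.1) * partial ord0 G (cpt z q) + q.1 * lin omega q.2 G (cpt z q))).
  have c2 : continuous (fun q : P3 => c q * (1 - q.1) * partial ord0 G (cpt z q)).
    apply: (@slice_continuous _ _ _ (fun x : ZP => c x.2 * (1 - x.2.1) * partial ord0 G (cpt x.1 x.2)) z).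
    apply: (@continuous_av (fun q => c q * (1 - q.1))); last exact: smooth_on_partial.
    apply: continuous_mul => //.
    by apply: continuous_sub; [exact: continuous_const|exact: continuous_fst3].
  apply: (etrans (esym (cfD KP c2 hcc))).
  congr cone_int; apply/funext => q; rewrite [RHS]mulrDr; congr (_ + _); first by rewrite mulrA.
  by rewrite /h /lin !mulr_sumr; apply: eq_bigr => i _; rewrite !mulrA.
apply: (@is_derive_cone_int (fun x => c x.2 * G (cpt x.1 x.2)) (fun x => c x.2 * (
  (1 - x.2.1) * partial ord0 G (cpt x.1 x.2) + x.2.1 * lin omega x.2.2 G (cpt x.1 x.2)))) => //.
  exact: continuous_av.
move=> y q /=; apply: is_derive_mull.
exact: (is_derive_cpt_time openT Gs).
Qed.

Lemma cone_av_continuous (c : P3 -> R) G : continuous c -> smooth_on setT G ->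
  continuous (cone_av c G).
Proof.
move=> cc Gs; apply: continuous_pointwise => z.
apply: (@cf_continuous _ _ _ _ _ KP _ (fun z q => c q * G (cpt z q))).
  near=> y; apply: (@slice_continuous _ _ _ (fun x : ZP => c x.2 * G (cpt x.1 x.2)) y).
  exact: continuous_av.
by move=> q _; exact: continuous_av.
Unshelve. all: by end_near. Qed.

Lemma smooth_cone_av (c : P3 -> R) G : continuous c -> smooth_on setT G ->
  smooth_on setT (cone_av c G).
Proof.
move=> cc Gs; have oT := @openT 'rV[R]_d.+1.
apply: (@smooth_on_alg R d.+1 setT (fun h => exists c G, [/\ continuous c, smooth_on setT G & h = cone_av c G])) => //.
- by move=> h z [k [H [kc Hs ->]]] _; exact: cone_av_continuous.
- move=> h i [k [H [kc Hs ->]]]; move: i; apply: ord_cases => [|i].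
    exists (fun z => cone_av (fun q => k q * (1 - q.1)) (partial ord0 H) z +
      \sum_(i < d) cone_av (fun q => k q * q.1 * omega i q.2) (partial (li i) H) z).
      apply: SAadd.
        apply: SAgen; exists (fun q => k q * (1 - q.1)), (partial ord0 H).
        split; [|exact: smooth_on_partial Hs|by []].
        apply: continuous_mul kc _.
        by apply: continuous_sub; [exact: continuous_const|exact: continuous_fst3].
      apply: smooth_alg_sum oT _ => i; apply: SAgen.
      exists (fun q => k q * q.1 * omega i q.2), (partial (li i) H).
      split; [|exact: smooth_on_partial Hs|by []].
      apply: continuous_mul; first exact: continuous_mul kc continuous_fst3.
      by apply: continuous_ang3; exact: omega_continuous.
    by move=> z _; exact: is_derive_cone_av_time.
  exists (cone_av k (partial (li i) H)).
    apply: SAgen; exists k, (partial (li i) H).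
    by split; [exact: kc|exact: smooth_on_partial Hs|].
  by move=> z _; exact: is_derive_cone_av_lift.
- by apply: SAgen; exists c, G.
Qed.

Lemma cone_av_bound (c : P3 -> R) G T (C M : R) z : continuous c -> smooth_on setT G ->
  (forall q, cone_dom q -> `|c q| <= C) -> (forall y, slab T y -> `|G y| <= M) -> slab T z ->
  `|cone_av c G z| <= (1 - 0) * sph_cst * (C * M).
Proof.
move=> cc Gs cC GM /andP[z0 zT]; apply: (cf_bound KP).
  apply: (@slice_continuous _ _ _ (fun x : ZP => c x.2 * G (cpt x.1 x.2)) z).
  exact: continuous_av.
move=> q Aq; rewrite normrM ler_pM//; first exact: cC.
apply: GM; case: Aq => /= + _; rewrite in_itv /= => /andP[s0 s1].
rewrite /slab /= {1 2}/time cptE0; apply/andP; split.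
  by rewrite mulr_ge0// subr_ge0.
by apply: le_trans zT; rewrite ler_piMr// gerBl.
Qed.

(* Density of the Duhamel integral, up to the factor [time z ^+ 2]. *)
Definition duh_wt q : R := q.1 * sin q.2.1.

(** Retarded potential: the substitution r = t s in the integral of r F(t - r, x + r omega) over 0 <
    r < t and the sphere produces t^2 and the weight s. The divisor is 4 pi, left as an integral. *)
Definition duhamel F z : R :=
  (sph_int (fun p => sin p.1))^-1 * (time z ^+ 2 * cone_av duh_wt F z).

Lemma continuous_duh_wt : continuous duh_wt.
Proof.
apply: continuous_mul; first exact: continuous_fst3.
by apply: (@continuous_ang3 (fun p => sin p.1)); exact: sin1_continuous.
Qed.

Lemma duhamelE F z : smooth_on setT F -> duhamel F z =
  (sph_int (fun p => sin p.1))^-1 * cone_int (fun q => duh_wt q * (time z ^+ 2 * F (cpt z q))).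
Proof.
move=> Fs; rewrite /duhamel /cone_av; congr (_ * _).
rewrite -(cfZ KP); last exact: (@slice_continuous _ _ _ (fun x : ZP => duh_wt x.2 * F (cpt x.1 x.2)) z (continuous_av continuous_duh_wt Fs)).
by congr cone_int; apply/funext => q; rewrite mulrCA.
Qed.

Lemma smooth_time : smooth_on setT (@time R d).
Proof. exact: (smooth_on_coord ord0 openT). Qed.

Lemma smooth_duhamel F : smooth_on setT F -> smooth_on setT (duhamel F).
Proof.
move=> Fs; apply: (smooth_onZ _ openT); apply: (smooth_onM openT).
  exact: (smooth_onM openT smooth_time smooth_time).
exact: smooth_cone_av continuous_duh_wt Fs.
Qed.

Lemma partial_duhamel_lift F i z : smooth_on setT F ->
  partial (li i) (duhamel F) z = duhamel (partial (li i) F) z.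
Proof.
move=> Fs.
have D1 : is_derive z 'e_(li i) (@time R d) 0.
  by have := is_derive_coord (li i) ord0 z; rewrite (_ : (ord0 == li i) = false).
have D : is_derive z 'e_(li i) (duhamel F) (duhamel (partial (li i) F) z).
  have := is_derive_mull (sph_int (fun p => sin p.1))^-1 (is_derive_mul (is_derive_mul D1 D1)
     (is_derive_cone_av_lift i z continuous_duh_wt Fs)).
  by rewrite !(mul0r, mulr0, addr0, add0r).
exact: (@derive_val _ _ _ _ _ _ _ D).
Qed.

Section DuhamelBox.
Hypothesis d3 : (d <= 3)%N.
Variable F : 'rV[R]_d.+1 -> R.
Hypothesis Fs : smooth_on setT F.

Let Fc (x : ZP) := F (cpt x.1 x.2).
Let F0 (x : ZP) := partial ord0 F (cpt x.1 x.2).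
Let F00 (x : ZP) := partial ord0 (partial ord0 F) (cpt x.1 x.2).
Let W (x : ZP) := lin omega x.2.2 F (cpt x.1 x.2).
Let W0 (x : ZP) := lin omega x.2.2 (partial ord0 F) (cpt x.1 x.2).
Let Q (x : ZP) := quad omega omega x.2.2 F (cpt x.1 x.2).
Let L (x : ZP) := lap F (cpt x.1 x.2).
Let wt (x : ZP) := duh_wt x.2.
Let t (x : ZP) := time x.1.
Let s (x : ZP) := x.2.1.
Let sn (x : ZP) := sin x.2.2.1.

(** [V] and [V2] are the first two time derivatives of F (cpt z q) at fixed q; [h0], [h1], [h2] are
    the integrand of the Duhamel integral and its first two time derivatives. *)
Let V x := (1 - s x) * F0 x + s x * W x.
Let V2 x := (1 - s x) ^+ 2 * F00 x + 2 * s x * (1 - s x) * W0 x + s x ^+ 2 * Q x.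
Let h0 x := wt x * (t x ^+ 2 * Fc x).
Let h1 x := wt x * (2 * t x * Fc x + t x ^+ 2 * V x).
Let h2 x := wt x * (2 * Fc x + 4 * t x * V x + t x ^+ 2 * V2 x).

Let Fcc : continuous Fc. Proof. exact: continuous_cpt2 (smooth_continuous Fs). Qed.
Let F0c : continuous F0.
Proof. exact: continuous_cpt2 (smooth_continuous (smooth_on_partial _ Fs)). Qed.
Let F00c : continuous F00.
Proof.
exact: continuous_cpt2 (smooth_continuous (smooth_on_partial _ (smooth_on_partial _ Fs))).
Qed.
Let Lc : continuous L.
Proof. exact: continuous_cpt2 (smooth_continuous (smooth_lap openT Fs)). Qed.
Let Wc : continuous W. Proof. exact: continuous_lin2 (@omega_continuous R) Fs. Qed.
Let W0c : continuous W0.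
Proof. exact: continuous_lin2 (@omega_continuous R) (smooth_on_partial _ Fs). Qed.
Let Qc : continuous Q.
Proof. exact: continuous_quad2 (@omega_continuous R) (@omega_continuous R) Fs. Qed.
Let wtc : continuous wt. Proof. exact: continuous_sndP continuous_duh_wt. Qed.
Let tc : continuous t. Proof. exact: continuous_fst_time. Qed.
Let sc : continuous s. Proof. exact: continuous_sndP continuous_fst3. Qed.
Let kc (k : R) : continuous (fun _ : ZP => k). Proof. exact: continuous_const. Qed.
Let s1c : continuous (fun x => 1 - s x). Proof. exact: continuous_sub (@kc 1) sc. Qed.
Let t2c : continuous (fun x => t x ^+ 2). Proof. exact: continuous_mul tc tc. Qed.

Let Vc : continuous V.
Proof. exact: continuous_add (continuous_mul s1c F0c) (continuous_mul sc Wc). Qed.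

Let V2c : continuous V2.
Proof.
apply: continuous_add; first apply: continuous_add.
- exact: continuous_mul (continuous_mul s1c s1c) F00c.
- exact: continuous_mul (continuous_mul (continuous_mul (@kc 2) sc) s1c) W0c.
- exact: continuous_mul (continuous_mul sc sc) Qc.
Qed.

Let h0c : continuous h0.
Proof. exact: continuous_mul wtc (continuous_mul t2c Fcc). Qed.

Let h1c : continuous h1.
Proof.
apply: continuous_mul wtc _; apply: continuous_add.
  exact: continuous_mul (continuous_mul (@kc 2) tc) Fcc.
exact: continuous_mul t2c Vc.
Qed.

Let h2c : continuous h2.
Proof.
apply: continuous_mul wtc _; apply: continuous_add; first apply: continuous_add.
- exact: continuous_mul (@kc 2) Fcc.
- exact: continuous_mul (continuous_mul (@kc 4) tc) Vc.
- exact: continuous_mul t2c V2c.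
Qed.

Let dt z : is_derive z 'e_ord0 (@time R d) 1.
Proof. by have := is_derive_coord (ord0 : 'I_d.+1) ord0 z; rewrite eqxx. Qed.

Let dFc z q : is_derive z 'e_ord0 (fun z => Fc (z, q)) (V (z, q)).
Proof. exact: (is_derive_cpt_time openT Fs I). Qed.

Let dt2 z : is_derive z 'e_ord0 (fun z : 'rV[R]_d.+1 => time z ^+ 2) (2 * time z).
Proof.
have := is_derive_mul (dt z) (dt z); rewrite mul1r mulr1 => D.
by rewrite mulr_natl mulr2n.
Qed.

Let dV z q : is_derive z 'e_ord0 (fun z => V (z, q)) (V2 (z, q)).
Proof.
have D0 := is_derive_cpt_time openT (smooth_on_partial ord0 Fs) (I : setT (cpt z q)).
have D1 := is_derive_cpt_time openT (@smooth_lin _ _ _ _ openT Fs omega q.2) (I : setT (cpt z q)).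
have E1 : lin omega q.2 (lin omega q.2 F) (cpt z q) = Q (z, q).
  by rewrite /Q /quad [LHS]/lin; apply: eq_bigr => i _; rewrite (partial_lin openT Fs).
rewrite E1 (partial_lin openT Fs _ _ _ I) in D1.
have := is_derive_add (is_derive_mull (1 - q.1) D0) (is_derive_mull q.1 D1).
set X := (X in is_derive _ _ _ X -> _); suff -> : V2 (z, q) = X by [].
rewrite /X /V2 /F00 /W0 /s /=.
move: (Q _) (lin omega q.2 (partial ord0 F) _) (partial ord0 (partial ord0 F) _) => a b c.
by ring.
Qed.

Let dh0 z q : is_derive z 'e_ord0 (fun z => h0 (z, q)) (h1 (z, q)).
Proof. exact: (is_derive_mull (wt (z, q)) (is_derive_mul (dt2 z) (dFc z q))). Qed.

Let dh1 z q : is_derive z 'e_ord0 (fun z => h1 (z, q)) (h2 (z, q)).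
Proof.
have := is_derive_mull (wt (z, q)) (is_derive_add
  (is_derive_mul (is_derive_mull 2 (dt z)) (dFc z q))
  (is_derive_mul (dt2 z) (dV z q))).
set X := (X in is_derive _ _ _ X -> _); suff -> : h2 (z, q) = X by [].
rewrite /X /h2 /t /=.
move: (wt _) (Fc _) (V _) (V2 _) (time z) => a b c e g.
by ring.
Qed.

Let N : R := sph_int (fun p => sin p.1).

Let dduh z : is_derive z 'e_ord0 (duhamel F) (N^-1 * cone_int (fun q => h1 (z, q))).
Proof.
rewrite (_ : duhamel F = fun z => N^-1 * cone_int (fun q => h0 (z, q))); last first.
  by apply/funext => y; exact: duhamelE y Fs.
by apply: is_derive_mull; exact: is_derive_cone_int h0c h1c dh0.
Qed.

Let ddduh z : partial ord0 (partial ord0 (duhamel F)) z = N^-1 * cone_int (fun q => h2 (z, q)).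
Proof.
have -> : partial ord0 (duhamel F) = fun z => N^-1 * cone_int (fun q => h1 (z, q)).
  by apply/funext => y; exact: (@derive_val _ _ _ _ _ _ _ (dduh y)).
have D : is_derive z 'e_ord0 (fun z => N^-1 * cone_int (fun q => h1 (z, q)))
   (N^-1 * cone_int (fun q => h2 (z, q))).
  by apply: is_derive_mull; exact: is_derive_cone_int h1c h2c dh1.
exact: (@derive_val _ _ _ _ _ _ _ D).
Qed.

Lemma duhamel_time0 z : time z = 0 -> duhamel F z = 0.
Proof. by move=> z0; rewrite /duhamel z0 expr0n /= mul0r mulr0. Qed.

Lemma partial_duhamel_time0 z : time z = 0 -> partial ord0 (duhamel F) z = 0.
Proof.
move=> z0; rewrite [LHS](@derive_val _ _ _ _ _ _ _ (dduh z)).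
rewrite (_ : (fun q => _) = fun q => 0 * h1 (z, q)).
  by rewrite (cfZ KP) ?mul0r ?mulr0//; exact: (slice_continuous h1c).
by apply/funext => q; rewrite /h1 /t /= z0 expr0n /= !(mul0r, mulr0, addr0).
Qed.

Section Primitive.
Variable z : 'rV[R]_d.+1.

(** The integrand of box (duhamel F) contains Delta F, which is removed by adding [dL], t times the
    integrand of [sphere_laplacian]. What remains is the exact s-derivative [dX] of X. All
    coefficients of X vanish at s = 1, and at s = 0 only - sin theta F(z) survives, so the integral
    of [dX] is 4 pi F(z). *)
Let X (q : P3) := sin q.2.1 * ((q.1 ^+ 2 - 1) * Fc (z, q) +
  time z * (2 * q.1 ^+ 2 - 2 * q.1) * F0 (z, q) +
  time z * (q.1 ^+ 3 - q.1) * (W (z, q) - F0 (z, q))).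

Let dX (q : P3) := sin q.2.1 * (2 * q.1 * Fc (z, q) +
  (q.1 ^+ 2 - 1) * (time z * (W (z, q) - F0 (z, q))) +
  (time z * (4 * q.1 - 2) * F0 (z, q) +
   time z * (2 * q.1 ^+ 2 - 2 * q.1) * (time z * (W0 (z, q) - F00 (z, q)))) +
  (time z * (3 * q.1 ^+ 2 - 1) * (W (z, q) - F0 (z, q)) +
   time z * (q.1 ^+ 3 - q.1) * (time z * (Q (z, q) - W0 (z, q)) - time z * (W0 (z, q) - F00 (z, q))))).

Let sl (g : ZP -> R) : continuous g -> continuous (fun q => g (z, q)).
Proof. exact: slice_continuous. Qed.
Let k3 (k : R) : continuous (fun _ : P3 => k). Proof. exact: continuous_const. Qed.
Let q2 : continuous (fun q : P3 => q.1 ^+ 2).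
Proof. exact: continuous_mul continuous_fst3 continuous_fst3. Qed.
Let q3 : continuous (fun q : P3 => q.1 ^+ 3).
Proof. exact: continuous_mul continuous_fst3 q2. Qed.
Let q1k (k : R) : continuous (fun q : P3 => k * q.1).
Proof. exact: continuous_mul (@k3 k) continuous_fst3. Qed.
Let q2k (k : R) : continuous (fun q : P3 => k * q.1 ^+ 2).
Proof. exact: continuous_mul (@k3 k) q2. Qed.
Let sn3 : continuous (fun q : P3 => sin q.2.1).
Proof. by apply: (@continuous_ang3 (fun p => sin p.1)); exact: sin1_continuous. Qed.
Let WF : continuous (fun q => W (z, q) - F0 (z, q)).
Proof. exact: continuous_sub (sl Wc) (sl F0c). Qed.
Let WF0 : continuous (fun q => W0 (z, q) - F00 (z, q)).
Proof. exact: continuous_sub (sl W0c) (sl F00c). Qed.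
Let QW : continuous (fun q => Q (z, q) - W0 (z, q)).
Proof. exact: continuous_sub (sl Qc) (sl W0c). Qed.
Let tk (g : P3 -> R) : continuous g -> continuous (fun q => time z * g q).
Proof. by move=> gc; exact: continuous_mul (@k3 (time z)) gc. Qed.

Let Xc : continuous X.
Proof.
apply: continuous_mul sn3 _; apply: continuous_add; first apply: continuous_add.
- exact: continuous_mul (continuous_sub q2 (@k3 1)) (sl Fcc).
- exact: continuous_mul (tk (continuous_sub (@q2k 2) (@q1k 2))) (sl F0c).
- exact: continuous_mul (tk (continuous_sub q3 continuous_fst3)) WF.
Qed.

Let dXc : continuous dX.
Proof.
apply: continuous_mul sn3 _; apply: continuous_add; first apply: continuous_add;
  first apply: continuous_add.
- exact: continuous_mul (@q1k 2) (sl Fcc).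
- exact: continuous_mul (continuous_sub q2 (@k3 1)) (tk WF).
- apply: continuous_add.
    exact: continuous_mul (tk (continuous_sub (@q1k 4) (@k3 2))) (sl F0c).
  exact: continuous_mul (tk (continuous_sub (@q2k 2) (@q1k 2))) (tk WF0).
- apply: continuous_add.
    exact: continuous_mul (tk (continuous_sub (@q2k 3) (@k3 1))) WF.
  exact: continuous_mul (tk (continuous_sub q3 continuous_fst3))
    (continuous_sub (tk QW) (tk WF0)).
Qed.

Let dpow2 (x : R) : is_derive x 1 (fun y : R => y ^+ 2) (2 * x).
Proof.
have := is_derive_mul (is_derive_id x (1 : R)) (is_derive_id x (1 : R)).
by rewrite mul1r mulr1 mulr_natl mulr2n.
Qed.

Let dpow3 (x : R) : is_derive x 1 (fun y : R => y ^+ 3) (3 * x ^+ 2).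
Proof.
have := is_derive_mul (is_derive_id x (1 : R)) (dpow2 x).
by rewrite (_ : 1 * x ^+ 2 + x * (2 * x) = 3 * x ^+ 2)//; ring.
Qed.

Let dXE (x : R) p : is_derive x 1 (fun y : R => X (y, p)) (dX (x, p)).
Proof.
rewrite /X /dX /=; apply: is_derive_mull.
have Oy : setT (cpt z (x, p)) by [].
have DF := is_derive_cpt_s openT Fs Oy.
have D0 := is_derive_cpt_s openT (smooth_on_partial ord0 Fs) Oy.
have D1 := is_derive_cpt_s openT (@smooth_lin _ _ _ _ openT Fs omega p) Oy.
have E1 : lin omega p (lin omega p F) (cpt z (x, p)) = Q (z, (x, p)).
  by rewrite /Q /quad [LHS]/lin; apply: eq_bigr => i _; rewrite (partial_lin openT Fs).
rewrite E1 (partial_lin openT Fs _ _ _ Oy) in D1.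
have c1 := is_derive_sub (dpow2 x) (is_derive_cst (1 : R) x (1 : R)).
have c2 := is_derive_mull (time z) (is_derive_sub (is_derive_mull 2 (dpow2 x))
  (is_derive_mull 2 (is_derive_id x (1 : R)))).
have c3 := is_derive_mull (time z) (is_derive_sub (dpow3 x) (is_derive_id x (1 : R))).
have := is_derive_add (is_derive_add (is_derive_mul c1 DF) (is_derive_mul c2 D0))
  (is_derive_mul c3 (is_derive_sub D1 D0)).
rewrite subr0 (_ : 2 * (2 * x) - 2 * 1 = 4 * x - 2); last by ring.
by [].
Qed.

Let int_dX : cone_int dX = sph_int (fun p => sin p.1) * F z.
Proof.
rewrite /cone_int (itv_int_cf_FTC ltr01 cfunctional_sph Xc dXc dXE).
have -> : (fun p => X (1, p)) = fun p => 0 * sin p.1.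
  by apply/funext => p; rewrite /X /= !expr1n subrr mulr1 subrr !(mul0r, mulr0, addr0).
have -> : (fun p => X (0, p)) = fun p => - F z * sin p.1.
  apply/funext => p; rewrite /X /Fc /= cpt0 !expr0n /= !(mulr0, subrr, sub0r, addr0, mul0r).
  by rewrite mulN1r mulrC.
rewrite !(cfZ cfunctional_sph); try exact: sin1_continuous.
by rewrite mul0r sub0r mulNr opprK mulrC.
Qed.

Let dL : P3 -> R := fun q => time z * (sin q.2.1 * (time z * q.1 * (L (z, q) - Q (z, q)) - 2 * W (z, q))).

Let dLc : continuous dL.
Proof.
apply: tk; apply: continuous_mul sn3 _; apply: continuous_sub.
  exact: continuous_mul (tk continuous_fst3) (continuous_sub (sl Lc) (sl Qc)).
exact: continuous_mul (@k3 2) (sl Wc).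
Qed.

Let int_dL : cone_int dL = 0.
Proof.
rewrite /cone_int (_ : (fun s => _) = fun=> 0 * 0).
  by rewrite (cfZ (cfunctional_itv ltr01) 0 (@continuous_const R R 0)) ?mul0r.
apply/funext => x; rewrite mul0r.
have gc : continuous (fun p => sin p.1 * (time z * x * (L (z, (x, p)) - Q (z, (x, p))) - 2 * W (z, (x, p)))).
  have sl2 (g : ZP -> R) : continuous g -> continuous (fun p => g (z, (x, p))).
    by move=> gc; exact: (slice_continuous (sl gc)).
  apply: continuous_mul; first exact: sin1_continuous.
  apply: continuous_sub.
    exact: continuous_mul (@continuous_const _ _ _) (continuous_sub (sl2 _ Lc) (sl2 _ Qc)).
  exact: continuous_mul (@continuous_const _ _ _) (sl2 _ Wc).
by rewrite (cfZ cfunctional_sph _ gc) (sphere_laplacian d3 openT Fs) ?mulr0.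
Qed.

Lemma box_duhamel : box (duhamel F) z = F z.
Proof.
have Lg i : smooth_on setT (partial (li i) (partial (li i) F)).
  by do 2 apply: smooth_on_partial.
pose l i (q : P3) := duh_wt q * (time z ^+ 2 * partial (li i) (partial (li i) F) (cpt z q)).
have lc i : continuous (l i).
  apply: continuous_mul continuous_duh_wt _; apply: continuous_mul; first exact: continuous_const.
  exact: (sl (continuous_cpt2 (smooth_continuous (Lg i)))).
have N0 : sph_int (fun p => sin p.1) != 0 by rewrite gt_eqF// sph_int_sin_gt0.
have -> : box (duhamel F) z = N^-1 * (cone_int (fun q => h2 (z, q)) -
    cone_int (fun q => \sum_(i < d) l i q)).
  rewrite /box ddduh mulrBr (cf_sum KP _ lc); congr (_ - _).
  rewrite mulr_sumr; apply: eq_bigr => i _.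
  have -> : partial (li i) (duhamel F) = duhamel (partial (li i) F).
    by apply/funext => y; exact: partial_duhamel_lift.
  rewrite partial_duhamel_lift; last exact: smooth_on_partial.
  by rewrite (duhamelE _ (Lg i)).
have slc : continuous (fun q => \sum_(i < d) l i q) by exact: continuous_sum.
rewrite -(cfB KP (sl h2c) slc).
(* A pointwise polynomial identity in s, t, sin theta and the derivatives of F. *)
have -> : (fun q => h2 (z, q) - \sum_(i < d) l i q) = (fun q => dX q - dL q).
  apply/funext => q.
  have -> : \sum_(i < d) l i q = duh_wt q * (time z ^+ 2 * L (z, q)).
    by rewrite /L /lap !mulr_sumr.
  rewrite /h2 /dX /dL /V /V2 /wt /s /t /duh_wt /=.
  move: (sin q.2.1) (Fc _) (F0 _) (F00 _) (W _) (W0 _) (Q _) (L _) (time z) q.1 => a b c e g h k m n x.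
  by ring.
by rewrite (cfB KP dXc dLc) int_dX int_dL subr0 mulrA mulVf ?mul1r.
Qed.

End Primitive.

End DuhamelBox.

End Duhamel.

(** * Functions on the slab *)

Section MultiIndex.
Context {R : realType} {n : nat}.
Implicit Types (u : 'rV[R]_n -> R) (s : seq 'I_n) (a : multi_index n) (O : set 'rV[R]_n).

(** Derivatives are indexed by sequences of directions, where differentiating once more is a cons;
    by symmetry only the counts matter, which [mi] records. *)
Definition mi s : multi_index n := [ffun i => count_mem i s].

Definition mi_seq a : seq 'I_n := flatten [seq nseq (a i) i | i <- enum 'I_n].

Lemma count_mi_seq a i : count_mem i (mi_seq a) = a i.
Proof.
rewrite count_flatten -map_comp sumnE big_map big_enum /= (bigD1 i)//=.
rewrite count_nseq /= eqxx mul1n big1 ?addn0// => j ji.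
by rewrite count_nseq /= (negbTE ji) mul0n.
Qed.

Lemma mi_mi_seq a : mi (mi_seq a) = a.
Proof. by apply/ffunP => i; rewrite ffunE count_mi_seq. Qed.

Lemma mi_perm s s' : perm_eq s s' -> mi s = mi s'.
Proof. by move=> /permP ss'; apply/ffunP => i; rewrite !ffunE ss'. Qed.

Lemma mi_seq_mi s : perm_eq (mi_seq (mi s)) s.
Proof.
by apply/allP => i _ /=; rewrite count_mi_seq ffunE.
Qed.

Lemma mderiv_mi O u s z : open O -> smooth_on O u -> O z ->
  mderiv (mi s) u z = partials s u z.
Proof. by move=> oO us Oz; exact: partials_perm oO us Oz (mi_seq_mi s). Qed.

Lemma partials_sub O u g s z : open O -> smooth_on O u -> smooth_on O g -> O z ->
  partials s (fun z => u z - g z) z = partials s u z - partials s g z.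
Proof.
move=> oO us gs; elim: s z => [//|i s IH] z Oz /=.
rewrite (@partial_near _ _ i _ (fun z => partials s u z - partials s g z)).
  have D := is_derive_sub (smooth_on_is_derive i (smooth_on_partials s us) Oz)
    (smooth_on_is_derive i (smooth_on_partials s gs) Oz).
  exact: (@derive_val _ _ _ _ _ _ _ D).
by apply: near_eq_on oO Oz _ => y Oy; exact: IH.
Qed.

Lemma partials_add O u g s z : open O -> smooth_on O u -> smooth_on O g -> O z ->
  partials s (fun z => u z + g z) z = partials s u z + partials s g z.
Proof.
move=> oO us gs; elim: s z => [//|i s IH] z Oz /=.
rewrite (@partial_near _ _ i _ (fun z => partials s u z + partials s g z)).
  have D := is_derive_add (smooth_on_is_derive i (smooth_on_partials s us) Oz)
    (smooth_on_is_derive i (smooth_on_partials s gs) Oz).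
  exact: (@derive_val _ _ _ _ _ _ _ D).
by apply: near_eq_on oO Oz _ => y Oy; exact: IH.
Qed.

Lemma partials_scale O u (c : R) s z : open O -> smooth_on O u -> O z ->
  partials s (fun z => c * u z) z = c * partials s u z.
Proof.
move=> oO us; elim: s z => [//|i s IH] z Oz /=.
rewrite (@partial_near _ _ i _ (fun z => c * partials s u z)).
  have D := is_derive_mull c (smooth_on_is_derive i (smooth_on_partials s us) Oz).
  exact: (@derive_val _ _ _ _ _ _ _ D).
by apply: near_eq_on oO Oz _ => y Oy; exact: IH.
Qed.

End MultiIndex.

Section Slab.
Context {R : realType} {d : nat}.
Variable T : R.
Hypothesis T0 : 0 < T.
Implicit Types (z y : 'rV[R]_d.+1) (u w g : 'rV[R]_d.+1 -> R) (s : seq 'I_d.+1).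
Local Notation O := (@open_slab R d T).

Lemma open_open_slab : open O.
Proof.
rewrite (_ : O = (fun y => time y) @^-1` [set` `]0, T[ ]); last first.
  by apply/seteqP; split=> y /=; rewrite in_itv.
by apply: open_comp; [move=> y _; exact: time_continuous|exact: interval_open].
Qed.

Lemma open_slab_slab : O `<=` slab T.
Proof. by move=> z /andP[z0 zT]; rewrite /slab /= !ltW. Qed.

Lemma time_shift z (h : R) : time (z + h *: 'e_ord0) = time z + h.
Proof. by rewrite /time !mxE !eqxx mulr1. Qed.

Lemma time_shift_lift z (h : R) i : time (z + h *: 'e_(li i)) = time z.
Proof. by rewrite /time !mxE /= mulr0 addr0. Qed.

Lemma near_translate z v (A : set 'rV[R]_d.+1) : nbhs z A ->
  \forall h \near (0 : R), A (z + h *: v).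
Proof.
have hc : z + h *: v @[h --> (0 : R)] --> z.
  rewrite -[X in _ --> X]addr0 -(scale0r v).
  apply: (@cvgD _ 'rV[R]_d.+1); first exact: cvg_cst.
  by apply: cvgZr_tmp; exact: cvg_id.
by move=> /hc.
Qed.

(** The approximating point is moved in time only, backwards whenever possible: the continuity
    argument for solutions needs a strictly earlier point. *)
Lemma slab_dense z (A : set 'rV[R]_d.+1) : slab T z -> nbhs z A ->
  exists y, [/\ A y, O y & 0 < time z -> time y < time z].
Proof.
move=> /andP[z0 zT] /(near_translate 'e_ord0) /nbhs_normP[e /= e0 eA].
have [tz|tz] := ltP 0 (time z).
  pose h := Num.min (e / 2) (time z / 2).
  have h0 : 0 < h by rewrite lt_min !divr_gt0.
  have he : h < e by rewrite gt_min ltr_pdivrMr// ltr_pMr// ltr1n.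
  have hz : h < time z by rewrite gt_min orbC ltr_pdivrMr// ltr_pMr// ltr1n.
  exists (z + (- h) *: 'e_ord0); split.
  - by apply: eA; rewrite /= sub0r opprK gtr0_norm.
  - rewrite /open_slab /= time_shift; apply/andP; split; first by rewrite subr_gt0.
    by rewrite ltrBlDr (le_lt_trans zT)// ltrDl.
  - by rewrite time_shift gtrBl.
have {}tz : time z = 0 by apply/eqP; rewrite eq_le tz z0.
pose h := Num.min (e / 2) (T / 2).
have h0 : 0 < h by rewrite lt_min !divr_gt0.
have he : h < e by rewrite gt_min ltr_pdivrMr// ltr_pMr// ltr1n.
have hT : h < T by rewrite gt_min orbC ltr_pdivrMr// ltr_pMr// ltr1n.
exists (z + h *: 'e_ord0); split.
- by apply: eA; rewrite /= sub0r normrN gtr0_norm.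
- by rewrite /open_slab /= time_shift tz add0r h0 hT.
- by [].
Qed.

(* Composing with this map turns a function on the slab into one on the whole
   space. *)
Definition clamp z : 'rV[R]_d.+1 :=
  \row_j (if j == ord0 then Num.min T (Num.max 0 (time z)) else z ord0 j).

Lemma time_clamp z : time (clamp z) = Num.min T (Num.max 0 (time z)).
Proof. by rewrite /time !mxE. Qed.

Lemma slab_clamp z : slab T (clamp z).
Proof.
by rewrite /slab /= time_clamp ge_min lexx /= le_min ltW// le_max lexx.
Qed.

Lemma clamp_slab z : slab T z -> clamp z = z.
Proof.
move=> /andP[z0 zT]; apply/rowP => j; rewrite !mxE; case: eqP => // ->.
by rewrite max_r// min_r.
Qed.

Lemma clamp_continuous : continuous clamp.
Proof.
apply: continuous_pointwise => z; apply: row_continuous => j.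
have [->|j0] := eqVneq j ord0.
  rewrite (_ : (fun y => _) = fun y => Num.min T (Num.max 0 (time y))).
    have cm : {for z, continuous (fun y => Num.max 0 (time y))}.
      exact: (@continuous_max R _ (fun=> 0) (@time R d) z (@continuous_const R _ 0 z)
        (@time_continuous R d z)).
    exact: (@continuous_min R _ (fun=> T) (fun y => Num.max 0 (time y)) z (@continuous_const R _ T z) cm).
  by apply/funext => y; rewrite mxE eqxx.
rewrite (_ : (fun y => _) = fun y : 'rV[R]_d.+1 => y ord0 j); first exact: coord_continuous.
by apply/funext => y; rewrite mxE (negbTE j0).
Qed.

Lemma clamp_comp_continuous g : {within slab T, continuous g} ->
  continuous (fun z => g (clamp z)).
Proof.
move=> /subspace_continuousP gc; apply: continuous_pointwise => z A /= gA.
have H := gc _ (slab_clamp z) A gA.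
have K := @clamp_continuous z _ H.
by apply: (@filterS _ (nbhs z) (nbhs_filter z) _ _ _ K) => y /=; apply; exact: slab_clamp.
Qed.

Definition xt s u : 'rV[R]_d.+1 -> R := dext T (mi s) u.

Lemma xt_perm s s' u : perm_eq s s' -> xt s u = xt s' u.
Proof. by move=> /mi_perm; rewrite /xt => ->. Qed.

Lemma smooth_slab_smooth u : smooth_slab T u -> smooth_on O u.
Proof. by case. Qed.

Lemma xt_ext s u : smooth_slab T u -> exists g, [/\ {within slab T, continuous g},
  (forall z, O z -> g z = partials s u z) & forall z, slab T z -> xt s u z = g z].
Proof.
move=> [us /(_ (mi s))[g [gc gE]]]; exists g; split => //.
  by move=> z Oz; rewrite gE// (mderiv_mi s open_open_slab us Oz).
by move=> z Sz; exact: dext_unique T0 gc gE z Sz.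
Qed.

Lemma xt_open s u z : smooth_slab T u -> O z -> xt s u z = partials s u z.
Proof.
move=> us Oz; have [g [_ gE ->]] := xt_ext s us; first exact: gE.
exact: open_slab_slab.
Qed.

Lemma xt_clamp_continuous s u : smooth_slab T u -> continuous (fun z => xt s u (clamp z)).
Proof.
move=> us; have [g [gc _ E]] := xt_ext s us.
rewrite (_ : (fun z => _) = fun z => g (clamp z)); first exact: clamp_comp_continuous.
by apply/funext => z; rewrite E//; exact: slab_clamp.
Qed.

Lemma slab_eq (g h : 'rV[R]_d.+1 -> R) : continuous (fun z => g (clamp z)) ->
  continuous (fun z => h (clamp z)) -> (forall z, O z -> g z = h z) ->
  forall z, slab T z -> g z = h z.
Proof.
move=> gc hc gh z Sz; apply/eqP; rewrite -subr_eq0 -normr_le0; apply/ler_addgt0Pr => e e0.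
rewrite add0r; have e2 : 0 < e / 2 by rewrite divr_gt0.
have /cvgrPdist_le/(_ _ e2) G := gc z.
have /cvgrPdist_le/(_ _ e2) H := hc z.
have [y [[Gy Hy] Oy _]] := slab_dense Sz (filterI G H).
have Sy := open_slab_slab Oy.
move: Gy Hy; rewrite /= !clamp_slab// (gh y Oy) => Gy Hy.
rewrite -(subrKA (h y)) (le_trans (ler_normD _ _))// (splitr e) lerD//.
by rewrite distrC.
Qed.

Lemma slab_le (g : 'rV[R]_d.+1 -> R) (M : R) : continuous (fun z => g (clamp z)) ->
  (forall z, O z -> `|g z| <= M) -> forall z, slab T z -> `|g z| <= M.
Proof.
move=> gc gM z Sz; apply/ler_addgt0Pr => e e0.
have /cvgrPdist_le/(_ _ e0) G := gc z.
have [y [Gy Oy _]] := slab_dense Sz G.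
have Sy := open_slab_slab Oy.
move: Gy; rewrite /= !clamp_slab// => Gy.
by rewrite -(subrK (g y) (g z)) addrC (le_trans (ler_normD _ _))// lerD// gM.
Qed.

Lemma smooth_slab_partials s u : smooth_slab T u -> smooth_slab T (partials s u).
Proof.
move=> us; have uO := smooth_slab_smooth us; split; first exact: smooth_on_partials.
move=> a; have [g [gc gE _]] := xt_ext (mi_seq a ++ s) us; exists g; split => // z Oz.
rewrite gE// -{2}(mi_mi_seq a) (mderiv_mi _ open_open_slab (smooth_on_partials s uO) Oz).
by rewrite partials_cat.
Qed.

Lemma xt_partials s s' u z : smooth_slab T u -> slab T z ->
  xt s' (partials s u) z = xt (s' ++ s) u z.
Proof.
move=> us; have us' := smooth_slab_partials s us; move: z; apply: slab_eq.
- exact: xt_clamp_continuous.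
- exact: xt_clamp_continuous.
- by move=> z Oz; rewrite !xt_open// partials_cat.
Qed.

Lemma smooth_slab_global u : smooth_on setT u -> smooth_slab T u.
Proof.
move=> us; split; first exact: smooth_on_subset us.
move=> a; exists (mderiv a u); split => //.
by apply: continuous_subspaceT; apply: smooth_continuous; exact: smooth_on_partials.
Qed.

Lemma xt_global s u z : smooth_on setT u -> slab T z -> xt s u z = partials s u z.
Proof.
move=> us Sz; apply: (dext_unique T0 _ _ Sz).
  by apply: continuous_subspaceT; apply: smooth_continuous; exact: smooth_on_partials.
by move=> y Oy; rewrite (mderiv_mi _ openT us).
Qed.

Lemma pderiv_extE i k u : pderiv_ext T i k u = xt (nseq k i) u.
Proof.
rewrite /pderiv_ext /xt; congr (dext T _ u); apply/ffunP => j.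
by rewrite !ffunE count_nseq /= eq_sym; case: eqP; rewrite ?mul1n ?mul0n.
Qed.

Lemma val_extE u : val_ext T u = xt [::] u.
Proof. by rewrite /val_ext /xt; congr (dext T _ u); apply/ffunP => j; rewrite !ffunE. Qed.

Lemma laplacianE u z : laplacian T u z = \sum_(i < d) xt [:: li i; li i] u z.
Proof. by apply: eq_bigr => i _; rewrite pderiv_extE. Qed.

Lemma smooth_slab_sub u w : smooth_slab T u -> smooth_slab T w ->
  smooth_slab T (fun z => u z - w z).
Proof.
move=> us ws; have uO := smooth_slab_smooth us; have wO := smooth_slab_smooth ws.
have oO := open_open_slab.
split; first exact: smooth_onB.
move=> a; exists (fun z => xt (mi_seq a) u (clamp z) - xt (mi_seq a) w (clamp z)); split.
  apply: continuous_subspaceT.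
  by apply: continuous_sub; exact: xt_clamp_continuous.
move=> z Oz; have Sz := open_slab_slab Oz.
rewrite clamp_slab// !xt_open// -{3}(mi_mi_seq a) (mderiv_mi _ oO (smooth_onB oO uO wO) Oz).
by rewrite (partials_sub _ oO uO wO Oz).
Qed.

Lemma xt_sub s u w z : smooth_slab T u -> smooth_slab T w -> slab T z ->
  xt s (fun z => u z - w z) z = xt s u z - xt s w z.
Proof.
move=> us ws; have uO := smooth_slab_smooth us; have wO := smooth_slab_smooth ws.
have oO := open_open_slab.
have uw := smooth_slab_sub us ws.
move: z; apply: (@slab_eq (xt s (fun z => u z - w z)) (fun z => xt s u z - xt s w z)).
- exact: xt_clamp_continuous.
- by apply: continuous_sub; exact: xt_clamp_continuous.
- by move=> z Oz; rewrite !xt_open// (partials_sub _ oO uO wO Oz).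
Qed.

End Slab.

(** * Sup bound for zero initial data *)

Section ZeroData.
Context {R : realType} {d : nat}.
Variable T : R.
Hypothesis T0 : 0 < T.
Implicit Types (z y : 'rV[R]_d.+1) (u w g : 'rV[R]_d.+1 -> R) (s : seq 'I_d.+1).
Local Notation O := (@open_slab R d T).
Local Notation oO := (@open_open_slab R d T).

(** The extension cannot simply be differentiated along t = 0, so a nearby slice t = b > 0 is used.
    If the extended derivative had a limit c != 0, the increment over a step h in the slice would be
    at least h |c| / 2, while both end values tend to 0 with b. *)
Lemma xt_time0_lift s u i : smooth_slab T u -> (forall z, time z = 0 -> xt T s u z = 0) ->
  forall z, time z = 0 -> xt T (li i :: s) u z = 0.
Proof.
move=> us u0 z z0; apply/eqP; apply: contraT => c0.
have uO := smooth_on_partials s (smooth_slab_smooth us).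
have Sz0 y : time y = 0 -> slab T y by move=> y0; rewrite /slab /= y0 lexx ltW.
set c := xt T (li i :: s) u z in c0.
have cp : 0 < `|c| by rewrite normr_gt0.
have c2 : 0 < `|c| / 2 by rewrite divr_gt0.
have Xc s' : continuous (fun y => xt T s' u (clamp T y)) by exact: xt_clamp_continuous.
have /cvgrPdist_le/(_ _ c2) G := Xc (li i :: s) z.
have [r r0 rG] := near_row_norm G.
pose h := r / 2; have h0 : 0 < h by rewrite divr_gt0.
have hr : h < r by rewrite ltr_pdivrMr// ltr_pMr// ltr1n.
(* Two end values of this size add up to h |c| / 4, below h |c| / 2. The step h is fixed first, then
   b is taken small. *)
have e0 : 0 < h * (`|c| / 8) by rewrite mulr_gt0// divr_gt0.
have /cvgrPdist_le/(_ _ e0) A1 := Xc s z.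
have /cvgrPdist_le/(_ _ e0) A2 := Xc s (z + h *: 'e_(li i)).
have B1 := near_translate 'e_ord0 A1.
have B2 := near_translate 'e_ord0 A2.
have [b [b1 [b2 [b0 [br bT]]]]] : exists b : R,
   `|xt T s u (clamp T z) - xt T s u (clamp T (z + b *: 'e_ord0))| <= h * (`|c| / 8) /\
   `|xt T s u (clamp T (z + h *: 'e_(li i))) -
      xt T s u (clamp T (z + h *: 'e_(li i) + b *: 'e_ord0))| <= h * (`|c| / 8) /\
   0 < b /\ b < r /\ b < T.
  have [b [[b1 b2] [b0 [br bT]]]] : exists b : R,
   ((`|xt T s u (clamp T z) - xt T s u (clamp T (z + b *: 'e_ord0))| <= h * (`|c| / 8)) /\
   (`|xt T s u (clamp T (z + h *: 'e_(li i))) -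
      xt T s u (clamp T (z + h *: 'e_(li i) + b *: 'e_ord0))| <= h * (`|c| / 8))) /\
   (0 < b /\ b < r /\ b < T).
    have B12 := @filterI _ _ (nbhs_filter (0 : R)) _ _ B1 B2.
    have [q /= q0 qP] := (nbhs_normP _ _).1 B12.
    pose b := Num.min (q / 2) (Num.min (r / 2) (T / 2)).
    have b0 : 0 < b by rewrite !lt_min !divr_gt0.
    have bq : b < q by rewrite gt_min ltr_pdivrMr// ltr_pMr// ltr1n.
    have br : b < r by rewrite !gt_min orbCA ltr_pdivrMr// ltr_pMr// ltr1n.
    have bT : b < T.
      by rewrite !gt_min; apply/orP; right; apply/orP; right; rewrite ltr_pdivrMr// ltr_pMr// ltr1n.
    exists b; split => //; have := qP b; rewrite /= sub0r normrN gtr0_norm//.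
    by move=> /(_ bq).
  by exists b.
have tb (k : R) : time (z + b *: 'e_ord0 + k *: 'e_(li i)) = b.
  by rewrite time_shift_lift time_shift z0 add0r.
have Ob (k : R) : O (z + b *: 'e_ord0 + k *: 'e_(li i)) by rewrite /open_slab /= tb b0 bT.
have Ob0 : O (z + b *: 'e_ord0) by have := Ob 0; rewrite scale0r addr0.
have cl y : O y -> clamp T y = y by move=> Oy; apply: clamp_slab; exact: open_slab_slab.
have [t t01|t t01 mvt] := @mvt_partial R d.+1 (li i) (partials s u) (z + b *: 'e_ord0) h _.
  exact: smooth_on_derivable uO (Ob _).
rewrite (clamp_slab (Sz0 _ z0)) u0// in b1.
have z0' : time (z + h *: 'e_(li i)) = 0 by rewrite time_shift_lift.
rewrite (clamp_slab (Sz0 _ z0')) u0// addrAC in b2.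
have Obh := Ob h.
rewrite cl// xt_open// sub0r normrN in b1.
rewrite cl// xt_open// sub0r normrN in b2.
have : `|xt T (li i :: s) u (clamp T z) - xt T (li i :: s) u
    (clamp T (z + b *: 'e_ord0 + (t * h) *: 'e_(li i)))| <= `|c| / 2.
  apply: rG.
  have -> : z + b *: 'e_ord0 + (t * h) *: 'e_(li i) - z = b *: 'e_ord0 + (t * h) *: 'e_(li i).
    by rewrite addrC !addrA addNr add0r.
  apply: row_norm_lt => // k; rewrite !mxE eqxx /=.
  move/andP: t01 => [t0 t1]; have th : t * h < r by apply: le_lt_trans hr; rewrite ler_piMl// ltW.
  have th0 : 0 <= t * h by rewrite mulr_ge0// ltW.
  move: k; apply: ord_cases => [|k] /=.
    by rewrite mulr1 mulr0 addr0 gtr0_norm.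
  rewrite mulr0 add0r; case: eqP => _ /=; rewrite ?mulr1 ?mulr0 ?normr0// ger0_norm//.
rewrite (clamp_slab (Sz0 _ z0)) -/c cl// (xt_open T0 _ us (Ob _)) => cG.
move: mvt; set g := partial _ _ _ in cG *; move=> mvt.
have gc : `|c| / 2 <= `|g|.
  have := ler_normD (c - g) g; rewrite subrK => k.
  by have := le_trans k (lerD cG (lexx _)); rewrite -lerBlDl {1}(splitr `|c|) addrK.
have : h * `|g| <= h * (`|c| / 8) + h * (`|c| / 8).
  rewrite -{1}(gtr0_norm h0) -normrM -mvt.
  by apply: le_trans (ler_normB _ _) _; exact: lerD.
rewrite -mulrDr ler_pM2l// => gc'.
have := le_trans gc gc'.
by move: cp; move: `|c| => k; lra.
Qed.

Hypothesis d3 : (d <= 3)%N.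

(** T^2 bounds t^2 s, [sph_cst] is the area of the parameter rectangle, on which |sin theta| <= 1,
    and the divisor is 4 pi. *)
Definition wave_cst : R := T ^+ 2 * (@sph_cst R) / sph_int (fun p : R * R => sin p.1).

Lemma wave_cst_ge0 : 0 <= wave_cst.
Proof.
rewrite /wave_cst divr_ge0 ?(ltW sph_int_sin_gt0)// mulr_ge0 ?sqr_ge0//.
exact: cf_ge0 (@cfunctional_sph R).
Qed.

(* The sup bound contained in Kirchhoff's formula. *)
Lemma zero_data_bound u z (M : R) : smooth_slab T u ->
  (forall y, time y = 0 -> xt T [::] u y = 0) ->
  (forall y, time y = 0 -> xt T [:: ord0] u y = 0) ->
  O z -> 0 <= M -> (forall y, O y -> time y < time z -> `|box u y| <= M) ->
  `|u z| <= wave_cst * M.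
Proof.
move=> us u0 u1 Oz M0 uM; have uO := smooth_slab_smooth us.
have [tz0 tzT] := andP Oz.
have H s : continuous (fun y => xt T s u (clamp T y)) by exact: xt_clamp_continuous.
(* Continuous version of [cone_data]: at s = 1 the cone reaches t = 0, where u and its derivatives
   are known only through their extensions. *)
pose kz (q : R * (R * R)) := sin q.2.1 * (time z * q.1 * (xt T [:: ord0] u (clamp T (cpt z q)) +
   \sum_(i < d) omega i q.2 * xt T [:: li i] u (clamp T (cpt z q))) + xt T [::] u (clamp T (cpt z q))).
have Hc s : continuous (fun q => xt T s u (clamp T (cpt z q))).
  apply: continuous_pointwise => q.
  apply: (@continuous_comp _ _ _ (cpt z) (fun y => xt T s u (clamp T y))); last exact: H.
  exact: continuous_cpt.
have ang (a : R * R -> R) : continuous a -> continuous (fun q : R * (R * R) => a q.2).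
  exact: continuous_ang3.
have kc : continuous kz.
  apply: continuous_mul; first by apply: (ang (fun p => sin p.1)); exact: sin1_continuous.
  apply: continuous_add; last exact: Hc.
  apply: continuous_mul; first exact: continuous_mul (@continuous_const _ _ _) (@continuous_fst3 R).
  apply: continuous_add; first exact: Hc.
  apply: continuous_sum => i; apply: continuous_mul; last exact: Hc.
  by apply: ang; exact: omega_continuous.
have JP := @cfunctional_sph R.
pose Z (s : R) := sph_int (fun p => kz (s, p)).
have Zc : continuous Z.
  apply: continuous_pointwise => s; apply: (cf_continuous JP (g := fun (s : R) p => kz (s, p))).
    by near=> x; exact: slice_continuous.
  move=> p _; rewrite (_ : (fun q => _) = kz); first exact: kc.
  by apply/funext => -[].
have Oc (s : R) p : 0 < s < 1 -> O (cpt z (s, p)).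
  move=> /andP[s0 s1]; rewrite /open_slab /= /time cptE0 /=; apply/andP; split.
    by rewrite mulr_gt0// subr_gt0.
  by apply: le_lt_trans tzT; rewrite ler_piMr ?(ltW tz0)// gerBl ltW.
have kE (s : R) p : 0 < s < 1 -> kz (s, p) = cone_data u z (s, p).
  move=> s01; have Oy := Oc s p s01.
  rewrite /kz /cone_data clamp_slab; last exact: open_slab_slab.
  rewrite !xt_open//; congr (_ * (_ * (_ + _) + _)).
  by apply: eq_bigr => i _; rewrite xt_open.
have near01 (s : R) : 0 < s < 1 -> \forall x \near s, 0 < x < 1.
  move=> /andP[s0 s1]; apply/nbhs_normP; exists (Num.min s (1 - s)).
    by rewrite /= lt_min s0 subr_gt0.
  by move=> x /=; rewrite lt_min !ltr_norml => /andP[/andP[a1 a2] /andP[b1 b2]]; lra.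
pose Z' (s : R) := - (time z ^+ 2 * s * sph_int (fun p => sin p.1 * box u (cpt z (s, p)))).
have dZ (s : R) : 0 < s < 1 -> is_derive s 1 Z (Z' s).
  move=> s01; apply: near_eq_is_derive; last first.
    apply: (is_derive_cone_mean d3 oO uO); near=> x => p; apply: Oc.
    by near: x; exact: near01.
  near=> x; rewrite /Z; congr sph_int; apply/funext => p; rewrite kE//.
  by near: x; exact: near01.
have D (x : R) : x \in `]0, 1[%R -> is_derive x 1 Z (Z' x) by rewrite in_itv; exact: dZ.
have C : {within `[0, 1], continuous Z} by exact: continuous_subspaceT.
(* The mean value theorem evaluates box u only at some x in ]0, 1[: there the points of the cone are
   inside the slab and strictly earlier than z, as the hypothesis on box u demands. *)
have [x] := MVT ltr01 D C.
rewrite in_itv /= => x01; rewrite subr0 mulr1.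
have -> : Z 1 = 0.
  rewrite /Z (_ : (fun p => _) = fun p => 0 * sin p.1).
    by rewrite (cfZ JP) ?mul0r//; exact: sin1_continuous.
  apply/funext => p; rewrite /kz /=.
  have c0 : time (cpt z (1, p)) = 0 by rewrite /time cptE0 /= subrr mulr0.
  rewrite clamp_slab; last by rewrite /slab /= c0 lexx ltW.
  rewrite u0// u1// big1 ?addr0 ?mulr0 ?mul0r// => i _.
  by rewrite (@xt_time0_lift [::] u i us u0)// mulr0.
have -> : Z 0 = u z * sph_int (fun p => sin p.1).
  rewrite -(cfZ JP); last exact: sin1_continuous.
  congr sph_int; apply/funext => p; rewrite /kz /= cpt0 clamp_slab; last exact: open_slab_slab.
  by rewrite !mulr0 mul0r add0r xt_open// mulrC.
rewrite sub0r => /eqP; rewrite eqr_opp => /eqP ZE.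
have N0 := @sph_int_sin_gt0 R.
rewrite /wave_cst mulrAC ler_pdivlMr// -[X in _ * X](gtr0_norm N0) -normrM ZE.
have [x0 x1] := andP x01.
have bc : continuous (fun p => sin p.1 * box u (cpt z (x, p))).
  apply: continuous_mul; first exact: sin1_continuous.
  apply: continuous_pointwise => p.
  apply: (@slice_continuous_at _ _ _ (fun q => box u (cpt z q))).
  exact: continuous_at_cpt (smooth_box oO uO) (Oc x p x01).
have : `|sph_int (fun p => sin p.1 * box u (cpt z (x, p)))| <= (@sph_cst R) * M.
  apply: (cf_bound JP bc) => p _; rewrite normrM -[leRHS]mul1r.
  apply: ler_pM; [exact: normr_ge0|exact: normr_ge0| |].
    by rewrite ler_norml sin_geN1 sin_le1.
  apply: uM; first exact: Oc.
  by rewrite {1}/time cptE0 /= gtr_pMr ?gtrBl.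
have Tz : 0 <= time z ^+ 2 * x by rewrite mulr_ge0 ?sqr_ge0 ?ltW.
rewrite normrM (ger0_norm Tz) => k; rewrite -[leRHS]mulrA.
apply: ler_pM => //; apply: le_trans (_ : time z ^+ 2 <= _).
  by rewrite ler_piMr ?sqr_ge0// ltW.
by rewrite ler_pXn2r ?nnegrE ?(ltW tz0) ?(ltW T0) ?(ltW tzT).
Unshelve. all: by end_near. Qed.

End ZeroData.

Section Interpolation.
Context {R : realType} {d : nat}.
Variable T : R.
Implicit Types (z y : 'rV[R]_d.+1) (u : 'rV[R]_d.+1 -> R).
Local Notation O := (@open_slab R d T).
Local Notation oO := (@open_open_slab R d T).

(** Landau's inequality: a difference quotient approximates the derivative up to h B. In the time
    direction the sign of the step is chosen to stay in the slab, which h < T / 2 permits. *)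
Lemma interpolation u i (h A B : R) z : smooth_on O u -> 0 < h -> h < T / 2 ->
  (forall y, O y -> `|u y| <= A) -> (forall y, O y -> `|partial i (partial i u) y| <= B) ->
  O z -> `|partial i u z| <= 2 * A / h + h * B.
Proof.
move=> uO h0 hT uA uB Oz; have [z0 zT] := andP Oz.
have [k [kh Ok]] : exists k : R, `|k| = h /\ forall t : R, 0 <= t <= 1 -> O (z + (t * k) *: 'e_i).
  move: i uB; apply: ord_cases => [|i] uB; last first.
    by exists h; split => [|t _]; rewrite ?gtr0_norm// /open_slab /= time_shift_lift z0 zT.
  have [zh|zh] := leP (time z) (T / 2).
    exists h; split => [|t /andP[t0 t1]]; first by rewrite gtr0_norm.
    rewrite /open_slab /= time_shift.
    have th : t * h <= h by rewrite ler_piMl// ltW.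
    have th0 : 0 <= t * h by rewrite mulr_ge0// ltW.
    by apply/andP; split; lra.
  exists (- h); split => [|t /andP[t0 t1]]; first by rewrite normrN gtr0_norm.
  rewrite /open_slab /= time_shift.
  have th : t * h <= h by rewrite ler_piMl// ltW.
  have th0 : 0 <= t * h by rewrite mulr_ge0// ltW.
  by apply/andP; split; lra.
have [t t01|t t01 E] := @mvt_partial R d.+1 i u z k _.
  exact: smooth_on_derivable uO (Ok t t01).
have [t0 t1] := andP t01.
have Ok' (a : R) : 0 <= a <= 1 -> O (z + (a * (t * k)) *: 'e_i).
  move=> /andP[a0 a1]; rewrite mulrA; apply: Ok.
  by rewrite mulr_ge0//= mulr_ile1.
have [a a01|a a01 E'] := @mvt_partial R d.+1 i (partial i u) z (t * k) _.
  exact: smooth_on_derivable (smooth_on_partial i uO) (Ok' a a01).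
have k0 : k != 0 by rewrite -normr_gt0 kh.
have O1 : O (z + k *: 'e_i) by have := Ok 1; rewrite mul1r lexx ler01 => /(_ isT).
have -> : partial i u z = (u (z + k *: 'e_i) - u z) / k -
    t * k * partial i (partial i u) (z + (a * (t * k)) *: 'e_i).
  by rewrite -E' E [k * _]mulrC mulfK// opprB addrC subrK.
apply: le_trans (ler_normB _ _) _; apply: lerD.
  rewrite normrM normfV kh ler_pM2r ?invr_gt0// mulr_natl mulr2n.
  by apply: le_trans (ler_normB _ _) _; rewrite lerD ?uA.
rewrite !normrM kh ger0_norm// -mulrA; apply: le_trans (_ : 1 * (h * B) <= _); last by rewrite mul1r.
rewrite ler_pM ?mulr_ge0 ?(ltW h0)// ler_pM2l// uB//.
exact: Ok'.
Qed.

End Interpolation.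

(** * Nets *)

Section SmallParameter.
Context {R : realType}.
Implicit Types (e : R).

Lemma near0_lt (c : R) : 0 < c -> \forall e \near (0 : R)^'+, 0 < e < c.
Proof.
move=> c0; near=> e; apply/andP; split; first by [].
by near: e; exact: nbhs_right_lt.
Unshelve. all: by end_near. Qed.

Lemma near0_01 : \forall e \near (0 : R)^'+, 0 < e <= 1.
Proof. by apply: filterS (near0_lt ltr01) => e /andP[e0 /ltW e1]; rewrite e0. Qed.

Lemma powR_nat e (k : nat) : 0 <= e -> e `^ (k%:R) = e ^+ k.
Proof. exact: powR_mulrn. Qed.

Lemma OpowP (f : R -> R) (b : R) : Opow f b <->
  exists2 C : R, 0 < C & \forall e \near (0 : R)^'+, `|f e| <= C * e `^ b.
Proof.
split=> [/eqO_exP[C C0 fC]|[C C0 fC]].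
  by exists C => //; apply: filterS fC => e /=; rewrite (ger0_norm (powR_ge0 _ _)).
apply/eqO_exP; exists C => //; apply: filterS fC => e.
by rewrite (ger0_norm (powR_ge0 _ _)).
Qed.

Lemma exists_nat_ge (x : R) : exists n : nat, x <= n%:R.
Proof.
exists (Num.bound `|x|); apply: le_trans (ler_norm x) (ltW (archi_boundP _)).
exact: normr_ge0.
Qed.

Lemma Opow_le (f : R -> R) (b : R) (k : nat) : b <= k%:R ->
  (\forall e \near (0 : R)^'+, `|f e| <= e ^+ k) -> Opow f b.
Proof.
move=> bk fk; apply/OpowP; exists 1 => //; near=> e.
have e01 : 0 < e <= 1 by near: e; exact: near0_01.
have [e0 e1] := andP e01.
apply: le_trans (_ : e ^+ k <= _); first by near: e; exact: fk.
by rewrite mul1r -powR_nat ?(ltW e0)//; apply: ger_powR; rewrite ?e0.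
Unshelve. all: by end_near. Qed.

(** One spare power of eps pays for any constant; this accounts for the exponents raised by one
    below. *)
Lemma near0_absorb (C : R) (k : nat) : \forall e \near (0 : R)^'+, C * e ^+ k.+1 <= e ^+ k.
Proof.
have C1 : 0 < `|C| + 1 by rewrite ltr_wpDl.
have D0 : 0 < (`|C| + 1)^-1 by rewrite invr_gt0.
near=> e.
have /andP[e0 eC] : 0 < e < (`|C| + 1)^-1 by near: e; exact: near0_lt.
rewrite exprS mulrA ler_piMl ?exprn_ge0 ?(ltW e0)//.
apply: le_trans (_ : (`|C| + 1) * e <= _).
  by rewrite ler_pM2r// (le_trans (ler_norm C))// lerDl.
by rewrite mulrC -ler_pdivlMr// div1r ltW.
Unshelve. all: by end_near. Qed.

Lemma Opow_nat (f : R -> R) (k : nat) : Opow f k.+1%:R ->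
  \forall e \near (0 : R)^'+, `|f e| <= e ^+ k.
Proof.
move=> /OpowP[C C0 fC]; near=> e.
have e0 : 0 < e by [].
apply: le_trans (_ : C * e ^+ k.+1 <= _); last by near: e; exact: near0_absorb.
by rewrite -powR_nat ?(ltW e0)//; near: e; exact: fC.
Unshelve. all: by end_near. Qed.

End SmallParameter.

Section Nets.
Context {R : realType} {d : nat}.
Variable T : R.
Hypothesis T0 : 0 < T.
Implicit Types (w : R -> 'rV[R]_d.+1 -> R) (K : set 'rV[R]_d.+1) (s : seq 'I_d.+1).
Local Notation O := (@open_slab R d T).
Local Notation oO := (@open_open_slab R d T).

Definition smooth_net_on w := forall e : R, 0 < e <= 1 -> smooth_on O (w e).

(** Bounds without constants, since k may be changed by one, and uniform on the open slab; they
    imply the bounds on compact subsets of the closed slab by density. *)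
Definition small_deriv w s (k : nat) :=
  \forall e \near (0 : R)^'+, forall z, O z -> `|partials s (w e) z| <= e ^+ k.

Definition moderate_deriv w s (k : nat) :=
  \forall e \near (0 : R)^'+, forall z, O z -> `|partials s (w e) z| <= (e ^+ k)^-1.

Definition bounded_deriv w s :=
  exists C : R, \forall e \near (0 : R)^'+, forall z, O z -> `|partials s (w e) z| <= C.

Lemma bounded_moderate w s : bounded_deriv w s -> moderate_deriv w s 1.
Proof.
move=> [C wC]; rewrite /moderate_deriv; near=> e => z Oz.
have e0 : 0 < e by [].
apply: le_trans (_ : C <= _); first by move: z Oz; near: e; exact: wC.
rewrite expr1 -[e^-1]mul1r ler_pdivlMr//.
rewrite -(expr1 e) -(expr0 e).
by near: e; exact: (@near0_absorb R C 0).
Unshelve. all: by end_near. Qed.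

Lemma interpolation_net w : smooth_net_on w ->
  (forall s, exists k, moderate_deriv w s k) ->
  (forall k, small_deriv w [::] k) -> forall s k, small_deriv w s k.
Proof.
move=> ws wm w0; elim=> [//|i s IH] k.
have [l ml] := wm [:: i, i & s].
(* The step of the interpolation is h = eps^(k + l + 1). Both the lower bound divided by h and h
   times the bound eps^(- l) of the second derivative are then eps^(k + 1), and h <= eps is below T
   / 2 eventually. *)
have sA := IH ((k + 1) + (k + l + 1))%N.
have T2 : 0 < T / 2 by rewrite divr_gt0.
rewrite /small_deriv; near=> e => z Oz.
have e01 : 0 < e <= 1 by near: e; exact: near0_01.
have [e0 e1] := andP e01.
have h0 : 0 < e ^+ (k + l + 1) by rewrite exprn_gt0.
have hT : e ^+ (k + l + 1) < T / 2.
  apply: le_lt_trans (_ : e < T / 2).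
    by rewrite addn1 exprS ler_piMr ?(ltW e0)// exprn_ile1// ltW.
  by have /andP[] : 0 < e < T / 2 by near: e; exact: near0_lt.
have uA : forall y, O y -> `|partials s (w e) y| <= e ^+ ((k + 1) + (k + l + 1)).
  by near: e; exact: sA.
have uB : forall y, O y -> `|partial i (partial i (partials s (w e))) y| <= (e ^+ l)^-1.
  by near: e; exact: ml.
have us := smooth_on_partials s (ws e e01).
apply: le_trans (interpolation us h0 hT uA uB Oz) _.
have -> : e ^+ (k + l + 1) * (e ^+ l)^-1 = e ^+ k.+1.
  by rewrite addn1 -addSn exprD mulfK// gt_eqF// exprn_gt0.
rewrite exprD mulrA mulfK ?gt_eqF// addn1.
have -> : 2 * e ^+ k.+1 + e ^+ k.+1 = 3 * e ^+ k.+1 by ring.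
by near: e; exact: near0_absorb.
Unshelve. all: by end_near. Qed.

Lemma dext_le w s e (M : R) : smooth_slab T (w e) ->
  (forall z, O z -> `|partials s (w e) z| <= M) ->
  forall z, slab T z -> `|xt T s (w e) z| <= M.
Proof.
move=> ws wM; apply: slab_le => //; first exact: xt_clamp_continuous.
by move=> z Oz; rewrite xt_open//; exact: wM.
Qed.

Lemma sup_abs_le K u (M : R) : 0 <= M -> (forall z, K z -> `|u z| <= M) ->
  `|sup_abs K u| <= M.
Proof.
move=> M0 uM; rewrite /sup_abs; set A := [set `|u x| | x in K].
(* K may be empty, where [sup] is 0 by convention. *)
have [->|/set0P A0] := eqVneq A set0; first by rewrite sup0 normr0.
have [x Ax] := A0; have ub : ubound A M by move=> _ [z Kz <-]; exact: uM.
rewrite ger0_norm; first exact: ge_sup.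
case: (Ax) => z Kz zx; apply: le_trans (_ : x <= _); first by rewrite -zx.
by apply: ub_le_sup => //; exists M.
Qed.

Lemma vanishing_of w : smooth_net T w -> (forall s k, small_deriv w s k) -> vanishing T w.
Proof.
move=> ws wk; split => // K cK KS a b b0.
have [k bk] := exists_nat_ge b; apply: (Opow_le bk).
have H := wk (mi_seq a) k; near=> e.
have e01 : 0 < e <= 1 by near: e; exact: near0_01.
have [e0 e1] := andP e01.
apply: sup_abs_le; first by rewrite exprn_ge0// ltW.
move=> z Kz; rewrite -(mi_mi_seq a); apply: (dext_le (ws e e01)) (KS z Kz).
by near: e; exact: H.
Unshelve. all: by end_near. Qed.

Lemma moderate_of w : smooth_net T w -> (forall s, exists k, moderate_deriv w s k) ->
  moderate T w.
Proof.
move=> ws wk; split => // K cK KS a; have [k H] := wk (mi_seq a).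
exists (- k%:R); apply/OpowP; exists 1 => //; near=> e.
have e01 : 0 < e <= 1 by near: e; exact: near0_01.
have [e0 e1] := andP e01.
rewrite mul1r powRN powR_nat ?(ltW e0)//.
apply: sup_abs_le; first by rewrite invr_ge0 exprn_ge0// ltW.
move=> z Kz; rewrite -(mi_mi_seq a); apply: (dext_le (ws e e01)) (KS z Kz).
by near: e; exact: H.
Unshelve. all: by end_near. Qed.

(** A set without upper bound has a meaningless default [sup]; compactness of K and continuity of
    the extension ensure that the values are bounded. *)
Lemma le_sup_abs K u z : compact K -> continuous (fun z => u (clamp T z)) ->
  K `<=` slab T -> K z -> `|u z| <= sup_abs K u.
Proof.
move=> cK uc KS Kz; apply: ub_le_sup; last by exists z.
have K0 : K !=set0 by exists z.
have [|c cK' cmax] := @compact_EVT_max _ R (fun z => `|u (clamp T z)|) K K0 cK.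
  apply: continuous_subspaceT; apply: continuous_pointwise => x.
  by apply: (@continuous_comp _ _ _ (fun z => u (clamp T z))); [exact: uc|exact: norm_continuous].
exists `|u (clamp T c)| => _ [y Ky <-].
have := cmax y; rewrite inE => /(_ Ky).
by rewrite clamp_slab//; exact: KS.
Qed.

Lemma vanishing_bound w K s k : vanishing T w -> compact K -> K `<=` slab T ->
  \forall e \near (0 : R)^'+, forall z, K z -> `|xt T s (w e) z| <= e ^+ k.
Proof.
move=> [ws wv] cK KS.
have k0 : (0 : R) <= k.+1%:R by rewrite ler0n.
have H := Opow_nat (wv K cK KS (mi s) k.+1%:R k0).
near=> e => z Kz.
have e01 : 0 < e <= 1 by near: e; exact: near0_01.
apply: le_trans (_ : sup_abs K (dext T (mi s) (w e)) <= _).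
  apply: le_sup_abs => //.
  apply: (@xt_clamp_continuous _ _ _ T0 s (w e)); exact: ws.
by apply: le_trans (ler_norm _) _; near: e; exact: H.
Unshelve. all: by end_near. Qed.

End Nets.

Section RealFunctions.
Context {R : realType}.
Implicit Types (f g : R -> R).

Lemma continuous_bounded_on f (C : R) : continuous f ->
  exists2 M : R, 0 <= M & forall x, `|x| <= C -> `|f x| <= M.
Proof.
move=> fc; have [C0|C0] := ltP C 0.
  by exists 0 => // x xC; have := le_lt_trans xC C0; rewrite normr_lt0.
have K0 : `[- C, C]%classic !=set0 by exists 0; rewrite /= in_itv /= oppr_le0 C0.
have [|c _ cmax] := @compact_EVT_max _ R (fun x => `|f x|) _ K0 (@segment_compact _ _ _).
  apply: continuous_subspaceT; apply: continuous_pointwise => x.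
  by apply: (@continuous_comp _ _ _ f); [exact: fc|exact: norm_continuous].
exists `|f c| => // x xC; apply: cmax; rewrite inE /= in_itv /=.
by rewrite -ler_norml.
Qed.

Lemma smooth_fun_lipschitz f (C : R) : smooth_fun f ->
  exists2 L : R, 0 <= L & forall x y, `|x| <= C -> `|y| <= C -> `|f x - f y| <= L * `|x - y|.
Proof.
move=> fs; have [L L0 fL] := continuous_bounded_on C (@smooth_fun_continuous R f 1 fs).
exists L => //.
suff H x y : x <= y -> `|x| <= C -> `|y| <= C -> `|f y - f x| <= L * `|y - x|.
  move=> x y xC yC; have [xy|/ltW yx] := leP x y; last exact: H.
  by rewrite distrC (distrC x); exact: H.
move=> xy xC yC.
have D t : t \in `]x, y[%R -> is_derive t 1 f (derive1n 1 f t).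
  by move=> _; exact: (smooth_fun_is_derive 0 t fs).
have fc : {within `[x, y], continuous f}.
  by apply: continuous_subspaceT; exact: (@smooth_fun_continuous R f 0 fs).
have [t] := MVT_segment xy D fc.
rewrite in_itv /= => /andP[xt ty] ->; rewrite normrM ler_wpM2r// fL//.
move: xC yC; rewrite !ler_norml => /andP[a b] /andP[c e].
by rewrite (le_trans a xt) (le_trans ty e).
Qed.

End RealFunctions.

(** * Nets with all derivatives bounded on the slab *)

Section BoundedNets.
Context {R : realType} {d : nat}.
Variable T : R.
Hypothesis T0 : 0 < T.
Local Notation E := 'rV[R]_d.+1.
Implicit Types (z y : E) (w g h : R -> E -> R) (s : seq 'I_d.+1).

Definition global_smooth_net w := forall e : R, 0 < e <= 1 -> smooth_on setT (w e).

Definition bounded_on_slab w :=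
  exists C : R, \forall e \near (0 : R)^'+, forall z, slab T z -> `|w e z| <= C.

Definition bounded_net w := global_smooth_net w /\
  forall s, bounded_on_slab (fun e => partials s (w e)).

Lemma bounded_on_slab_add g h : bounded_on_slab g -> bounded_on_slab h ->
  bounded_on_slab (fun e z => g e z + h e z).
Proof.
move=> [C gC] [D hD]; exists (C + D); near=> e => z Sz.
apply: le_trans (ler_normD _ _) _; apply: lerD; move: z Sz; near: e; [exact: gC|exact: hD].
Unshelve. all: by end_near. Qed.

Lemma bounded_on_slab_mul g h : bounded_on_slab g -> bounded_on_slab h ->
  bounded_on_slab (fun e z => g e z * h e z).
Proof.
move=> [C gC] [D hD]; exists (C * D); near=> e => z Sz.
rewrite normrM; apply: ler_pM => //; move: z Sz; near: e; [exact: gC|exact: hD].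
Unshelve. all: by end_near. Qed.

Lemma bounded_on_slab_eq g h : (forall e, 0 < e <= 1 -> forall z, g e z = h e z) ->
  bounded_on_slab g -> bounded_on_slab h.
Proof.
move=> gh [C gC]; exists C; near=> e => z Sz.
rewrite -gh; last by near: e; exact: near0_01.
by move: z Sz; near: e; exact: gC.
Unshelve. all: by end_near. Qed.

(** Counterpart of [smooth_alg] for nets: boundedness of all derivatives follows from sup bounds on
    generators whose derivatives stay in the algebra. *)
Inductive net_alg (S : (R -> E -> R) -> Prop) : (R -> E -> R) -> Prop :=
  | NAgen g of S g : net_alg S g
  | NAbounded g of bounded_net g : net_alg S g
  | NAadd g h of net_alg S g & net_alg S h : net_alg S (fun e z => g e z + h e z)
  | NAmul g h of net_alg S g & net_alg S h : net_alg S (fun e z => g e z * h e z).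

Lemma bounded_net_partial w i : bounded_net w -> bounded_net (fun e => partial i (w e)).
Proof.
move=> [ws wb]; split; first by move=> e e01; apply: smooth_on_partial; exact: ws.
move=> s; have [C wC] := wb (rcons s i); exists C.
by apply: filterS wC => e wC z Sz; have := wC z Sz; rewrite -cats1 partials_cat.
Qed.

Lemma bounded_net_alg (S : (R -> E -> R) -> Prop) :
  (forall g, S g -> global_smooth_net g) -> (forall g, S g -> bounded_on_slab g) ->
  (forall g i, S g -> exists2 g', net_alg S g' &
     forall e, 0 < e <= 1 -> forall z, partial i (g e) z = g' e z) ->
  forall g, net_alg S g -> bounded_net g.
Proof.
move=> Ss Sb Sd.
have As g : net_alg S g -> global_smooth_net g.
  elim=> {g} [g /Ss//|g []//|g h _ gs _ hs|g h _ gs _ hs] e e01.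
    by apply: smooth_onD (gs e e01) (hs e e01); exact: openT.
  by apply: smooth_onM (gs e e01) (hs e e01); exact: openT.
have Ab g : net_alg S g -> bounded_on_slab g.
  elim=> {g} [g /Sb//|g [_ /(_ [::])]//|g h _ gs _ hs|g h _ gs _ hs].
    exact: bounded_on_slab_add.
  exact: bounded_on_slab_mul.
have Ad g i : net_alg S g -> exists2 g', net_alg S g' &
     forall e, 0 < e <= 1 -> forall z, partial i (g e) z = g' e z.
  elim=> {g} [g /Sd//|g gb|g h Ag [g' Ag' gE] Ah [h' Ah' hE]|g h Ag [g' Ag' gE] Ah [h' Ah' hE]].
  - by exists (fun e => partial i (g e)) => //; apply: NAbounded; exact: bounded_net_partial.
  - exists (fun e z => g' e z + h' e z); first exact: NAadd.
    move=> e e01 z; rewrite -gE// -hE//.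
    have D := is_derive_add (smooth_on_is_derive i (As g Ag e e01) (I : setT z))
      (smooth_on_is_derive i (As h Ah e e01) (I : setT z)).
    exact: (@derive_val _ _ _ _ _ _ _ D).
  - exists (fun e z => g' e z * h e z + g e z * h' e z).
      by apply: NAadd; exact: NAmul.
    move=> e e01 z; rewrite -gE// -hE//.
    have D := is_derive_mul (smooth_on_is_derive i (As g Ag e e01) (I : setT z))
      (smooth_on_is_derive i (As h Ah e e01) (I : setT z)).
    exact: (@derive_val _ _ _ _ _ _ _ D).
move=> g Ag; split; first exact: As.
move=> s; have [h Ah hE] : exists2 h, net_alg S h &
    forall e, 0 < e <= 1 -> forall z, partials s (g e) z = h e z.
  elim: s => [|i s [h Ah hE]]; first by exists g.
  have [h' Ah' h'E] := Ad h i Ah; exists h' => // e e01 z /=.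
  by rewrite -h'E//; congr (partial i _ z); apply/funext => y; exact: hE.
apply: (@bounded_on_slab_eq h); last exact: Ab.
by move=> e e01 z; rewrite hE.
Qed.

Lemma bounded_netD g h : bounded_net g -> bounded_net h ->
  bounded_net (fun e z => g e z + h e z).
Proof.
move=> gb hb; apply: (@bounded_net_alg (fun=> False)) => //.
by apply: NAadd; exact: NAbounded.
Qed.

Lemma bounded_netM g h : bounded_net g -> bounded_net h ->
  bounded_net (fun e z => g e z * h e z).
Proof.
move=> gb hb; apply: (@bounded_net_alg (fun=> False)) => //.
by apply: NAmul; exact: NAbounded.
Qed.

Lemma bounded_net_const (c : R -> R) (C : R) : (\forall e \near (0 : R)^'+, `|c e| <= C) ->
  bounded_net (fun e _ => c e).
Proof.
move=> cC; apply: (@bounded_net_alg (fun g => exists c : R -> R,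
    (exists C : R, \forall e \near (0 : R)^'+, `|c e| <= C) /\ g = fun e _ => c e)).
- by move=> _ [k [_ ->]] e _; apply: smooth_on_cst; exact: openT.
- by move=> _ [k [[D kD] ->]]; exists D; apply: filterS kD.
- move=> _ i [k [_ ->]]; exists (fun _ _ => 0).
    apply: NAgen; exists (fun=> 0); split => //; exists 0.
    by near=> e; rewrite normr0.
  by move=> e _ z; exact: (@derive_val _ _ _ _ _ _ _ (is_derive_cst (k e) z 'e_i)).
- by apply: NAgen; exists c; split => //; exists C.
Unshelve. all: by end_near. Qed.

Lemma bounded_net_cst (c : R) : bounded_net (fun _ _ => c).
Proof. by apply: (@bounded_net_const _ `|c|); near=> e. Unshelve. all: by end_near. Qed.

Lemma bounded_netB g h : bounded_net g -> bounded_net h ->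
  bounded_net (fun e z => g e z - h e z).
Proof.
move=> gb hb; rewrite (_ : (fun e z => _) = fun e z => g e z + (-1) * h e z).
  by apply: bounded_netD => //; apply: bounded_netM => //; exact: bounded_net_cst.
by apply/funext => e; apply/funext => z; rewrite mulN1r.
Qed.

Lemma net_alg_sum (S : (R -> E -> R) -> Prop) (I : Type) (r : seq I) (g : I -> R -> E -> R) :
  (forall i, net_alg S (g i)) -> net_alg S (fun e z => \sum_(i <- r) g i e z).
Proof.
move=> gS; elim: r => [|i r IH].
  rewrite (_ : (fun e z => _) = fun _ _ => 0); first by apply: NAbounded; exact: bounded_net_cst.
  by apply/funext => e; apply/funext => z; rewrite big_nil.
rewrite (_ : (fun e z => _) = fun e z => g i e z + \sum_(j <- r) g j e z); first exact: NAadd.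
by apply/funext => e; apply/funext => z; rewrite big_cons.
Qed.

Lemma bounded_net_sum (I : Type) (r : seq I) (g : I -> R -> E -> R) :
  (forall i, bounded_net (g i)) -> bounded_net (fun e z => \sum_(i <- r) g i e z).
Proof.
move=> gb; apply: (@bounded_net_alg (fun=> False)) => //.
by apply: net_alg_sum => i; exact: NAbounded.
Qed.

Lemma bounded_net_box w : bounded_net w -> bounded_net (fun e => box (w e)).
Proof.
move=> wb; apply: bounded_netB; first by do 2 apply: bounded_net_partial.
by apply: bounded_net_sum => i; do 2 apply: bounded_net_partial.
Qed.

Lemma bounded_net_time : bounded_net (fun _ => @time R d).
Proof.
apply: (@bounded_net_alg (fun g => g = fun _ => @time R d)).
- by move=> g -> e _; exact: smooth_time.
- move=> g ->; exists T; near=> e => z /andP[z0 zT].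
  by rewrite ger0_norm.
- move=> g i ->; exists (fun _ _ => ((ord0 : 'I_d.+1) == i)%:R).
    by apply: NAbounded; exact: bounded_net_cst.
  by move=> e _ z; exact: (@derive_val _ _ _ _ _ _ _ (is_derive_coord i ord0 z)).
- exact: NAgen.
Unshelve. all: by end_near. Qed.

Lemma bounded_net_comp (f : R -> R) w : smooth_fun f -> bounded_net w ->
  bounded_net (fun e z => f (w e z)).
Proof.
move=> fs wb; have [ws wB] := wb.
apply: (@bounded_net_alg (fun g => exists k, g = fun e z => derive1n k f (w e z))).
- move=> g [k ->] e e01; apply: (smooth_on_comp openT _ (ws e e01)).
  by move=> n x; rewrite /derive1n -iterD; exact: (fs (n + k)%N).
- move=> g [k ->]; have [C wC] := wB [::].
  have [M M0 fM] := continuous_bounded_on C (@smooth_fun_continuous R f k fs).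
  by exists M; apply: filterS wC => e wC z Sz; apply: fM; exact: wC.
- move=> g i [k ->]; exists (fun e z => derive1n k.+1 f (w e z) * partial i (w e) z).
    apply: NAmul; first by apply: NAgen; exists k.+1.
    by apply: NAbounded; exact: bounded_net_partial.
  move=> e e01 z.
  have D := is_derive_comp_dir (smooth_fun_is_derive k (w e z) fs)
    (smooth_on_is_derive i (ws e e01) (I : setT z)).
  exact: (@derive_val _ _ _ _ _ _ _ D).
- by apply: NAgen; exists 0%N.
Qed.

Lemma bounded_on_cone_dom (c : R * (R * R) -> R) : continuous c ->
  exists2 C : R, 0 <= C & forall q, cone_dom q -> `|c q| <= C.
Proof.
move=> cc; have cD := cf_compact (@cfunctional_cone R).
have [D0|/set0P D0] := eqVneq (@cone_dom R) set0.
  by exists 0 => // q; rewrite D0.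
have [|q _ qmax] := @compact_EVT_max _ R (fun q => `|c q|) _ D0 cD.
  apply: continuous_subspaceT; apply: continuous_pointwise => x.
  by apply: (@continuous_comp _ _ _ c); [exact: cc|exact: norm_continuous].
by exists `|c q| => // y Dy; apply: qmax; rewrite inE.
Qed.

Lemma bounded_net_cone_av (c : R * (R * R) -> R) w : continuous c -> bounded_net w ->
  bounded_net (fun e => cone_av c (w e)).
Proof.
move=> cc wb.
apply: (@bounded_net_alg (fun g => exists c w,
   [/\ continuous c, bounded_net w & g = fun e => cone_av c (w e)])).
- move=> _ [k [h [kc [hs _] ->]]] e e01.
  by apply: smooth_cone_av kc (hs e e01).
- move=> _ [k [h [kc [hs hb] ->]]].
  have [C C0 kC] := bounded_on_cone_dom kc; have [D hD] := hb [::].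
  exists ((1 - 0) * (@sph_cst R) * (C * D)); near=> e => z Sz.
  have e01 : 0 < e <= 1 by near: e; exact: near0_01.
  apply: (cone_av_bound kc (hs e e01) kC _ Sz).
  by near: e; exact: hD.
- move=> _ i [k [h [kc hb ->]]]; have [hs _] := hb; move: i; apply: ord_cases => [|i].
    exists (fun e z => cone_av (fun q => k q * (1 - q.1)) (partial ord0 (h e)) z +
      \sum_(i < d) cone_av (fun q => k q * q.1 * omega i q.2) (partial (li i) (h e)) z).
      apply: NAadd.
        apply: NAgen; exists (fun q => k q * (1 - q.1)), (fun e => partial ord0 (h e)).
        split; [|exact: bounded_net_partial|by []].
        apply: continuous_mul kc _.
        by apply: continuous_sub; [exact: continuous_const|exact: continuous_fst3].
      apply: net_alg_sum => i; apply: NAgen.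
      exists (fun q => k q * q.1 * omega i q.2), (fun e => partial (li i) (h e)).
      split; [|exact: bounded_net_partial|by []].
      apply: continuous_mul; first exact: continuous_mul kc (@continuous_fst3 R).
      by apply: continuous_ang3; exact: omega_continuous.
    move=> e e01 z.
    exact: (@derive_val _ _ _ _ _ _ _ (is_derive_cone_av_time z kc (hs e e01))).
  exists (fun e => cone_av k (partial (li i) (h e))).
    apply: NAgen; exists k, (fun e => partial (li i) (h e)).
    by split; [exact: kc|exact: bounded_net_partial|].
  move=> e e01 z.
  exact: (@derive_val _ _ _ _ _ _ _ (is_derive_cone_av_lift i z kc (hs e e01))).
- by apply: NAgen; exists c, w.
Unshelve. all: by end_near. Qed.

Lemma bounded_net_duhamel w : bounded_net w -> bounded_net (fun e => duhamel (w e)).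
Proof.
move=> wb; apply: bounded_netM; first exact: bounded_net_cst.
apply: bounded_netM; last exact: bounded_net_cone_av (@continuous_duh_wt R) wb.
exact: bounded_netM bounded_net_time bounded_net_time.
Qed.

Lemma bounded_net_space (u : R -> 'rV[R]_d -> R) :
  (forall e, 0 < e <= 1 -> smooth_on setT (u e)) ->
  (forall s : seq 'I_d, exists C : R, \forall e \near (0 : R)^'+, forall x, `|partials s (u e) x| <= C) ->
  bounded_net (fun e z => u e (space z)).
Proof.
move=> us ub.
apply: (@bounded_net_alg (fun g => exists s : seq 'I_d, g = fun e z => partials s (u e) (space z))).
- by move=> _ [s ->] e e01; apply: smooth_on_space; apply: smooth_on_partials; exact: us.
- by move=> _ [s ->]; have [C uC] := ub s; exists C; apply: filterS uC => e uC z _.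
- move=> _ i [s ->]; move: i; apply: ord_cases => [|i].
    exists (fun _ _ => 0); first by apply: NAbounded; exact: bounded_net_cst.
    move=> e _ z; exact: (@derive_val _ _ _ _ _ _ _ (is_derive_space_time (partials s (u e)) z)).
  exists (fun e z => partials (i :: s) (u e) (space z)); first by apply: NAgen; exists (i :: s).
  move=> e e01 z.
  have D := smooth_on_is_derive i (smooth_on_partials s (us e e01)) (I : setT (space z)).
  exact: (@derive_val _ _ _ _ _ _ _ (is_derive_space_lift D)).
- by apply: NAgen; exists [::].
Qed.

Definition duhamel_cst : R := (sph_int (fun p : R * R => sin p.1))^-1 *
  (T ^+ 2 * ((1 - 0) * (@sph_cst R))).

Lemma duhamel_cst_ge0 : 0 <= duhamel_cst.
Proof.
rewrite mulr_ge0 ?invr_ge0 ?(ltW sph_int_sin_gt0)// mulr_ge0 ?sqr_ge0// subr0 mul1r.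
exact: cf_ge0 (@cfunctional_sph R).
Qed.

Lemma duhamel_bound (F : E -> R) (M : R) z : smooth_on setT F ->
  (forall y, slab T y -> `|F y| <= M) -> slab T z -> `|duhamel F z| <= duhamel_cst * M.
Proof.
move=> Fs FM Sz; have [z0 zT] := andP Sz.
have w1 (q : R * (R * R)) : cone_dom q -> `|duh_wt q| <= 1.
  case=> /= + _; rewrite in_itv /= => /andP[q0 q1].
  rewrite /duh_wt normrM; apply: mulr_ile1 => //; first by rewrite ger0_norm.
  by rewrite ler_norml sin_geN1 sin_le1.
have := cone_av_bound (@continuous_duh_wt R) Fs w1 FM Sz; rewrite mul1r => H.
have N0 := @sph_int_sin_gt0 R.
rewrite /duhamel /duhamel_cst -[leRHS]mulrA normrM (@ger0_norm _ _^-1) ?invr_ge0 ?(ltW N0)//.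
apply: ler_wpM2l; first by rewrite invr_ge0 ltW.
rewrite -[leRHS]mulrA normrM; apply: ler_pM => //.
rewrite ger0_norm ?sqr_ge0//.
by rewrite ler_pXn2r ?nnegrE ?(ltW T0).
Qed.

Lemma duhamel_sub (F G : E -> R) z : smooth_on setT F -> smooth_on setT G ->
  duhamel F z - duhamel G z = duhamel (fun y => F y - G y) z.
Proof.
move=> Fs Gs; rewrite /duhamel -!mulrBr; congr (_ * (_ * _)).
have sl H : smooth_on setT H -> continuous (fun q => duh_wt q * H (cpt z q)).
  move=> Hs; exact: (@slice_continuous _ _ _
    (fun x : E * (R * (R * R)) => duh_wt x.2 * H (cpt x.1 x.2)) z
    (continuous_av (@continuous_duh_wt R) Hs)).
rewrite /cone_av -(cfB (@cfunctional_cone R) (sl _ Fs) (sl _ Gs)).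
by congr cone_int; apply/funext => q; rewrite mulrBr.
Qed.

End BoundedNets.

(** * Initial data with compact support *)

Section InitialData.
Context {R : realType} {n : nat}.

Lemma partials_cst0 s x : partials s (fun _ : 'rV[R]_n => 0 : R) x = 0.
Proof.
elim: s x => [//|i s IH] x /=.
rewrite (_ : partials s _ = fun=> 0); last by apply/funext.
exact: (@derive_val _ _ _ _ _ _ _ (is_derive_cst (0 : R) x (delta_mx ord0 i))).
Qed.

Lemma partials_tsupport (u : 'rV[R]_n -> R) s x : ~ tsupport u x -> partials s u x = 0.
Proof.
move=> ux; rewrite -(partials_cst0 s x); apply: (@partials_eq_on _ _ (~` tsupport u)) => //.
  by apply: closed_openC; exact: closed_closure.
move=> y uy; apply: contrapT => y0; apply: uy; apply: subset_closure.
exact/eqP.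
Qed.

(** The derivatives vanish off the support, so a bound on the ball holds everywhere. The compact
    support also makes the supremum over the ball finite, without which [sup] would give no
    bound. *)
Lemma data_bound (u : R -> 'rV[R]_n -> R) (r : R) :
  (forall eps : R, 0 < eps <= 1 ->
     [/\ smooth_on setT (u eps), compact (tsupport (u eps))
       & tsupport (u eps) `<=` origin_ball r]) ->
  (forall a : multi_index n,
     (fun eps : R => sup_abs (origin_ball r) (mderiv a (u eps))) =O_ (0^'+) (cst 1 : R -> R)) ->
  forall s, exists C : R, \forall e \near (0 : R)^'+, forall x, `|partials s (u e) x| <= C.
Proof.
move=> hu bu s; have /eqO_exP[C C0 uC] := bu (mi s); exists C; near=> e => x.
have e01 : 0 < e <= 1 by near: e; exact: near0_01.
have [us cu su] := hu e e01.
have [ux|ux] := pselect (tsupport (u e) x); last by rewrite partials_tsupport// normr0 ltW.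
apply: le_trans (_ : `|sup_abs (origin_ball r) (mderiv (mi s) (u e))| <= _); last first.
  have : `|sup_abs (origin_ball r) (mderiv (mi s) (u e))| <= C * `|cst 1 e : R|.
    by near: e; exact: uC.
  by rewrite /= normr1 mulr1.
apply: le_trans (ler_norm _).
have us' := smooth_on_partials s us.
have [|c _ cmax] := @compact_EVT_max _ R (fun x => `|partials s (u e) x|) _ (ex_intro _ x ux) cu.
  apply: continuous_subspaceT; apply: continuous_pointwise => y.
  apply: (@continuous_comp _ _ _ (partials s (u e))); last exact: norm_continuous.
  exact: smooth_on_cont us' I.
rewrite -(mderiv_mi s openT us (I : setT x)); apply: ub_le_sup; last by exists x => //; exact: su.
exists `|partials s (u e) c| => _ [y _ <-].
rewrite (mderiv_mi s openT us (I : setT y)).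
have [uy|uy] := pselect (tsupport (u e) y); last by rewrite partials_tsupport// normr0.
by apply: cmax; rewrite inE.
Unshelve. all: by end_near. Qed.

End InitialData.

(* A net index growing to infinity slowly enough to keep each eventual property. *)
Lemma diagonal_index (R : realType) (P : nat -> R -> Prop) :
  (forall N, \forall e \near (0 : R)^'+, P N e) ->
  exists nu : R -> nat, forall N, \forall e \near (0 : R)^'+, (N <= nu e)%N /\ P (nu e) e.
Proof.
move=> PN.
have /choice[nu nuP] : forall e : R, exists k, forall N, N%:R <= e^-1 -> P N e ->
    (N <= k)%N /\ P k e.
  move=> e; have [[N0 [N0e PN0]]|nex] := pselect (exists N, N%:R <= e^-1 /\ P N e); last first.
    by exists 0%N => N Ne PNe; exfalso; apply: nex; exists N.
  (* The index is the largest N <= 1 / eps with P N eps: the cap makes the maximum exist and tends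
     to infinity, so any given N is eventually exceeded. *)
  pose Q N := `[< N%:R <= e^-1 /\ P N e >].
  have [b eb] := exists_nat_ge e^-1.
  have QN : exists N, Q N by exists N0; apply/asboolP.
  have Qb N : Q N -> (N <= b)%N.
    by move=> /asboolP[Ne _]; rewrite -(ler_nat R); exact: le_trans Ne eb.
  case: (ex_maxnP QN Qb) => k /asboolP[ke Pk] kmax; exists k => N Ne PNe; split => //.
  by apply: kmax; apply/asboolP.
exists nu => N; near=> e.
have [e0 eN] : 0 < e /\ e < N.+1%:R^-1.
  by apply/andP; near: e; apply: near0_lt; rewrite invr_gt0.
apply: nuP; last by near: e; exact: PN.
rewrite -[e^-1]mul1r ler_pdivlMr//.
apply: le_trans (_ : N.+1%:R * e <= _); first by rewrite ler_pM2r// ler_nat.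
by rewrite mulrC -ler_pdivlMr// div1r ltW.
Unshelve. all: by end_near. Qed.

(** * Smallness of the factor e *)

Section Coupling.
Context {R : realType}.
Variable e : R -> R.
Hypothesis he : exists2 b : R, 0 < b & Opow (fun eps : R => `|e eps|) b.

Lemma coupling_small (D : R) : 0 < D -> \forall eps \near (0 : R)^'+, `|e eps| <= D.
Proof.
move=> D0; have [b b0 /OpowP[C C0 eC]] := he.
pose c := (D / C) `^ (b^-1).
have DC : 0 < D / C by rewrite divr_gt0.
have c0 : 0 < c by rewrite powR_gt0.
near=> eps.
have /andP[e0 ec] : 0 < eps < c by near: eps; exact: near0_lt.
have H : Num.norm `|e eps| <= C * eps `^ b by near: eps; exact: eC.
rewrite normr_id in H; apply: le_trans H _.
have H : eps `^ b <= D / C.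
  have -> : D / C = c `^ b by rewrite /c -powRrM mulVf ?gt_eqF// powRr1// ltW.
  by rewrite ge0_ler_powR ?nnegrE ?ltW.
by rewrite mulrC -ler_pdivlMr.
Unshelve. all: by end_near. Qed.

Lemma coupling_pow N : exists n, forall C : R,
  \forall eps \near (0 : R)^'+, C * `|e eps| ^+ n <= eps ^+ N.
Proof.
have [b b0 /OpowP[D D0 eD]] := he.
(* n b >= N + 1 makes |e|^n of order eps^(N + 1); the extra power absorbs D^n and every C, so that n
   does not depend on C. *)
have [n bn] := exists_nat_ge (N.+1%:R / b).
exists n => C; near=> eps.
have e01 : 0 < eps <= 1 by near: eps; exact: near0_01.
have [e0 e1] := andP e01.
apply: le_trans (_ : (`|C| * D ^+ n) * eps ^+ N.+1 <= _); last by near: eps; exact: near0_absorb.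
have H : Num.norm `|e eps| <= D * eps `^ b by near: eps; exact: eD.
rewrite normr_id in H.
apply: le_trans (_ : `|C| * (D * eps `^ b) ^+ n <= _).
  apply: le_trans (_ : `|C| * `|e eps| ^+ n <= _).
    by rewrite ler_wpM2r ?exprn_ge0// ler_norm.
  rewrite ler_wpM2l// lerXn2r ?nnegrE// mulr_ge0 ?powR_ge0// ltW//.
rewrite exprMn -mulrA ler_wpM2l// ler_wpM2l ?exprn_ge0 ?(ltW D0)//.
rewrite -(powR_mulrn n (powR_ge0 eps b)) -powRrM -powR_nat ?(ltW e0)//.
apply: ger_powR; first by rewrite e0.
by rewrite mulrC -ler_pdivrMr.
Unshelve. all: by end_near. Qed.

End Coupling.

(** * Existence *)

Section Existence.
Context {R : realType} {d : nat}.
Variables (T : R) (f : R -> R) (e : R -> R) (u0 u1 : R -> 'rV[R]_d -> R).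
Hypotheses (d3 : (d <= 3)%N) (T0 : 0 < T) (fs : smooth_fun f).
Hypothesis he : exists2 b : R, 0 < b & Opow (fun eps : R => `|e eps|) b.
Hypotheses (u0s : forall eps : R, 0 < eps <= 1 -> smooth_on setT (u0 eps))
  (u1s : forall eps : R, 0 < eps <= 1 -> smooth_on setT (u1 eps)).
Hypotheses (u0b : forall s, exists C : R, \forall eps \near (0 : R)^'+, forall x, `|partials s (u0 eps) x| <= C)
  (u1b : forall s, exists C : R, \forall eps \near (0 : R)^'+, forall x, `|partials s (u1 eps) x| <= C).
Local Notation E := 'rV[R]_d.+1.

Definition picard0 (eps : R) (z : E) : R := u0 eps (space z) + time z * u1 eps (space z).

Definition picard_source (w : R -> E -> R) (eps : R) (z : E) : R :=
  e eps * f (w eps z) - box (picard0 eps) z.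

Fixpoint picard n : R -> E -> R :=
  if n is n'.+1 then fun eps z => picard0 eps z + duhamel (picard_source (picard n') eps) z
  else picard0.

Lemma bounded_net_picard0 : bounded_net T picard0.
Proof.
exact: bounded_netD (bounded_net_space T u0s u0b)
  (bounded_netM (bounded_net_time T) (bounded_net_space T u1s u1b)).
Qed.

Lemma bounded_net_source w : bounded_net T w -> bounded_net T (picard_source w).
Proof.
move=> wb; apply: bounded_netB.
  apply: bounded_netM; last exact: bounded_net_comp.
  exact: bounded_net_const (coupling_small he ltr01).
apply: bounded_net_box; exact: bounded_net_picard0.
Qed.

Lemma bounded_net_picard n : bounded_net T (picard n).
Proof.
elim: n => [|n IH]; first exact: bounded_net_picard0.
apply: bounded_netD; first exact: bounded_net_picard0.
by apply: bounded_net_duhamel => //; exact: bounded_net_source.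
Qed.

Lemma smooth_picard0 eps : 0 < eps <= 1 -> smooth_on setT (picard0 eps).
Proof. by have [ws _] := bounded_net_picard0; exact: ws. Qed.

Lemma smooth_picard n eps : 0 < eps <= 1 -> smooth_on setT (picard n eps).
Proof. by have [ws _] := bounded_net_picard n; exact: ws. Qed.

Lemma smooth_source n eps : 0 < eps <= 1 -> smooth_on setT (picard_source (picard n) eps).
Proof. by have [ws _] := bounded_net_source (bounded_net_picard n); exact: ws. Qed.

Lemma box_add (F G : E -> R) z : smooth_on setT F -> smooth_on setT G ->
  box (fun z => F z + G z) z = box F z + box G z.
Proof.
move=> Fs Gs.
have H i : partial i (partial i (fun z => F z + G z)) z =
   partial i (partial i F) z + partial i (partial i G) z.
  exact: (partials_add [:: i; i] openT Fs Gs (I : setT z)).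
have L : lap (fun z => F z + G z) z = lap F z + lap G z.
  by rewrite /lap -big_split; apply: eq_bigr => i _; exact: H.
by rewrite {1}/box (H ord0) L opprD addrACA.
Qed.

Lemma box_picard n eps z : 0 < eps <= 1 ->
  box (picard n.+1 eps) z = e eps * f (picard n eps z).
Proof.
move=> e01; rewrite (box_add _ (smooth_picard0 e01)); last exact: smooth_duhamel (smooth_source n e01).
by rewrite (box_duhamel d3 (smooth_source n e01)) /picard_source addrC subrK.
Qed.

Lemma picard_init n eps z : 0 < eps <= 1 -> time z = 0 ->
  picard n eps z = u0 eps (space z) /\ partial ord0 (picard n eps) z = u1 eps (space z).
Proof.
move=> e01 z0.
have I0 : picard0 eps z = u0 eps (space z) by rewrite /picard0 z0 mul0r addr0.
have D0 : is_derive z 'e_ord0 (picard0 eps) (u1 eps (space z)).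
  have Dt : is_derive z 'e_ord0 (@time R d) 1.
    by have := is_derive_coord (ord0 : 'I_d.+1) ord0 z; rewrite eqxx.
  have := is_derive_add (is_derive_space_time (u0 eps) z)
    (is_derive_mul Dt (is_derive_space_time (u1 eps) z)).
  by rewrite mulr0 mul1r addr0 add0r.
case: n => [|n] /=; first by split => //; exact: (@derive_val _ _ _ _ _ _ _ D0).
have Ss := smooth_source n e01.
split; first by rewrite duhamel_time0// addr0.
have D1 := smooth_on_is_derive ord0 (smooth_duhamel Ss) (I : setT z).
rewrite (partial_duhamel_time0 Ss z0) in D1.
have D := is_derive_add D0 D1; rewrite addr0 in D.
exact: (@derive_val _ _ _ _ _ _ _ D).
Qed.

(** The sources of consecutive iterates differ by e (f(w_(n+1)) - f(w_n)), so each step gains a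
    factor |e|. The Lipschitz constant is taken on the range of these two iterates; C may grow with
    n. *)
Lemma picard_step n : exists2 C : R, 0 <= C & \forall eps \near (0 : R)^'+,
  forall z, slab T z -> `|picard n.+1 eps z - picard n eps z| <= C * `|e eps| ^+ n.
Proof.
elim: n => [|n [C C0 IH]].
  have [_ /(_ [::])[C wC]] := bounded_netB (bounded_net_picard 1) (bounded_net_picard 0).
  exists `|C| => //; apply: filterS wC => eps wC z Sz.
  by rewrite expr0 mulr1; apply: le_trans (wC z Sz) (ler_norm _).
have [_ /(_ [::])[D0 pD0]] := bounded_net_picard n.
have [_ /(_ [::])[D1 pD1]] := bounded_net_picard n.+1.
have [L L0 fL] := smooth_fun_lipschitz (Num.max D0 D1) fs.
exists (duhamel_cst T * (L * C)); first by rewrite mulr_ge0 ?duhamel_cst_ge0// mulr_ge0.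
near=> eps => z Sz.
have e01 : 0 < eps <= 1 by near: eps; exact: near0_01.
have -> : picard n.+2 eps z - picard n.+1 eps z =
   duhamel (fun y => picard_source (picard n.+1) eps y - picard_source (picard n) eps y) z.
  rewrite -(duhamel_sub _ (smooth_source n.+1 e01) (smooth_source n e01)) /=.
  by rewrite opprD addrACA subrr add0r.
rewrite -mulrA; apply: (duhamel_bound T0 _ _ Sz).
  exact: (smooth_onB openT (smooth_source n.+1 e01) (smooth_source n e01)).
move=> y Sy.
have -> : picard_source (picard n.+1) eps y - picard_source (picard n) eps y =
    e eps * (f (picard n.+1 eps y) - f (picard n eps y)).
  rewrite /picard_source; move: (box _ _) (f _) (f _) (e eps) => a b c k; ring.
rewrite normrM exprS [leRHS]mulrCA; apply: ler_wpM2l => //.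
apply: le_trans (_ : L * `|picard n.+1 eps y - picard n eps y| <= _).
  apply: fL; rewrite le_max; apply/orP.
    by right; move: y Sy; near: eps; exact: pD1.
  by left; move: y Sy; near: eps; exact: pD0.
rewrite -mulrA; apply: ler_wpM2l => //.
by move: y Sy; near: eps; exact: IH.
Unshelve. all: by end_near. Qed.

Definition residual n eps z := box (picard n eps) z - e eps * f (picard n eps z).

Lemma bounded_net_residual n : bounded_net T (residual n).
Proof.
apply: bounded_netB; first exact: bounded_net_box (bounded_net_picard n).
apply: bounded_netM; last exact: bounded_net_comp (bounded_net_picard n).
exact: bounded_net_const (coupling_small he ltr01).
Qed.

(** Since box w_(n+1) = e f(w_n), the residual is e (f(w_n) - f(w_(n+1))). *)
Lemma residual_small n : exists C : R, \forall eps \near (0 : R)^'+,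
  forall z, slab T z -> `|residual n.+1 eps z| <= C * `|e eps| ^+ n.
Proof.
have [C C0 wC] := picard_step n.
have [_ /(_ [::])[D0 pD0]] := bounded_net_picard n.
have [_ /(_ [::])[D1 pD1]] := bounded_net_picard n.+1.
have [L L0 fL] := smooth_fun_lipschitz (Num.max D0 D1) fs.
exists (L * C); near=> eps => z Sz.
have e01 : 0 < eps <= 1 by near: eps; exact: near0_01.
have e1 : `|e eps| <= 1 by near: eps; exact: (coupling_small he).
rewrite /residual box_picard// -mulrBr normrM distrC.
(* The outer factor |e| is just bounded by 1; the power |e|^n of the step is enough. *)
apply: le_trans (_ : 1 * (L * `|picard n.+1 eps z - picard n eps z|) <= _).
  apply: ler_pM => //; apply: fL; rewrite le_max; apply/orP.
    by right; move: z Sz; near: eps; exact: pD1.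
  by left; move: z Sz; near: eps; exact: pD0.
rewrite mul1r -mulrA; apply: ler_wpM2l => //.
by move: z Sz; near: eps; exact: wC.
Unshelve. all: by end_near. Qed.

Lemma residual_order N : exists n, \forall eps \near (0 : R)^'+,
  forall z, slab T z -> `|residual n eps z| <= eps ^+ N.
Proof.
have [n nP] := coupling_pow he N; have [C rC] := residual_small n; exists n.+1.
near=> eps => z Sz; apply: le_trans (_ : C * `|e eps| ^+ n <= _).
  by move: z Sz; near: eps; exact: rC.
by near: eps; exact: nP.
Unshelve. all: by end_near. Qed.

Lemma bounded_net_moderate (w : R -> E -> R) s : bounded_net T w -> \forall eps \near (0 : R)^'+,
  forall z, slab T z -> `|partials s (w eps) z| <= eps^-1.
Proof.
move=> [_ /(_ s)[C wC]]; near=> eps => z Sz.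
have e0 : 0 < eps by [].
apply: le_trans (_ : C <= _); first by move: z Sz; near: eps; exact: wC.
rewrite -[eps^-1]mul1r ler_pdivlMr// -(expr1 eps) -(expr0 eps).
by near: eps; exact: (@near0_absorb R C 0).
Unshelve. all: by end_near. Qed.

Theorem existence : exists u : R -> E -> R, moderate T u /\ solves T f e u0 u1 u.
Proof.
have /choice[nn nnP] := residual_order.
(* Finitely many conditions for each N: the derivatives with code below N are at most 1 / eps, which
   absorbs constants depending on N, and the residual is at most eps^N. Every s is covered once N
   exceeds its code. *)
pose P N eps := (forall s : seq 'I_d.+1, (pickle s < N)%N -> forall z, slab T z ->
   `|partials s (picard (nn N) eps) z| <= eps^-1 /\
   `|partials s (residual (nn N) eps) z| <= eps^-1) /\
   forall z, slab T z -> `|residual (nn N) eps z| <= eps ^+ N.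
have PN N : \forall eps \near (0 : R)^'+, P N eps.
  (* Ranging over codes i < N turns the condition into a finite conjunction, for which eventual
     properties can be intersected. *)
  pose Q (i : 'I_N) (eps : R) : Prop := if (unpickle i : option (seq 'I_d.+1)) is Some s then
    forall z, slab T z -> `|partials s (picard (nn N) eps) z| <= eps^-1 /\
      `|partials s (residual (nn N) eps) z| <= eps^-1 else True.
  have QN : \forall eps \near (0 : R)^'+, forall i, Q i eps.
    apply: (@filter_forall _ _ Q _ (at_right_proper_filter (0 : R))) => i; rewrite /Q.
    case: (unpickle i) => [s|]; last by near=> eps.
    near=> eps => z Sz; split; move: z Sz; near: eps.
      exact: bounded_net_moderate (bounded_net_picard _).
    exact: bounded_net_moderate (bounded_net_residual _).
  near=> eps; split; last by near: eps; exact: nnP.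
  move=> s sN; have : Q (Ordinal sN) eps by move: (Ordinal sN); near: eps; exact: QN.
  by rewrite /Q -[nat_of_ord (Ordinal sN)]/(pickle s) pickleK.
have [nu nuP] := diagonal_index PN.
pose u eps := picard (nn (nu eps)) eps; pose m eps := residual (nn (nu eps)) eps.
have us eps : 0 < eps <= 1 -> smooth_on setT (u eps) by move=> e01; exact: smooth_picard.
have ms eps : 0 < eps <= 1 -> smooth_on setT (m eps).
  by move=> e01; have [ws _] := bounded_net_residual (nn (nu eps)); exact: ws.
have ub s : \forall eps \near (0 : R)^'+, forall z, slab T z ->
    `|partials s (u eps) z| <= eps^-1 /\ `|partials s (m eps) z| <= eps^-1.
  have H := nuP (pickle s).+1; near=> eps => z Sz.
  have [sn [H1 _]] : ((pickle s).+1 <= nu eps)%N /\ P (nu eps) eps by near: eps; exact: H.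
  exact: H1.
have Su : smooth_net T u by move=> eps /us; exact: smooth_slab_global.
have Sm : smooth_net T m by move=> eps /ms; exact: smooth_slab_global.
have um : moderate T u.
  apply: moderate_of => // s; exists 1%N; have H := ub s.
  rewrite /moderate_deriv; near=> eps => z /open_slab_slab Sz.
  rewrite expr1; have [//] : `|partials s (u eps) z| <= eps^-1 /\
     `|partials s (m eps) z| <= eps^-1 by move: z Sz; near: eps; exact: H.
have mv : vanishing T m.
  apply: vanishing_of => //; apply: interpolation_net => //.
  - by move=> eps /Sm [].
  - move=> s; exists 1%N; have H := ub s.
    rewrite /moderate_deriv; near=> eps => z /open_slab_slab Sz.
    rewrite expr1; have [//] : `|partials s (u eps) z| <= eps^-1 /\
       `|partials s (m eps) z| <= eps^-1 by move: z Sz; near: eps; exact: H.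
  - move=> k; have H := nuP k; rewrite /small_deriv; near=> eps => z /open_slab_slab Sz.
    have [e0 e1] : 0 < eps /\ eps <= 1 by apply/andP; near: eps; exact: near0_01.
    have [kn [_ H1]] : (k <= nu eps)%N /\ P (nu eps) eps by near: eps; exact: H.
    by apply: le_trans (H1 z Sz) _; rewrite ler_wiXn2l// ltW.
exists u; split => //; exists m; split => // eps e01.
have ue := us _ e01; have me := ms _ e01.
have Sz0 z : time z = 0 -> slab T z by move=> z0; rewrite /slab /= z0 lexx ltW.
split.
- move=> z Sz; rewrite pderiv_extE laplacianE !val_extE !xt_global//.
  rewrite (eq_bigr (fun i => partial (li i) (partial (li i) (u eps)) z)); last first.
    by move=> i _; rewrite xt_global.
  by rewrite -/(lap _ _) -/(box _ _) /m /residual /= addrC subrK.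
- move=> z z0; rewrite val_extE xt_global//; last exact: Sz0.
  by have [H _] := picard_init (nn (nu eps)) e01 z0; exact: H.
- move=> z z0; rewrite pderiv_extE xt_global//; last exact: Sz0.
  by have [_ H] := picard_init (nn (nu eps)) e01 z0; exact: H.
Unshelve. all: by end_near. Qed.

End Existence.

(** * Uniqueness *)

Section ChainRuleNets.
Context {R : realType} {d : nat}.
Variables (T : R) (f : R -> R) (u : R -> 'rV[R]_d.+1 -> R).
Local Notation E := 'rV[R]_d.+1.
Implicit Types (s : seq 'I_d.+1) (g h : R -> E -> R).
Local Notation O := (@open_slab R d T).
Local Notation oO := (@open_open_slab R d T).
Hypotheses (fs : smooth_fun f) (us : smooth_net_on T u).

(* Polynomials in the f^(k)(u) and in the derivatives of u indexed by A. *)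
Inductive chain_poly (A : seq 'I_d.+1 -> Prop) : (R -> E -> R) -> Prop :=
  | CPcst (c : R) : chain_poly A (fun _ _ => c)
  | CPf k : chain_poly A (fun eps z => derive1n k f (u eps z))
  | CPd s of A s : chain_poly A (fun eps => partials s (u eps))
  | CPadd g h of chain_poly A g & chain_poly A h :
      chain_poly A (fun eps z => g eps z + h eps z)
  | CPmul g h of chain_poly A g & chain_poly A h :
      chain_poly A (fun eps z => g eps z * h eps z).

Lemma chain_poly_sub (A B : seq 'I_d.+1 -> Prop) g : (forall s, A s -> B s) ->
  chain_poly A g -> chain_poly B g.
Proof.
move=> AB; elim=> {g} [c|k|s As|g h _ gB _ hB|g h _ gB _ hB].
- exact: CPcst.
- exact: CPf.
- by apply: CPd; exact: AB.
- exact: CPadd.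
- exact: CPmul.
Qed.

(** Differentiating f^(k)(u) creates the factor d_i u, whence the condition [B [:: i]]. *)
Lemma chain_poly_derive (A B : seq 'I_d.+1 -> Prop) i g : (forall s, A s -> B s) ->
  (forall s, A s -> B (i :: s)) -> B [:: i] -> chain_poly A g ->
  exists2 g', chain_poly B g' & forall eps, 0 < eps <= 1 -> forall z, O z ->
    is_derive z 'e_i (g eps) (g' eps z).
Proof.
move=> AB AiB Bi; elim=> {g} [c|k|s As|g h gA [g' gB dg] hA [h' hB dh]|g h gA [g' gB dg] hA [h' hB dh]].
- exists (fun _ _ => 0); first exact: CPcst.
  by move=> eps _ z _; exact: is_derive_cst.
- exists (fun eps z => derive1n k.+1 f (u eps z) * partials [:: i] (u eps) z).
    exact: CPmul (CPf B k.+1) (CPd Bi).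
  move=> eps e01 z Oz.
  exact: (is_derive_comp_dir (smooth_fun_is_derive k (u eps z) fs)
    (smooth_on_is_derive i (us e01) Oz)).
- exists (fun eps => partials (i :: s) (u eps)); first by apply: CPd; exact: AiB.
  move=> eps e01 z Oz.
  exact: (smooth_on_is_derive i (smooth_on_partials s (us e01)) Oz).
- exists (fun eps z => g' eps z + h' eps z); first exact: CPadd.
  by move=> eps e01 z Oz; exact: is_derive_add (dg eps e01 z Oz) (dh eps e01 z Oz).
- exists (fun eps z => g' eps z * h eps z + g eps z * h' eps z).
    by apply: CPadd; apply: CPmul => //; exact: chain_poly_sub AB _.
  by move=> eps e01 z Oz; exact: is_derive_mul (dg eps e01 z Oz) (dh eps e01 z Oz).
Qed.

(** Proper subsequences, not merely shorter sequences: if s is purely spatial, so are they, which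
    keeps the induction within spatial derivatives. *)
Definition lower s s' := subseq s' s /\ (size s' < size s)%N.

(* The highest derivative occurs linearly, so that it can be absorbed once the
   equation has a small factor in front of f(u). *)
Lemma partials_comp s : s != [::] -> exists2 g, chain_poly (lower s) g &
  forall eps, 0 < eps <= 1 -> forall z, O z ->
    partials s (fun y => f (u eps y)) z =
      derive1n 1 f (u eps z) * partials s (u eps) z + g eps z.
Proof.
elim: s => [//|i s IH] _; have [->|s0] := eqVneq s [::].
  exists (fun _ _ => 0); first exact: CPcst.
  move=> eps e01 z Oz; rewrite addr0 /=.
  have D := is_derive_comp_dir (smooth_fun_is_derive 0 (u eps z) fs)
    (smooth_on_is_derive i (us e01) Oz).
  exact: (@derive_val _ _ _ _ _ _ _ D).
have [g gA gE] := IH s0.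
have sz : (0 < size s)%N by rewrite lt0n size_eq0.
have [|||g' gB dg] := @chain_poly_derive (lower s) (lower (i :: s)) i g _ _ _ gA.
- by move=> s' [ss' zs']; split; [exact: subseq_trans ss' (subseq_cons _ _)|exact: ltnW].
- by move=> s' [ss' zs']; split; [rewrite /= eqxx|].
- by split => //=; rewrite eqxx sub0seq.
(* The product rule on f'(u) d_s u keeps f'(u) in front of the new top derivative; the other term
   contains only d_i u and d_s u, both lower. *)
exists (fun eps z => derive1n 2 f (u eps z) * partials [:: i] (u eps) z * partials s (u eps) z +
  g' eps z).
  have B1 : lower (i :: s) [:: i] by split => //=; rewrite eqxx sub0seq.
  have Bs : lower (i :: s) s by split => //; exact: subseq_cons.
  exact: CPadd (CPmul (CPmul (CPf _ 2) (CPd B1)) (CPd Bs)) gB.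
move=> eps e01 z Oz /=.
rewrite (@partial_near _ _ i _ (fun z => derive1n 1 f (u eps z) * partials s (u eps) z + g eps z)).
  have D := is_derive_add (is_derive_mul (is_derive_comp_dir (smooth_fun_is_derive 1 (u eps z) fs)
    (smooth_on_is_derive i (us e01) Oz)) (smooth_on_is_derive i (smooth_on_partials s (us e01)) Oz))
    (dg eps e01 z Oz).
  rewrite [LHS](@derive_val _ _ _ _ _ _ _ D) addrA; congr (_ + _).
  by rewrite addrC.
by apply: near_eq_on oO Oz _ => y Oy; exact: gE.
Qed.

Lemma chain_poly_bounded A g : bounded_deriv T u [::] ->
  (forall s, A s -> bounded_deriv T u s) -> chain_poly A g ->
  exists C : R, \forall eps \near (0 : R)^'+, forall z, O z -> `|g eps z| <= C.
Proof.
move=> u0 uA; elim=> {g} [c|k|s /uA//|g h _ [C gC] _ [D hD]|g h _ [C gC] _ [D hD]].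
- by exists `|c|; near=> eps.
- have [C uC] := u0; have [M M0 fM] := continuous_bounded_on C (@smooth_fun_continuous R f k fs).
  by exists M; apply: filterS uC => eps uC z Oz; apply: fM; exact: uC.
- exists (C + D); near=> eps => z Oz.
  by apply: le_trans (ler_normD _ _) _; apply: lerD; move: z Oz; near: eps; [exact: gC|exact: hD].
- exists (C * D); near=> eps => z Oz.
  by rewrite normrM; apply: ler_pM => //; move: z Oz; near: eps; [exact: gC|exact: hD].
Unshelve. all: by end_near. Qed.

Lemma comp_bounded_deriv s : bounded_deriv T u [::] ->
  (forall s', subseq s' s -> bounded_deriv T u s') ->
  bounded_deriv T (fun eps z => f (u eps z)) s.
Proof.
move=> u0 us'; have [->|s0] := eqVneq s [::].
  exact: (chain_poly_bounded u0 us' (CPf _ 0)).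
have [g gA gE] := partials_comp s0.
have gA' : chain_poly (fun s' => subseq s' s) (fun eps z =>
   derive1n 1 f (u eps z) * partials s (u eps) z + g eps z).
  have Bs : (fun s' => subseq s' s) s by exact: subseq_refl.
  apply: CPadd (CPmul (CPf _ 1) (CPd Bs)) _.
  by apply: chain_poly_sub gA => s' [].
have [C hC] := chain_poly_bounded u0 us' gA'.
exists C; near=> eps => z Oz; rewrite gE//; last by near: eps; exact: near0_01.
by move: z Oz; near: eps; exact: hC.
Unshelve. all: by end_near. Qed.

End ChainRuleNets.

Section WaveOperator.
Context {R : realType} {d : nat}.
Implicit Types (s : seq 'I_d.+1) (F G : 'rV[R]_d.+1 -> R) (O : set 'rV[R]_d.+1).

Lemma partials_sum O n (F : 'I_n -> 'rV[R]_d.+1 -> R) s z : open O ->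
  (forall i, smooth_on O (F i)) -> O z ->
  partials s (fun z => \sum_i F i z) z = \sum_i partials s (F i) z.
Proof.
move=> oO Fs; elim: s z => [//|j s IH] z Oz /=.
rewrite (@partial_near _ _ j _ (fun z => \sum_i partials s (F i) z)).
  have D := is_derive_bigsum (fun i => smooth_on_is_derive j (smooth_on_partials s (Fs i)) Oz).
  exact: (@derive_val _ _ _ _ _ _ _ D).
by apply: near_eq_on oO Oz _ => y Oy; exact: IH.
Qed.

Lemma partials_box O F s z : open O -> smooth_on O F -> O z ->
  partials s (box F) z = partials (s ++ [:: ord0; ord0]) F z -
    \sum_(i < d) partials (s ++ [:: li i; li i]) F z.
Proof.
move=> oO Fs Oz.
have Fii i : smooth_on O (partial i (partial i F)) by exact: smooth_on_partials [:: i; i] Fs.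
rewrite (partials_sub s oO (Fii ord0) (smooth_lap oO Fs) Oz).
rewrite (partials_sum s oO (fun i => Fii (li i)) Oz) partials_cat; congr (_ - _).
by apply: eq_bigr => i _; rewrite partials_cat.
Qed.

Lemma box_partials O F s z : open O -> smooth_on O F -> O z ->
  box (partials s F) z = partials s (box F) z.
Proof.
move=> oO Fs Oz; rewrite (partials_box s oO Fs Oz) /box /lap.
have E i : partials (s ++ [:: i; i]) F z = partial i (partial i (partials s F)) z.
  rewrite -[RHS]/(partials ([:: i; i] ++ s) F z); apply: partials_perm oO Fs Oz _.
  by rewrite perm_catC.
by rewrite E; congr (_ - _); apply: eq_bigr => i _; rewrite E.
Qed.

Lemma box_sub O F G z : open O -> smooth_on O F -> smooth_on O G -> O z ->
  box (fun z => F z - G z) z = box F z - box G z.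
Proof.
move=> oO Fs Gs Oz.
have E i : partial i (partial i (fun z => F z - G z)) z =
   partial i (partial i F) z - partial i (partial i G) z.
  exact: (partials_sub [:: i; i] oO Fs Gs Oz).
have L : lap (fun z => F z - G z) z = lap F z - lap G z.
  by rewrite /lap -sumrB; apply: eq_bigr => i _; exact: E.
by rewrite {1}/box (E ord0) L opprD addrACA -opprD.
Qed.

End WaveOperator.

(** * Supports in a compact box *)

Section CompactSupport.
Context {R : realType} {d : nat}.
Variables (T r : R).
Hypothesis T0 : 0 < T.
Implicit Types (s : seq 'I_d.+1) (u g : 'rV[R]_d.+1 -> R) (z : 'rV[R]_d.+1).
Local Notation O := (@open_slab R d T).
Local Notation oO := (@open_open_slab R d T).

(** A box around K_0, where |x| <= t + r <= T + r; its compactness is read off from the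
    coordinates. *)
Definition slab_box : set 'rV[R]_d.+1 :=
  [set z | forall i, `[if i == ord0 then 0 else - (T + r), if i == ord0 then T else T + r]%classic
    (z ord0 i)].

Lemma compact_slab_box : compact slab_box.
Proof.
apply: (@rV_compact R d.+1 (fun i => `[if i == ord0 then 0 else - (T + r),
   if i == ord0 then T else T + r]%classic)) => i.
exact: segment_compact.
Qed.

Lemma slab_box_slab : slab_box `<=` slab T.
Proof. by move=> z /(_ ord0); rewrite /= in_itv. Qed.

Lemma origin_cone_slab_box : origin_cone T r `<=` slab_box.
Proof.
move=> z [/andP[z0 zT] zr]; apply: ord_cases => [|i]; rewrite /= in_itv /=; first by apply/andP.
rewrite -ler_norml; apply: le_trans (_ : enorm (space z) <= _); last first.
  by apply: le_trans zr _; rewrite lerD2r.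
have zi : z ord0 (lift ord0 i) = space z ord0 i by rewrite mxE.
rewrite zi /enorm -sqrtr_sqr ler_wsqrtr// (bigD1 i)//= lerDl.
by apply: sumr_ge0 => j _; exact: sqr_ge0.
Qed.

Lemma smooth_slab_support u s z : smooth_slab T u -> slab_support T u `<=` slab_box ->
  O z -> ~ slab_box z -> partials s u z = 0.
Proof.
move=> us uK Oz Kz; rewrite -(partials_cst0 s z).
apply: (@partials_eq_on _ _ (O `&` ~` slab_support T u)) => //.
- by apply: openI; [exact: oO|apply: closed_openC; exact: closed_closure].
- move=> y [Oy uy]; apply/eqP; apply: contrapT => y0; apply: uy; apply: subset_closure.
  split; first exact: open_slab_slab.
  by rewrite val_extE xt_open//; exact/negP.
- by split => // /uK.
Qed.

(* A bound in terms of half of itself holds without that term, since the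
   supremum is attained and thus finite. *)
Lemma absorb_half g c : continuous (fun z => g (clamp T z)) ->
  (forall z, O z -> ~ slab_box z -> g z = 0) -> 0 <= c ->
  (forall A, 0 <= A -> (forall y, O y -> `|g y| <= A) -> forall y, O y -> `|g y| <= c + A / 2) ->
  forall y, O y -> `|g y| <= 2 * c.
Proof.
move=> gc g0 c0 H y Oy.
have gK z : ~ slab_box z -> O z -> `|g z| <= 2 * c.
  by move=> Kz Oz; rewrite (g0 z Oz Kz) normr0 mulr_ge0.
have [Ky|] := pselect (slab_box y); last by move=> /gK; apply.
have [|x Kx xmax] := @compact_EVT_max _ R (fun z => `|g (clamp T z)|) _ (ex_intro _ y Ky)
    compact_slab_box.
  apply: continuous_subspaceT; apply: continuous_pointwise => x.
  by apply: (@continuous_comp _ _ _ (fun z => g (clamp T z))); [exact: gc|exact: norm_continuous].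
move: Kx; rewrite inE => Kx; have Sx := slab_box_slab Kx.
have gx z : O z -> `|g z| <= `|g x|.
  move=> Oz; have [Kz|Kz] := pselect (slab_box z); last by rewrite (g0 z Oz Kz) normr0.
  have := xmax z; rewrite inE => /(_ Kz).
  by rewrite !clamp_slab//; exact: slab_box_slab.
have gA := H `|g x| (normr_ge0 _) gx.
(* The maximum point x may lie on the boundary of the slab, where the improved bound holds by
   continuity. *)
have := slab_le T0 gc gA Sx; have := gx y Oy.
by move: `|g x| `|g y| => a b; lra.
Qed.

End CompactSupport.

(** * Bounds for a supported solution *)

Section Solution.
Context {R : realType} {d : nat}.
Variables (T r : R) (f e : R -> R) (u0 u1 : R -> 'rV[R]_d -> R).
Hypotheses (d3 : (d <= 3)%N) (T0 : 0 < T) (fs : smooth_fun f) (f0 : f 0 = 0).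
Hypothesis he : exists2 b : R, 0 < b & Opow (fun eps : R => `|e eps|) b.
Hypotheses (u0s : forall eps : R, 0 < eps <= 1 -> smooth_on setT (u0 eps))
  (u1s : forall eps : R, 0 < eps <= 1 -> smooth_on setT (u1 eps)).
Hypotheses (u0b : forall s, exists C : R, \forall eps \near (0 : R)^'+, forall x, `|partials s (u0 eps) x| <= C)
  (u1b : forall s, exists C : R, \forall eps \near (0 : R)^'+, forall x, `|partials s (u1 eps) x| <= C).
Local Notation E := 'rV[R]_d.+1.
Local Notation O := (@open_slab R d T).
Local Notation oO := (@open_open_slab R d T).
Variables (u m : R -> E -> R).
Hypotheses (us : smooth_net T u) (mv : vanishing T m).
Hypothesis um : forall eps : R, 0 < eps <= 1 ->
  [/\ forall z, slab T z -> pderiv_ext T ord0 2 (u eps) z - laplacian T (u eps) z =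
        e eps * f (val_ext T (u eps) z) + val_ext T (m eps) z,
      forall z, time z = 0 -> val_ext T (u eps) z = u0 eps (space z)
    & forall z, time z = 0 -> pderiv_ext T ord0 1 (u eps) z = u1 eps (space z)].
Hypothesis uK : forall eps : R, 0 < eps <= 1 -> slab_support T (u eps) `<=` origin_cone T r.
Implicit Types (eps : R) (z y : E) (s : seq 'I_d.+1).

Let uO eps (e01 : 0 < eps <= 1) : smooth_on O (u eps) := smooth_slab_smooth (us e01).
Let mO eps (e01 : 0 < eps <= 1) : smooth_on O (m eps) := smooth_slab_smooth ((proj1 mv) eps e01).

Lemma solution_box eps z : 0 < eps <= 1 -> O z ->
  box (u eps) z = e eps * f (u eps z) + m eps z.
Proof.
move=> e01 Oz; have Sz := open_slab_slab Oz; have [H _ _] := um e01.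
have ue := us e01; have me := (proj1 mv) eps e01.
move: (H z Sz); rewrite pderiv_extE laplacianE !val_extE (xt_open T0 [::] ue Oz).
rewrite (xt_open T0 [::] me Oz) => <-; rewrite (xt_open T0 _ ue Oz) /box /lap /=.
by congr (_ - _); apply: eq_bigr => i _; rewrite (xt_open T0 _ ue Oz).
Qed.

Lemma solution_support s eps z : 0 < eps <= 1 -> O z -> ~ slab_box T r z ->
  partials s (u eps) z = 0.
Proof.
move=> e01; apply: smooth_slab_support => //; first exact: us.
by move=> y /(uK e01); exact: origin_cone_slab_box.
Qed.

(** On the open set off the box u vanishes with its derivatives, hence so does m = box u - e f(u),
    as f 0 = 0. *)
Lemma remainder_support s eps z : 0 < eps <= 1 -> O z -> ~ slab_box T r z ->
  partials s (m eps) z = 0.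
Proof.
move=> e01 Oz Kz; rewrite -(partials_cst0 s z).
have Kc : closed (@slab_box R d T r).
  exact: @compact_closed 'rV[R]_d.+1 _ (@norm_hausdorff _ _) (@compact_slab_box R d T r).
apply: (@partials_eq_on _ _ (O `&` ~` slab_box T r)) => //.
  by apply: openI; [exact: oO|exact: closed_openC].
move=> y [Oy Ky]; have := solution_box e01 Oy.
rewrite -[u eps y]/(partials [::] (u eps) y) solution_support// f0 mulr0 add0r => <-.
rewrite /box /lap -[partial ord0 _ y]/(partials [:: ord0; ord0] (u eps) y) solution_support//.
rewrite sub0r big1 ?oppr0// => i _.
by rewrite -[LHS]/(partials [:: li i; li i] (u eps) y) solution_support.
Qed.

(** Decay on the compact box is decay on the whole slab, because m vanishes elsewhere. *)
Lemma remainder_small s k : small_deriv T m s k.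
Proof.
have H := vanishing_bound T0 s k mv (@compact_slab_box R d T r) (@slab_box_slab R d T r).
rewrite /small_deriv; near=> eps => z Oz.
have e01 : 0 < eps <= 1 by near: eps; exact: near0_01.
have [Kz|Kz] := pselect (slab_box T r z); last first.
  by rewrite remainder_support// normr0 exprn_ge0//; case/andP: e01 => /ltW.
rewrite -(xt_open T0 s ((proj1 mv) eps e01) Oz).
by move: z Kz {Oz}; near: eps; exact: H.
Unshelve. all: by end_near. Qed.

Let p0 := picard0 u0 u1.

Let p0b : bounded_net T p0.
Proof. exact: bounded_net_picard0. Qed.

Let p0s eps (e01 : 0 < eps <= 1) : smooth_slab T (p0 eps).
Proof. by apply: smooth_slab_global => //; case: p0b => + _; apply. Qed.

Let p0O eps (e01 : 0 < eps <= 1) : smooth_on O (p0 eps) := smooth_slab_smooth (p0s e01).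

(** Subtracting the zeroth iterate, which has the same initial data, makes [zero_data_bound]
    applicable. *)
Let v eps z := u eps z - p0 eps z.

Let vs eps (e01 : 0 < eps <= 1) : smooth_slab T (v eps).
Proof. exact: smooth_slab_sub (us e01) (p0s e01). Qed.

Lemma solution_init eps z : 0 < eps <= 1 -> time z = 0 ->
  xt T [::] (v eps) z = 0 /\ xt T [:: ord0] (v eps) z = 0.
Proof.
move=> e01 z0; have Sz : slab T z by rewrite /slab /= z0 lexx ltW.
have [_ H0 H1] := um e01.
have [P0 P1] := picard_init T fs he u0s u1s u0b u1b 0 e01 z0.
have {}P0 : partials [::] (p0 eps) z = u0 eps (space z) := P0.
have {}P1 : partials [:: ord0] (p0 eps) z = u1 eps (space z) := P1.
have p0g : smooth_on setT (p0 eps) by case: p0b => + _; apply.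
have := H0 z z0; have := H1 z z0; rewrite pderiv_extE val_extE => {}H1 {}H0.
by rewrite !(xt_sub T0 _ (us e01) (p0s e01) Sz) H0 H1 !(xt_global T0 _ p0g Sz) P0 P1 !subrr.
Qed.

Lemma xt_time0_spatial (s' : seq 'I_d) s (w : E -> R) : smooth_slab T w ->
  (forall z, time z = 0 -> xt T s w z = 0) ->
  forall z, time z = 0 -> xt T (map li s' ++ s) w z = 0.
Proof. by move=> ws w0; elim: s' => [//|i s' IH] z z0 /=; exact: xt_time0_lift. Qed.

Lemma spatial_apriori (s' : seq 'I_d) : exists2 C : R, 0 <= C &
  \forall eps \near (0 : R)^'+, forall z (M : R), O z -> 0 <= M ->
    (forall y, O y -> time y < time z ->
      `|e eps * partials (map li s') (fun y => f (u eps y)) y| <= M) ->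
    `|partials (map li s') (u eps) z| <= C + wave_cst T * M.
Proof.
set s := map li s'.
have [_ /(_ s)[C0 pC0]] := p0b.
have [_ /(_ s)[C1 pC1]] := bounded_net_box p0b.
have mC := remainder_small s 0.
have W0 := wave_cst_ge0 T.
(* [C0] bounds the derivative of [p0], [C1] that of box [p0], and 1 = eps^0 that of the
   remainder. *)
exists (`|C0| + wave_cst T * (1 + `|C1|)).
  by rewrite addr_ge0// mulr_ge0// addr_ge0.
near=> eps => z M Oz M0 fM.
have e01 : 0 < eps <= 1 by near: eps; exact: near0_01.
have fuO : smooth_on O (fun y => f (u eps y)) by exact: smooth_on_comp oO fs (uO e01).
have ws := smooth_slab_partials T0 s (vs e01).
have Sz0 y : time y = 0 -> slab T y by move=> y0; rewrite /slab /= y0 lexx ltW.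
have w0 y : time y = 0 -> xt T [::] (partials s (v eps)) y = 0.
  move=> y0; rewrite (xt_partials T0 s [::] (vs e01) (Sz0 y y0)) -(cats0 (_ ++ _)).
  by apply: xt_time0_spatial (vs e01) _ y y0 => x /(solution_init e01)[].
have w1 y : time y = 0 -> xt T [:: ord0] (partials s (v eps)) y = 0.
  move=> y0; rewrite (xt_partials T0 s [:: ord0] (vs e01) (Sz0 y y0)).
  rewrite (@xt_perm _ _ T _ (s ++ [:: ord0])); last by rewrite perm_catC.
  by apply: xt_time0_spatial (vs e01) _ y y0 => x /(solution_init e01)[].
have bw y : O y -> time y < time z -> `|box (partials s (v eps)) y| <= M + (1 + `|C1|).
  move=> Oy yz; have Sy := open_slab_slab Oy.
  rewrite (box_partials s oO (smooth_slab_smooth (vs e01)) Oy).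
  have -> : partials s (box (v eps)) y = partials s (fun y =>
      (e eps * f (u eps y) + m eps y) - box (p0 eps) y) y.
    apply: (partials_eq_on s oO) Oy => x Ox.
    by rewrite (box_sub oO (uO e01) (p0O e01) Ox) solution_box.
  have efO : smooth_on O (fun y => e eps * f (u eps y)) by exact: smooth_onZ oO fuO.
  rewrite (partials_sub s oO (smooth_onD oO efO (mO e01)) (smooth_box oO (p0O e01)) Oy).
  rewrite (partials_add s oO efO (mO e01) Oy) (partials_scale _ s oO fuO Oy) -addrA.
  apply: le_trans (ler_normD _ _) _; apply: lerD; first exact: fM.
  apply: le_trans (ler_normB _ _) _; apply: lerD.
    rewrite -(expr0 eps).
    by move: y Oy {yz Sy}; near: eps; exact: mC.
  apply: le_trans (ler_norm C1); move: y Sy {Oy yz}; near: eps; exact: pC1.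
have := zero_data_bound T0 d3 ws w0 w1 Oz (addr_ge0 M0 (addr_ge0 ler01 (normr_ge0 C1))) bw.
rewrite (partials_sub s oO (uO e01) (p0O e01) Oz) => H.
rewrite -(subrK (partials s (p0 eps) z) (partials s (u eps) z)).
apply: le_trans (ler_normD _ _) _; rewrite -addrA -mulrDr [leRHS]addrC.
apply: lerD; first by rewrite [1 + _ + M]addrC.
apply: le_trans (ler_norm C0).
by have := open_slab_slab Oz; move: (z); near: eps; exact: pC0.
Unshelve. all: by end_near. Qed.

(* Continuity argument: at the first time where |u| reaches the level M, the
   a priori bound from the past gives a smaller value. *)
Lemma solution_bounded : bounded_deriv T u [::].
Proof.
have [C C0 uC] := spatial_apriori [::].
have W0 := wave_cst_ge0 T.
have [_ /(_ [::])[D pD]] := p0b.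
(* As long as |u| <= M, smallness of e gives |e f(u)| <= 1 and hence |u| <= C + [wave_cst T]. M
   exceeds this by at least 1 and also exceeds the bound [|D|] of the initial values. *)
pose M := C + wave_cst T + 1 + `|D|; have M0 : 0 < M by rewrite ltr_wpDr// ltr_wpDl// addr_ge0.
have [L L0 fL] := continuous_bounded_on M (@smooth_fun_continuous R f 0 fs).
have eL : \forall eps \near (0 : R)^'+, `|e eps| <= (L + 1)^-1.
  by apply: coupling_small => //; rewrite invr_gt0 ltr_wpDl.
exists M; near=> eps => z Oz; rewrite leNgt; apply/negP => Mz.
have e01 : 0 < eps <= 1 by near: eps; exact: near0_01.
have ue := us e01.
pose ux z := xt T [::] (u eps) (clamp T z).
have uxc : continuous ux by exact: (xt_clamp_continuous T0).
have uxO y : O y -> ux y = u eps y.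
  by move=> Oy; rewrite /ux clamp_slab ?xt_open//; exact: open_slab_slab.
(* The non-strict inequality and the extension to the closed slab make this set compact, so it has a
   point of least time. *)
pose Bad := slab_box T r `&` [set y | M <= `|ux y|].
have BadO y : O y -> M <= `|u eps y| -> Bad y.
  move=> Oy My; split; last by rewrite /= uxO.
  apply: contrapT => /(solution_support [::] e01 Oy) /= uy0.
  by move: My; rewrite uy0 normr0 leNgt M0.
have cBad : compact Bad.
  apply: compact_closedI; first exact: compact_slab_box.
  rewrite (_ : mkset _ = (fun y => `|ux y|) @^-1` [set x | M <= x]); last by [].
  apply: closed_comp; last exact: closed_ge.
  move=> y _; apply: (@continuous_comp _ _ _ ux); [exact: uxc|exact: norm_continuous].
have Bad0 : Bad !=set0 by exists z; apply: BadO => //; exact: ltW.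
have [|x] := @compact_EVT_min _ R (@time R d) Bad Bad0 cBad.
  by apply: continuous_subspaceT; exact: time_continuous.
move=> /set_mem[Kx Mx] xmin; have Sx := slab_box_slab Kx.
have past y : O y -> time y < time x -> `|u eps y| <= M.
  move=> Oy yx; rewrite leNgt; apply/negP => /ltW My.
  have := xmin y (mem_set (BadO y Oy My)).
  by rewrite leNgt yx.
have xD : time x = 0 -> `|ux x| <= `|D|.
  move=> x0; have [ + _] := solution_init e01 x0.
  rewrite (xt_sub T0 _ ue (p0s e01) Sx) /ux clamp_slab// => /eqP; rewrite subr_eq0 => /eqP ->.
  rewrite xt_global//; last by case: p0b => + _; apply.
  by apply: le_trans (ler_norm D); move: x Sx {Kx Mx xmin past x0}; near: eps; exact: pD.
have x0 : 0 < time x.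
  rewrite lt_neqAle eq_sym (andP Sx).1 andbT; apply/eqP => x0.
  have := le_trans Mx (xD x0); rewrite leNgt => /negP; apply.
  by rewrite /M ltrDr ltr_wpDl// addr_ge0.
have h0 : 0 < 1 / 2 :> R by [].
have /cvgrPdist_le/(_ _ h0) G := uxc x.
(* x may lie on t = T, so the a priori bound is applied at an earlier interior point y whose value
   differs by at most 1 / 2. *)
have [y [Gy Oy /(_ x0) yx]] := slab_dense T0 Sx G.
have uy : `|u eps y| <= C + wave_cst T * 1.
  have : forall z (M : R), O z -> 0 <= M -> (forall y, O y -> time y < time z ->
      `|e eps * f (u eps y)| <= M) -> `|u eps z| <= C + wave_cst T * M.
    by near: eps; exact: uC.
  apply => // y' Oy' yy'; rewrite normrM.
  apply: le_trans (_ : (L + 1)^-1 * L <= _).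
    apply: ler_pM => //; first by near: eps; exact: eL.
    by apply: fL; exact: past (lt_trans yy' yx).
  by rewrite mulrC ler_pdivrMr ?ltr_wpDl// mul1r lerDl.
move: Gy; rewrite /= (uxO y Oy) => Gy.
have := le_trans Mx (le_trans (_ : `|ux x| <= `|ux x - u eps y| + `|u eps y|) (lerD Gy uy)).
rewrite -{1}(subrK (u eps y) (ux x)) ler_normD => /(_ isT).
have := normr_ge0 D; rewrite /M; move: (wave_cst T) `|D| => W B; lra.
Unshelve. all: by end_near. Qed.

Lemma subseq_map_lift (s' : seq 'I_d) s : subseq s (map li s') ->
  exists2 s'', s = map li s'' & subseq s'' s'.
Proof.
by move=> /subseqP[b bs ->]; exists (mask b s'); rewrite -?map_mask ?mask_subseq.
Qed.

Lemma spatial_bounded (s' : seq 'I_d) : bounded_deriv T u (map li s').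
Proof.
have [n] := ubnP (size s'); elim: n s' => // n IH s' sn.
have [->|s0] := eqVneq s' [::]; first exact: solution_bounded.
set s := map li s'.
have s0' : s != [::] by rewrite -size_eq0 size_map size_eq0.
have uO' : smooth_net_on T u by move=> eps; exact: uO.
have [g gA gE] := partials_comp fs uO' s0'.
have [G gG] : exists C : R, \forall eps \near (0 : R)^'+, forall z, O z -> `|g eps z| <= C.
  apply: (chain_poly_bounded fs solution_bounded _ gA) => t [] /subseq_map_lift[s'' -> _].
  by rewrite !size_map => ss; apply: IH; apply: leq_trans ss _.
have [L L0 fL] : exists2 L : R, 0 <= L & \forall eps \near (0 : R)^'+,
    forall z, O z -> `|derive1n 1 f (u eps z)| <= L.
  have [D uD] := solution_bounded.
  have [L L0 fL] := continuous_bounded_on D (@smooth_fun_continuous R f 1 fs).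
  by exists L => //; apply: filterS uD => eps uD z Oz; apply: fL; exact: uD.
have [C C0 uC] := spatial_apriori s'.
have W0 := wave_cst_ge0 T.
have WL0 : 0 <= wave_cst T * L by rewrite mulr_ge0.
(* Chosen so that [wave_cst T] times L |e| is at most 1 / 2: the top-order term f'(u) d_s u can then
   be absorbed. The summand 1 allows L = 0. *)
have eL : \forall eps \near (0 : R)^'+, `|e eps| <= (2 * (wave_cst T * L) + 1)^-1.
  by apply: coupling_small => //; rewrite invr_gt0 ltr_wpDl// mulr_ge0.
have e1 := coupling_small he (@ltr01 R).
exists (2 * (C + wave_cst T * `|G|)); near=> eps => z Oz.
have e01 : 0 < eps <= 1 by near: eps; exact: near0_01.
rewrite -(xt_open T0 s (us e01) Oz).
have c0 : 0 <= C + wave_cst T * `|G| by rewrite addr_ge0// mulr_ge0.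
apply: (absorb_half (r := r) T0 (xt_clamp_continuous T0 (us e01))) Oz => //.
  by move=> y Oy Ky; rewrite xt_open ?solution_support//; exact: us.
move=> A A0 uA y Oy; rewrite xt_open//; last exact: us.
have : forall z (M : R), O z -> 0 <= M -> (forall y, O y -> time y < time z ->
    `|e eps * partials s (fun y => f (u eps y)) y| <= M) ->
    `|partials s (u eps) z| <= C + wave_cst T * M.
  by near: eps; exact: uC.
move=> /(_ y (`|e eps| * (L * A) + `|G|) Oy) H.
apply: le_trans (H _ _) _.
- by rewrite addr_ge0// mulr_ge0// mulr_ge0.
- move=> x Ox _; rewrite gE// mulrDr; apply: le_trans (ler_normD _ _) _; rewrite !normrM.
  apply: lerD.
    apply: ler_wpM2l => //; apply: ler_pM => //; first by move: x Ox; near: eps; exact: fL.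
    by rewrite -(xt_open T0 s (us e01) Ox); exact: uA.
  rewrite -[leRHS]mul1r; apply: ler_pM => //; first by near: eps; exact: e1.
  by apply: le_trans (ler_norm G); move: x Ox; near: eps; exact: gG.
- have WLe : wave_cst T * L * `|e eps| <= 1 / 2.
    apply: le_trans (_ : wave_cst T * L * (2 * (wave_cst T * L) + 1)^-1 <= _).
      by apply: ler_wpM2l => //; near: eps; exact: eL.
    have D0 : 0 < 2 * (wave_cst T * L) + 1 by rewrite ltr_wpDl// (mulr_ge0 _ WL0).
    rewrite ler_pdivrMr//.
    by move: WL0; move: (wave_cst T * L) => a; lra.
  have := ler_wpM2r A0 WLe.
  move: (wave_cst T) `|e eps| `|G| => W a b; have -> : W * L * a * A = W * (a * (L * A)) by ring.
  by rewrite mulrDr; lra.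
Unshelve. all: by end_near. Qed.

Let bounded_perm s s' : perm_eq s s' -> bounded_deriv T u s -> bounded_deriv T u s'.
Proof.
move=> ss' [C uC]; exists C; near=> eps => z Oz.
have e01 : 0 < eps <= 1 by near: eps; exact: near0_01.
rewrite -(partials_perm oO (uO e01) Oz ss').
by move: z Oz; near: eps; exact: uC.
Unshelve. all: by end_near. Qed.

Let perm_time s k : count_mem ord0 s = k.+1 ->
  exists2 s', perm_eq (ord0 :: s') s & count_mem ord0 s' = k.
Proof.
move=> sk; have s0 : (ord0 : 'I_d.+1) \in s by rewrite -has_pred1 has_count sk.
exists (rem ord0 s); first by rewrite perm_sym perm_to_rem.
have := permP (perm_to_rem s0) (pred1 ord0); rewrite sk /= ?eqxx ?add1n => -[] <-.
by [].
Qed.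

(** The equation, differentiated along s and solved for the term with d_t^2. The Laplacian raises
    the spatial order, so the hypothesis allows any number of spatial derivatives. *)
Lemma time_step s : (forall s', (count_mem ord0 s' <= count_mem ord0 s)%N -> bounded_deriv T u s') ->
  bounded_deriv T u (s ++ [:: ord0; ord0]).
Proof.
move=> H; have uO' : smooth_net_on T u by move=> eps; exact: uO.
have [C fC] : bounded_deriv T (fun eps z => f (u eps z)) s.
  apply: (comp_bounded_deriv fs uO'); first by apply: H.
  by move=> s' ss'; apply: H; exact: leq_count_subseq.
have mC := remainder_small s 0.
have e1 := coupling_small he (@ltr01 R).
have /choice[D Dle] : forall i : 'I_d, exists C : R, \forall eps \near (0 : R)^'+,
    forall z, O z -> `|partials (s ++ [:: li i; li i]) (u eps) z| <= C.
  by move=> i; apply: H; rewrite count_cat /= !addn0.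
have Dall : \forall eps \near (0 : R)^'+, forall i, forall z, O z ->
    `|partials (s ++ [:: li i; li i]) (u eps) z| <= D i.
  exact: (@filter_forall _ _ (fun i eps => forall z, O z ->
    `|partials (s ++ [:: li i; li i]) (u eps) z| <= D i) _ (at_right_proper_filter (0:R)) Dle).
exists (C + 1 + \sum_(i < d) D i); near=> eps => z Oz.
have e01 : 0 < eps <= 1 by near: eps; exact: near0_01.
have fuO : smooth_on O (fun y => f (u eps y)) by exact: smooth_on_comp oO fs (uO e01).
have efO : smooth_on O (fun y => e eps * f (u eps y)) by exact: smooth_onZ oO fuO.
have := partials_box s oO (uO e01) Oz.
rewrite (partials_eq_on s oO (fun y Oy => solution_box e01 Oy) Oz).
rewrite (partials_add s oO efO (mO e01) Oz) (partials_scale _ s oO fuO Oz).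
move=> /eqP; rewrite eq_sym subr_eq => /eqP ->.
apply: le_trans (ler_normD _ _) _; apply: lerD.
  apply: le_trans (ler_normD _ _) _; apply: lerD.
    rewrite normrM -[leRHS]mul1r; apply: ler_pM => //; first by near: eps; exact: e1.
    by move: z Oz; near: eps; exact: fC.
  by rewrite -(expr0 eps); move: z Oz; near: eps; exact: mC.
apply: le_trans (ler_norm_sum _ _ _) _; apply: ler_sum => i _.
by move: i z Oz; near: eps; exact: Dall.
Unshelve. all: by end_near. Qed.

Lemma solution_bounded_deriv s : bounded_deriv T u s.
Proof.
have H0 s' : count_mem ord0 s' = 0%N -> bounded_deriv T u s'.
  move=> s0; suff [s'' ->] : exists s'' : seq 'I_d, s' = map li s'' by exact: spatial_bounded.
  elim: s' s0 => [|i s' IH]; first by exists [::].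
  move: i; apply: ord_cases => [|i] //= /IH[s'' ->].
  by exists (i :: s'').
have [n] := ubnP (count_mem ord0 s); elim: n s => // n IH s.
case sk: (count_mem ord0 s) => [|[|k]] kn; first exact: H0.
  (* The equation raises the number of time derivatives by two. A single one is obtained from none
     and two by interpolation with the fixed step T / 4. *)
  have [s' ss' s0] := perm_time sk; apply: (bounded_perm ss').
  have [A uA] := H0 s' s0.
  have [B uB] : bounded_deriv T u [:: ord0, ord0 & s'].
    apply: (@bounded_perm (s' ++ [:: ord0; ord0])); first by rewrite perm_catC.
    apply: time_step => t; rewrite s0 leqn0 => /eqP; exact: H0.
  have h0 : 0 < T / 4 by rewrite divr_gt0.
  have hT : T / 4 < T / 2 by lra.
  exists (2 * A / (T / 4) + T / 4 * B); near=> eps => z Oz.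
  have e01 : 0 < eps <= 1 by near: eps; exact: near0_01.
  apply: (interpolation (smooth_on_partials s' (uO e01)) h0 hT) Oz.
    by near: eps; exact: uA.
  by near: eps; exact: uB.
have [s1 ss1 s1k] := perm_time sk; have [s2 ss2 s2k] := perm_time s1k.
apply: (@bounded_perm (s2 ++ [:: ord0; ord0])).
  by rewrite perm_catC; apply: perm_trans ss1; rewrite /= perm_cons.
apply: time_step => t; rewrite s2k => tk; apply: IH.
by apply: leq_ltn_trans tk _; rewrite -ltnS; exact: ltnW.
Unshelve. all: by end_near. Qed.

End Solution.

Section Uniqueness.
Context {R : realType} {d : nat}.
Variables (T r : R) (f e : R -> R) (u0 u1 : R -> 'rV[R]_d -> R).
Hypotheses (d3 : (d <= 3)%N) (T0 : 0 < T) (fs : smooth_fun f) (f0 : f 0 = 0).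
Hypothesis he : exists2 b : R, 0 < b & Opow (fun eps : R => `|e eps|) b.
Hypotheses (u0s : forall eps : R, 0 < eps <= 1 -> smooth_on setT (u0 eps))
  (u1s : forall eps : R, 0 < eps <= 1 -> smooth_on setT (u1 eps)).
Hypotheses (u0b : forall s, exists C : R, \forall eps \near (0 : R)^'+, forall x, `|partials s (u0 eps) x| <= C)
  (u1b : forall s, exists C : R, \forall eps \near (0 : R)^'+, forall x, `|partials s (u1 eps) x| <= C).
Local Notation E := 'rV[R]_d.+1.
Local Notation O := (@open_slab R d T).
Local Notation oO := (@open_open_slab R d T).

Lemma uniqueness (u v : R -> E -> R) : smooth_net T u -> smooth_net T v ->
  solves T f e u0 u1 u -> solves T f e u0 u1 v ->
  (forall eps : R, 0 < eps <= 1 -> slab_support T (u eps) `<=` origin_cone T r /\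
     slab_support T (v eps) `<=` origin_cone T r) ->
  vanishing T (fun (eps : R) z => u eps z - v eps z).
Proof.
move=> us vs [m [mv um]] [n [nv vn]] uvK.
have uK eps e01 := (uvK eps e01).1; have vK eps e01 := (uvK eps e01).2.
have ub s := solution_bounded_deriv d3 T0 fs f0 he u0s u1s u0b u1b us mv um uK s.
have vb s := solution_bounded_deriv d3 T0 fs f0 he u0s u1s u0b u1b vs nv vn vK s.
have ws eps (e01 : 0 < eps <= 1) : smooth_slab T (fun z => u eps z - v eps z).
  exact: smooth_slab_sub (us eps e01) (vs eps e01).
have uO eps (e01 : 0 < eps <= 1) := smooth_slab_smooth (us eps e01).
have vO eps (e01 : 0 < eps <= 1) := smooth_slab_smooth (vs eps e01).
apply: (vanishing_of T0 ws); apply: (interpolation_net T0).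
- by move=> eps e01; exact: smooth_slab_smooth (ws eps e01).
- move=> s; exists 1%N; apply: bounded_moderate.
  have [C uC] := ub s; have [D vD] := vb s; exists (C + D); near=> eps => z Oz.
  have e01 : 0 < eps <= 1 by near: eps; exact: near0_01.
  rewrite (partials_sub s oO (uO eps e01) (vO eps e01) Oz).
  apply: le_trans (ler_normB _ _) _; apply: lerD; move: z Oz; near: eps; [exact: uC|exact: vD].
move=> k; have [C uC] := ub [::]; have [D vD] := vb [::].
(* The uniform bounds on both solutions provide one Lipschitz constant for all small eps. *)
have [L L0 fL] := smooth_fun_lipschitz (Num.max C D) fs.
have W0 := wave_cst_ge0 T.
have WL0 : 0 <= wave_cst T * L by rewrite mulr_ge0.
have D0 : 0 < 2 * (wave_cst T * L) + 1 by rewrite ltr_wpDl// (mulr_ge0 _ WL0).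
have eL : \forall eps \near (0 : R)^'+, `|e eps| <= (2 * (wave_cst T * L) + 1)^-1.
  by apply: coupling_small => //; rewrite invr_gt0.
have mC := remainder_small T0 f0 us mv um uK [::] k.+1.
have nC := remainder_small T0 f0 vs nv vn vK [::] k.+1.
rewrite /small_deriv; near=> eps => z Oz.
have e01 : 0 < eps <= 1 by near: eps; exact: near0_01.
have [e0 e1] := andP e01; have wse := ws eps e01.
have ek : 0 <= eps ^+ k.+1 by rewrite exprn_ge0// ltW.
(* One factor 2 comes from [absorb_half], the other from the two remainders; the spare power of eps
   absorbs them together with [wave_cst T]. *)
apply: le_trans (_ : 2 * (wave_cst T * (2 * eps ^+ k.+1)) <= _); last first.
  by rewrite !mulrA; near: eps; exact: near0_absorb.
rewrite -(xt_open T0 [::] wse Oz).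
have c0 : 0 <= wave_cst T * (2 * eps ^+ k.+1) by exact: mulr_ge0 W0 (mulr_ge0 (ler0n R 2) ek).
apply: (absorb_half (r := r) T0 (xt_clamp_continuous T0 wse)) Oz => //.
  move=> y Oy Ky; rewrite (xt_open T0 _ wse Oy) /=.
  rewrite -[u eps y]/(partials [::] (u eps) y) -[v eps y]/(partials [::] (v eps) y).
  by rewrite (solution_support T0 us uK)// (solution_support T0 vs vK)// subrr.
move=> A A0 wA y Oy; rewrite (xt_open T0 _ wse Oy) /=.
have zero (i : nat) x : time x = 0 ->
    xt T (nseq i ord0) (u eps) x = xt T (nseq i ord0) (v eps) x ->
    xt T (nseq i ord0) (fun z => u eps z - v eps z) x = 0.
  move=> x0; have Sx : slab T x by rewrite /slab /= x0 lexx ltW.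
  by rewrite (xt_sub T0 _ (us eps e01) (vs eps e01) Sx) => ->; rewrite subrr.
have [_ ui0 ui1] := um eps e01; have [_ vi0 vi1] := vn eps e01.
have w0 x : time x = 0 -> xt T [::] (fun z => u eps z - v eps z) x = 0.
  move=> x0; apply: (zero 0%N) => //; have := ui0 x x0; have := vi0 x x0.
  by rewrite !val_extE /= => -> ->.
have w1 x : time x = 0 -> xt T [:: ord0] (fun z => u eps z - v eps z) x = 0.
  move=> x0; apply: (zero 1%N) => //; have := ui1 x x0; have := vi1 x x0.
  by rewrite !pderiv_extE => -> ->.
have M0 : 0 <= `|e eps| * (L * A) + 2 * eps ^+ k.+1.
  by rewrite addr_ge0 ?mulr_ge0.
have bw x : O x -> time x < time y ->
    `|box (fun z => u eps z - v eps z) x| <= `|e eps| * (L * A) + 2 * eps ^+ k.+1.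
  move=> Ox _; rewrite (box_sub oO (uO eps e01) (vO eps e01) Ox).
  rewrite (solution_box T0 us mv um e01 Ox) (solution_box T0 vs nv vn e01 Ox).
  rewrite opprD addrACA -mulrBr; apply: le_trans (ler_normD _ _) _; apply: lerD.
    rewrite normrM; apply: ler_wpM2l => //; apply: le_trans (fL _ _ _ _) _.
    - rewrite le_max; apply/orP; left; move: x Ox; near: eps; exact: uC.
    - rewrite le_max; apply/orP; right; move: x Ox; near: eps; exact: vD.
    - apply: ler_wpM2l => //.
      by have := wA x Ox; rewrite (xt_open T0 _ wse Ox).
  rewrite mulr_natl mulr2n; apply: le_trans (ler_normB _ _) _; apply: lerD.
    by move: x Ox; near: eps; exact: mC.
  by move: x Ox; near: eps; exact: nC.
apply: le_trans (zero_data_bound T0 d3 wse w0 w1 Oy M0 bw) _.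
have WLe : wave_cst T * L * `|e eps| <= 1 / 2.
  apply: le_trans (_ : wave_cst T * L * (2 * (wave_cst T * L) + 1)^-1 <= _).
    by apply: ler_wpM2l => //; near: eps; exact: eL.
  rewrite ler_pdivrMr//.
  by move: WL0; move: (wave_cst T * L) => a; lra.
have := ler_wpM2r A0 WLe.
move: (wave_cst T) `|e eps| (eps ^+ k.+1) => W a b.
have -> : W * L * a * A = W * (a * (L * A)) by ring.
by rewrite mulrDr; lra.
Unshelve. all: by end_near. Qed.

End Uniqueness.

Theorem corollary3p3 (R : realType) (d : nat) (T r : R) (f : R -> R)
    (e : R -> R) (u0 u1 : R -> 'rV[R]_d -> R)
    (hd : (1 <= d <= 3)%N) (hT : 0 < T) (hr : 0 <= r)
    (hf : smooth_fun f) (hf0 : f 0 = 0)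
    (he : exists2 b : R, 0 < b & Opow (fun eps : R => `|e eps|) b)
    (hu0 : forall eps : R, 0 < eps <= 1 ->
       [/\ smooth_on setT (u0 eps), compact (tsupport (u0 eps))
         & tsupport (u0 eps) `<=` origin_ball r])
    (hu1 : forall eps : R, 0 < eps <= 1 ->
       [/\ smooth_on setT (u1 eps), compact (tsupport (u1 eps))
         & tsupport (u1 eps) `<=` origin_ball r])
    (bu0 : forall a : multi_index d,
       (fun eps : R => sup_abs (origin_ball r) (mderiv a (u0 eps)))
         =O_ (0^'+) (cst 1 : R -> R))
    (bu1 : forall a : multi_index d,
       (fun eps : R => sup_abs (origin_ball r) (mderiv a (u1 eps)))
         =O_ (0^'+) (cst 1 : R -> R)) :
  (exists u : R -> 'rV[R]_d.+1 -> R,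
     moderate T u /\ solves T f e u0 u1 u) /\
  (forall u v : R -> 'rV[R]_d.+1 -> R,
     smooth_net T u -> smooth_net T v ->
     solves T f e u0 u1 u -> solves T f e u0 u1 v ->
     (forall eps : R, 0 < eps <= 1 ->
        slab_support T (u eps) `<=` origin_cone T r /\
        slab_support T (v eps) `<=` origin_cone T r) ->
     vanishing T (fun (eps : R) z => u eps z - v eps z)).
Proof.
have d3 : (d <= 3)%N by case/andP: hd.
have u0s eps : 0 < eps <= 1 -> smooth_on setT (u0 eps) by move=> /hu0[].
have u1s eps : 0 < eps <= 1 -> smooth_on setT (u1 eps) by move=> /hu1[].
have u0b := data_bound hu0 bu0; have u1b := data_bound hu1 bu1.
split; first exact: existence d3 hT hf he u0s u1s u0b u1b.
exact: (uniqueness (r := r) d3 hT hf hf0 he u0s u1s u0b u1b).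
Qed.
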